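(* Let $m\in H^\infty$ be inner, $H=H^2\ominus mH^2$ with $\dim H\ge2$, and $T=P_HS|_H$. Then $T^2$ is reducible if and only if either $m(\lambda)=m(-\lambda)$ for all $\lambda\in\mathbb D$, or there exists $\mu\in\mathbb D$ such that $$m(\lambda)=p(\lambda)\,\frac{\lambda+\mu}{1+\bar\mu\lambda}\quad(\lambda\in\mathbb D)$$ for some function $p\in H^\infty$ satisfying $p(\lambda)=p(-\lambda)$ for all $\lambda\in\mathbb D$.
   Context: $S$ is the unilateral shift $(Sh)(z)=zh(z)$ on the Hardy space $H^2$ of the unit disc $\mathbb D$; $P_H$ is the orthogonal projection onto $H$. Reducible means having a nontrivial (neither $\{0\}$ nor the whole space) closed subspace invariant under the operator and its adjoint. *)

(* Defs.v *)
From HB Require Import structures.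
From mathcomp Require Import all_boot all_order all_algebra.
From mathcomp Require Import all_classical all_reals all_analysis.
From mathcomp Require Import complex.
Set Implicit Arguments. Unset Strict Implicit. Unset Printing Implicit Defensive.
Import Order.TTheory GRing.Theory Num.Theory.
Import numFieldNormedType.Exports.
Local Open Scope classical_set_scope.
Local Open Scope ring_scope.
Local Open Scope complex_scope.

Definition Cx (R : realType) := R[i].
HB.instance Definition _ (R : realType) :=
  GRing.ComAlgebra.copy (Cx R) (Cx R)^o.
HB.instance Definition _ (R : realType) :=
  NormedModule.copy (Cx R) (Cx R)^o.

Section Hardy.
Variable R : realType.
Local Notation C := (Cx R).

Definition disc : set C := [set z | `|z| < 1].

(* H^2 is realised as the space of Taylor coefficient sequences
   h = (a_n) with sum |a_n|^2 < oo; h(z) = sum a_n z^n. *)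
Definition seqC := nat -> C.

Definition is_H2 (a : seqC) : Prop :=
  cvgn (series (fun n => (`|a n| ^+ 2 : C))).

Definition evalH2 (a : seqC) (z : C) : C :=
  limn (series (fun n => (a n * z ^+ n : C))).

Definition ipH2 (a b : seqC) : C := limn (series (fun n => (a n * (b n)^* : C))).
Definition nsqH2 (a : seqC) : C := limn (series (fun n => (`|a n| ^+ 2 : C))).

(* unilateral shift (S h)(z) = z h(z) *)
Definition shift (a : seqC) : seqC :=
  fun n => if n is n'.+1 then a n' else 0.

(* holomorphy on the disc: complex differentiability at each point *)
Definition holo_disc (f : C -> C) : Prop :=
  forall z, disc z -> derivable f z 1.

Definition is_Hinf (f : C -> C) : Prop :=
  holo_disc f /\ exists M : R, forall z, disc z -> `|f z| <= M%:C.

Definition inner_fun (m : C -> C) : Prop :=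
  is_Hinf m /\
  {ae (@lebesgue_measure R), forall t : R,
     exists l : C, `|l| = 1 /\
       (fun r : R => m (r%:C * ((cos t +i* sin t) : C))) @ (1 : R)^'- --> l}.

Definition mH2 (m : C -> C) : set seqC :=
  [set f | is_H2 f /\ exists g, is_H2 g /\
     forall z, disc z -> evalH2 f z = m z * evalH2 g z].

Definition model (m : C -> C) : set seqC :=
  [set f | is_H2 f /\ forall h, mH2 m h -> ipH2 f h = 0].

Definition projH (m : C -> C) (x : seqC) : seqC :=
  xget (fun _ => 0) [set y | model m y /\
     forall h, model m h -> ipH2 (x - y) h = 0].

Definition Tm (m : C -> C) (x : seqC) : seqC := projH m (shift x).

Definition dim_ge2 (K : set seqC) : Prop :=
  exists f1 f2, K f1 /\ K f2 /\
    forall a b : C, a *: f1 + b *: f2 = 0 -> a = 0 /\ b = 0.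

Definition closed_subspace (K M : set seqC) : Prop :=
  M `<=` K /\ M 0 /\
  (forall (a : C) x y, M x -> M y -> M (a *: x + y)) /\
  (forall (u : nat -> seqC) x, is_H2 x -> (forall k, M (u k)) ->
     (fun k => nsqH2 (u k - x)) @ \oo --> (0 : C) -> M x).

(* A : K -> K (a bounded operator on K) is reducible: there is a
   nontrivial closed subspace M of K invariant under A and A^*
   (A^* y is the unique z in K with <A x, y> = <x, z> for x in K). *)
Definition reducible (K : set seqC) (A : seqC -> seqC) : Prop :=
  exists M, closed_subspace K M /\ M <> [set 0] /\ M <> K
  /\ (forall x, M x -> M (A x))
  /\ (forall y z, M y -> K z ->
        (forall x, K x -> ipH2 (A x) y = ipH2 x z) -> M z).

End Hardy.

(* Main.v *)
Require Import Defs.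
From HB Require Import structures.
From mathcomp Require Import all_boot all_order all_algebra.
From mathcomp Require Import all_classical all_reals all_analysis.
From mathcomp Require Import complex.
From mathcomp Require Import ring lra.
Set Implicit Arguments.
Unset Strict Implicit.
Unset Printing Implicit Defensive.
Import Order.TTheory GRing.Theory Num.Theory.
Import numFieldNormedType.Exports.
Import ComplexField.
Local Open Scope classical_set_scope.
Local Open Scope ring_scope.

(** Let [a] be the sequence of Taylor coefficients of [m].  That [m] is inner
    means that the sequences [S^k a] are orthonormal: the coefficients exist by
    Goursat's theorem in logarithmic coordinates (circle averages of a
    holomorphic function on an annulus do not depend on the radius), and the
    orthogonality relations follow from Parseval's identity on the circle of
    radius [r] by dominated convergence as [r] tends to 1.

    For [x] in the model space [H], [T^2 x = S^2 x - <S^2 x, a> a - <S^2 x, S a> S a]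
    and the adjoint of [T^2] is the square of the backward shift.  Hence, for a
    reducing subspace [M], the pairs [(x_0, x_1)] with [x] in [M] form a line
    spanned by some [(al, be)], and the elements of [M] are of the form
    [g(z^2) (al + be z)].  Projecting [z^2j (al + be z)] and the orthogonal
    [z^2j (- be^* + al^* z)], where [2j] or [2j + 1] is the order of vanishing of
    [m] at 0, gives two linear relations between the even and the odd part of
    [m]; together they say that [m] is even or that
    [(1 - |mu|^2) m_even = (mu / z - mu^* z) m_odd], which is the stated
    factorisation.  Conversely, either condition makes the space of all
    [g(z^2) (al + be z)] in [H] reducing, with [(al, be)] equal to [(1, 0)] or
    [(mu, 1)]; it is nontrivial because [H] has dimension at least 2. *)

(** Differentiability on the disc is assumed pointwise, with no continuity of the derivative, so the
    Cauchy theory has to rest on the bisection argument instead of Green's formula. Unimodularity of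
    the boundary values enters only through the orthonormality of the [S^k a]; after that, the study
    of [T] is algebra in the sequence space. The parameter [mu] is a ratio of the entries of (al,
    be) and must lie in the open disc. One of these has modulus below 1 unless |al| = |be|, a case
    that the two relations exclude when m is not even. *)

Local Notation Re := (@complex.Re _).
Local Notation Im := (@complex.Im _).

(** * Real-valued modulus of complex numbers *)

Section ComplexNorm.
Variable R : realType.
Local Notation C := R[i].
Local Open Scope complex_scope.
Local Open Scope ring_scope.
Implicit Types (x y z : C) (r : R).

(** A modulus in [R] rather than in [R[i]] keeps all estimates in a totally ordered field, where
    [lra] and [nra] apply. *)
Definition nrm z : R := Normc.normc z.

Lemma normE z : `|z| = (nrm z)%:C. Proof. by []. Qed.

Lemma nrm_ge0 z : 0 <= nrm z.
Proof. by case: z => a b; exact: sqrtr_ge0. Qed.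
Hint Resolve nrm_ge0 : core.

Lemma nrmM x y : nrm (x * y) = nrm x * nrm y.
Proof. exact: Normc.normcM. Qed.

Lemma nrm0 : nrm 0 = 0. Proof. exact: Normc.normc0. Qed.
Lemma nrm1 : nrm 1 = 1. Proof. exact: Normc.normc1. Qed.

Lemma nrmV x : nrm x^-1 = (nrm x)^-1.
Proof. exact: Normc.normcV. Qed.

Lemma nrmX x n : nrm (x ^+ n) = nrm x ^+ n.
Proof. by elim: n => [|n IH]; rewrite ?expr0 ?nrm1// !exprS nrmM IH. Qed.

Lemma nrmD x y : nrm (x + y) <= nrm x + nrm y.
Proof. by have := ler_normD x y; rewrite !normE -rmorphD lecR. Qed.

Lemma nrmN x : nrm (- x) = nrm x.
Proof. by apply: complexI; rewrite -!normE normrN. Qed.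

Lemma nrmB x y : nrm (x - y) = nrm (y - x).
Proof. by rewrite -nrmN opprB. Qed.

Lemma nrm_eq0 x : (nrm x == 0) = (x == 0).
Proof.
apply/eqP/eqP => [h|->]; last exact: nrm0.
by apply: Normc.eq0_normc.
Qed.

Lemma nrm_gt0 x : (0 < nrm x) = (x != 0).
Proof. by rewrite lt_neqAle nrm_ge0 andbT eq_sym nrm_eq0. Qed.

Lemma nrm_real r : nrm r%:C = `|r|.
Proof. by rewrite /nrm /= expr0n addr0 sqrtr_sqr. Qed.

Lemma nrm_sqr z : nrm z ^+ 2 = Re z ^+ 2 + Im z ^+ 2.
Proof. by case: z => a b; rewrite /nrm /= sqr_sqrtr// addr_ge0 ?sqr_ge0. Qed.

Lemma conjcE z : z^* = conjc z. Proof. by []. Qed.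

Lemma nrm_conj z : nrm z^* = nrm z.
Proof. rewrite conjcE; by case: z => a b; rewrite /nrm /= sqrrN. Qed.

Lemma mulconj z : z * z^* = (nrm z ^+ 2)%:C.
Proof.
by rewrite conjcE nrm_sqr; case: z => a b /=; simpc; congr (_ +i* _); ring.
Qed.

Lemma Re_le_nrm z : `|Re z| <= nrm z.
Proof.
by case: z => a b; rewrite /nrm /= -sqrtr_sqr ler_wsqrtr// lerDl sqr_ge0.
Qed.

Lemma Im_le_nrm z : `|Im z| <= nrm z.
Proof.
by case: z => a b; rewrite /nrm /= -sqrtr_sqr ler_wsqrtr// lerDr sqr_ge0.
Qed.

Lemma nrm_le_ReIm z : nrm z <= `|Re z| + `|Im z|.
Proof.
rewrite -(@ler_pXn2r _ 2) ?nnegrE ?addr_ge0// nrm_sqr sqrrD !real_normK ?num_real//.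
by rewrite lerD2r lerDl mulrn_wge0// mulr_ge0.
Qed.

Lemma ReD x y : Re (x + y) = Re x + Re y. Proof. by case: x; case: y. Qed.
Lemma ImD x y : Im (x + y) = Im x + Im y. Proof. by case: x; case: y. Qed.
Lemma ReN x : Re (- x) = - Re x. Proof. by case: x. Qed.
Lemma ImN x : Im (- x) = - Im x. Proof. by case: x. Qed.
Lemma ReM x y : Re (x * y) = Re x * Re y - Im x * Im y.
Proof. by case: x; case: y. Qed.
Lemma ImM x y : Im (x * y) = Re x * Im y + Im x * Re y.
Proof. by case: x; case: y. Qed.
Lemma complex_ext x y : Re x = Re y -> Im x = Im y -> x = y.
Proof. by case: x => a b; case: y => c d /= -> ->. Qed.

End ComplexNorm.
Arguments nrm {R} z : simpl never.
#[global] Hint Resolve nrm_ge0 : core.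

(** * Absolutely convergent complex series *)

Section ComplexSeries.
Variable R : realType.
Local Notation C := R[i].
Local Open Scope complex_scope.
Local Open Scope ring_scope.
Implicit Types (f g : nat -> C).

(* An existential rather than [cvgn], whose unfolding to an inclusion of
   filters confuses the inference of implicit arguments. *)
Definition csable f :=
  exists l : R, series (fun n => nrm (f n)) @ \oo --> l.
(** Real and imaginary limits are taken separately so that real series apply; [lim_csum] identifies
    the result with the limit in [Cx R]. *)
Definition csum f : C :=
  limn (series (fun n => Re (f n))) +i* limn (series (fun n => Im (f n))).

Lemma csableP f : csable f <-> cvgn (series (fun n => nrm (f n))).
Proof.
by split => [[l h]|h]; [apply/cvg_ex; exists l|apply/cvg_ex].
Qed.

Lemma csable_le f (g : nat -> R) : cvgn (series g) ->
  (forall n, nrm (f n) <= g n) -> csable f.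
Proof.
move=> hg h; apply/csableP; apply: (series_le_cvg _ _ h hg) => n //.
exact: le_trans (nrm_ge0 _) (h n).
Qed.

Lemma csable_Re f : csable f -> cvgn (series (fun n => Re (f n))).
Proof.
move=> h; apply: normed_cvg; apply: (series_le_cvg _ _ _ ((csableP _).1 h)) => n //=.
exact: Re_le_nrm.
Qed.

Lemma csable_Im f : csable f -> cvgn (series (fun n => Im (f n))).
Proof.
move=> h; apply: normed_cvg; apply: (series_le_cvg _ _ _ ((csableP _).1 h)) => n //=.
exact: Im_le_nrm.
Qed.

Lemma csableD f g : csable f -> csable g -> csable (fun n => f n + g n).
Proof.
move=> /csableP hf /csableP hg.
apply: (@csable_le _ (fun n => nrm (f n) + nrm (g n))) => [|n]; last exact: nrmD.
have -> : series (fun n => nrm (f n) + nrm (g n)) =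
   series (fun n => nrm (f n)) + series (fun n => nrm (g n)).
  by apply/funext => n; rewrite /series /= big_split.
exact: is_cvgD.
Qed.

Lemma csableZ (c : C) f : csable f -> csable (fun n => c * f n).
Proof.
move=> /csableP hf; apply/csableP.
have -> : series (fun n => nrm (c * f n)) = nrm c *: series (fun n => nrm (f n)).
  apply/funext => n; rewrite fctE /series /= /GRing.scale/= mulr_sumr.
  by apply: eq_bigr => i _; rewrite nrmM.
by apply: is_cvgZl_tmp.
Qed.

Lemma Re_sum (I : Type) (r : seq I) (P : pred I) (F : I -> C) :
  Re (\sum_(i <- r | P i) F i) = \sum_(i <- r | P i) Re (F i).
Proof. by elim/big_rec2: _ => // i x y _ <-; rewrite ReD. Qed.
Lemma Im_sum (I : Type) (r : seq I) (P : pred I) (F : I -> C) :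
  Im (\sum_(i <- r | P i) F i) = \sum_(i <- r | P i) Im (F i).
Proof. by elim/big_rec2: _ => // i x y _ <-; rewrite ImD. Qed.

Lemma csumD f g : csable f -> csable g ->
  csum (fun n => f n + g n) = csum f + csum g.
Proof.
move=> hf hg; apply: complex_ext.
  rewrite ReD /= -limD; [|exact: csable_Re|exact: csable_Re].
  congr (limn _); apply/funext => n; rewrite /series /=.
  by under eq_bigr do rewrite ReD; rewrite big_split.
rewrite ImD /= -limD; [|exact: csable_Im|exact: csable_Im].
congr (limn _); apply/funext => n; rewrite /series /=.
by under eq_bigr do rewrite ImD; rewrite big_split.
Qed.

Lemma csumZ (c : C) f : csable f -> csum (fun n => c * f n) = c * csum f.
Proof.
move=> hf; have hr := csable_Re hf; have hi := csable_Im hf.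
apply: complex_ext; rewrite ?ReM ?ImM /=; apply/cvg_lim => //.
  have -> : series (fun n => Re (c * f n)) = (fun n =>
      Re c * series (fun n => Re (f n)) n - Im c * series (fun n => Im (f n)) n).
    apply/funext => n; rewrite /series /=.
    by under eq_bigr do rewrite ReM; rewrite big_split/= sumrN !mulr_sumr.
  by apply: cvgB; apply: cvgM => //; exact: cvg_cst.
have -> : series (fun n => Im (c * f n)) = (fun n =>
    Re c * series (fun n => Im (f n)) n + Im c * series (fun n => Re (f n)) n).
  apply/funext => n; rewrite /series /=.
  by under eq_bigr do rewrite ImM; rewrite big_split/= !mulr_sumr.
by apply: cvgD; apply: cvgM => //; exact: cvg_cst.
Qed.

Lemma csum_conj f : csable f -> csum (fun n => (f n)^*) = (csum f)^*.
Proof.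
move=> hf; apply: complex_ext => /=.
  by congr (limn (series _)); apply/funext => n; rewrite conjcE; case: (f n).
rewrite -limN; last exact: csable_Im.
congr (limn _); apply/funext => n; rewrite fctE /series /= -sumrN.
by apply: eq_bigr => i _; rewrite conjcE; case: (f i).
Qed.

Lemma limn_series_recl (f : nat -> R) : cvgn (series f) ->
  cvgn (series (fun n => f n.+1)) /\
  limn (series f) = f 0%N + limn (series (fun n => f n.+1)).
Proof.
move=> h.
have E : series (fun n => f n.+1) = (fun n => series f (n + 1)%N - f 0%N).
  apply/funext => n; rewrite /series /= addn1 big_nat_recl// addrC addKr.
  by [].
have h1 : (fun n => series f (n + 1)%N) @ \oo --> limn (series f).
  by rewrite cvg_shiftn.
have h2 : series (fun n => f n.+1) @ \oo --> limn (series f) - f 0%N.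
  by rewrite E; apply: cvgB => //; exact: cvg_cst.
split; first by apply/cvg_ex; eexists; exact: h2.
by rewrite (cvg_lim _ h2)// addrC subrK.
Qed.

Lemma csum_recl f : csable f -> csum f = f 0%N + csum (fun n => f n.+1).
Proof.
move=> hf; apply: complex_ext; rewrite ?ReD ?ImD /=.
  by have [_ ->] := limn_series_recl (csable_Re hf).
by have [_ ->] := limn_series_recl (csable_Im hf).
Qed.

Lemma csable_recl f : csable f -> csable (fun n => f n.+1).
Proof. by move=> /csableP/limn_series_recl[h _]; apply/csableP. Qed.

Lemma csum_eq0 f : (forall n, f n = 0) -> csum f = 0.
Proof.
move=> h; have E (g : nat -> R) : (forall n, g n = 0) -> limn (series g) = 0.
  move=> g0; have -> : series g = (fun=> 0).
    by apply/funext => n; rewrite /series /= big1.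
  exact: lim_cst.
by apply: complex_ext; rewrite /= E// => n; rewrite h.
Qed.

Lemma csum_fin f N : csable f -> (forall n, (N <= n)%N -> f n = 0) ->
  csum f = \sum_(i < N) f i.
Proof.
elim: N f => [|N IH] f hf h; first by rewrite big_ord0 csum_eq0// => n; rewrite h.
rewrite csum_recl// big_ord_recl IH//; first exact: csable_recl.
by move=> n hn; rewrite h.
Qed.

Lemma nneg_series_cvg (f : nat -> R) B : (forall n, 0 <= f n) ->
  (forall N, series f N <= B) -> cvgn (series f) /\ limn (series f) <= B.
Proof.
move=> f0 fB.
have c : cvgn (series f).
  apply: nondecreasing_is_cvgn; first exact: nondecreasing_series.
  by exists B => _ [n _ <-].
by split => //; apply: limr_le => //; near=> n.
Unshelve. all: by end_near. Qed.

Lemma nneg_series_le_lim (f : nat -> R) N : (forall n, 0 <= f n) ->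
  cvgn (series f) -> series f N <= limn (series f).
Proof.
by move=> f0 h; apply: nondecreasing_cvgn_le => //; exact: nondecreasing_series.
Qed.

Lemma csable_fin f N : (forall n, (N <= n)%N -> f n = 0) -> csable f.
Proof.
move=> h; apply/csableP; apply: (@nneg_series_cvg _ (series (fun n => nrm (f n)) N) _ _).1 => // n.
have nd : nondecreasing_seq (series (fun n => nrm (f n))).
  by apply: nondecreasing_series => k _ _; exact: nrm_ge0.
have [nN|/ltnW Nn] := leqP n N; first exact: nd.
rewrite /series /=.
rewrite (big_cat_nat (leq0n _) Nn)//= [X in _ + X]big_nat [X in _ + X]big1 ?addr0// => i /andP[Ni _].
by rewrite h// nrm0.
Qed.

End ComplexSeries.

(** * Square-summable sequences, inner product and shifts *)

Section SquareSummable.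
Variable R : realType.
Local Notation C := R[i].
Local Notation vec := (nat -> C).
Local Open Scope complex_scope.
Local Open Scope ring_scope.
Implicit Types (x y z : vec) (c : C).

Definition l2 x := exists l : R, series (fun n => nrm (x n) ^+ 2) @ \oo --> l.
Definition rsq x : R := limn (series (fun n => nrm (x n) ^+ 2)).
Definition ip x y : C := csum (fun n => x n * (y n)^*).

Lemma l2P x : l2 x <-> cvgn (series (fun n => nrm (x n) ^+ 2)).
Proof.
by split => [[l h]|h]; [apply/cvg_ex; exists l|apply/cvg_ex].
Qed.

Lemma series_cvgD (f g : nat -> R) : cvgn (series f) -> cvgn (series g) ->
  cvgn (series (fun n => f n + g n)).
Proof.
move=> hf hg; have -> : series (fun n => f n + g n) = series f + series g.
  by apply/funext => n; rewrite fctE /series /= big_split.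
exact: is_cvgD.
Qed.

Lemma series_cvgZ (c : R) (f : nat -> R) : cvgn (series f) ->
  cvgn (series (fun n => c * f n)).
Proof.
move=> hf; have -> : series (fun n => c * f n) = c *: series f.
  by apply/funext => n; rewrite fctE /series /= /GRing.scale/= mulr_sumr.
by apply: is_cvgZl_tmp.
Qed.

Lemma l2_le x (g : nat -> R) : cvgn (series g) ->
  (forall n, nrm (x n) ^+ 2 <= g n) -> l2 x.
Proof.
move=> hg h; apply/l2P; apply: (series_le_cvg _ _ h hg) => n; first exact: sqr_ge0.
exact: le_trans (sqr_ge0 _) (h n).
Qed.

Lemma l2_csable x y : l2 x -> l2 y -> csable (fun n => x n * (y n)^*).
Proof.
move=> /l2P hx /l2P hy; apply: (csable_le (series_cvgD hx hy)) => n.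
rewrite nrmM nrm_conj.
have := sqr_ge0 (nrm (x n) - nrm (y n)).
have := mulr_ge0 (nrm_ge0 (x n)) (nrm_ge0 (y n)).
nra.
Qed.

Lemma l2D x y : l2 x -> l2 y -> l2 (x + y).
Proof.
move=> /l2P hx /l2P hy; 
apply: (@l2_le _ (fun n => 2 * nrm (x n) ^+ 2 + 2 * nrm (y n) ^+ 2)) => [|n].
  by apply: series_cvgD; exact: series_cvgZ.
rewrite fctE.
have := sqr_ge0 (nrm (x n) - nrm (y n)).
have := nrmD (x n) (y n); have := nrm_ge0 (x n + y n).
nra.
Qed.

Lemma l2Z c x : l2 x -> l2 (c *: x).
Proof.
move=> /l2P hx; 
apply: (@l2_le _ (fun n => nrm c ^+ 2 * nrm (x n) ^+ 2)) => [|n].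
  exact: series_cvgZ.
by rewrite fctE /GRing.scale/= nrmM exprMn.
Qed.

Lemma l2N x : l2 x -> l2 (- x).
Proof. by move=> hx; rewrite -scaleN1r; exact: l2Z. Qed.

Lemma l2B x y : l2 x -> l2 y -> l2 (x - y).
Proof. by move=> hx hy; apply: l2D => //; exact: l2N. Qed.

Lemma l2_fin x N : (forall n, (N <= n)%N -> x n = 0) -> l2 x.
Proof.
move=> h; have := @csable_fin R (fun n => x n * x n) N.
rewrite csableP l2P.
have -> : (fun n => nrm (x n * x n)) = (fun n => nrm (x n) ^+ 2).
  by apply/funext => n; rewrite nrmM expr2.
by apply => n hn; rewrite h// mul0r.
Qed.

Lemma l20 : l2 0. Proof. exact: (@l2_fin _ 0%N). Qed.

Lemma l2_sum (I : Type) (r : seq I) (P : pred I) (F : I -> vec) :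
  (forall i, l2 (F i)) -> l2 (\sum_(i <- r | P i) F i).
Proof.
by move=> h; apply: big_ind => //; [exact: l20|exact: l2D].
Qed.

Lemma ipDl x y z : l2 x -> l2 y -> l2 z -> ip (x + y) z = ip x z + ip y z.
Proof.
move=> hx hy hz; rewrite /ip -csumD; [|exact: l2_csable..].
by congr csum; apply/funext => n; rewrite fctE mulrDl.
Qed.

Lemma ipZl c x y : l2 x -> l2 y -> ip (c *: x) y = c * ip x y.
Proof.
move=> hx hy; rewrite /ip -csumZ; last exact: l2_csable.
by congr csum; apply/funext => n; rewrite fctE /GRing.scale/= mulrA.
Qed.

Lemma ipC x y : l2 x -> l2 y -> ip y x = (ip x y)^*.
Proof.
move=> hx hy; rewrite /ip -csum_conj; last exact: l2_csable.
congr csum; apply/funext => n.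
by rewrite rmorphM /= conjCK mulrC.
Qed.

Lemma ipNl x y : l2 x -> l2 y -> ip (- x) y = - ip x y.
Proof. by move=> hx hy; rewrite -scaleN1r ipZl// mulN1r. Qed.

Lemma ipBl x y z : l2 x -> l2 y -> l2 z -> ip (x - y) z = ip x z - ip y z.
Proof. by move=> hx hy hz; rewrite ipDl ?ipNl//; exact: l2N. Qed.

Lemma ip0l y : ip 0 y = 0.
Proof. by apply: csum_eq0 => n; rewrite mul0r. Qed.

Lemma ip0r y : ip y 0 = 0.
Proof. by apply: csum_eq0 => n; rewrite rmorph0 mulr0. Qed.

Lemma ipDr x y z : l2 x -> l2 y -> l2 z -> ip z (x + y) = ip z x + ip z y.
Proof.
move=> hx hy hz; rewrite (ipC (l2D hx hy) hz) ipDl// rmorphD/=.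
by rewrite (ipC hx hz) (ipC hy hz).
Qed.

Lemma ipZr c x y : l2 x -> l2 y -> ip y (c *: x) = c^* * ip y x.
Proof.
by move=> hx hy; rewrite (ipC (l2Z c hx) hy) ipZl// rmorphM/= (ipC hx hy).
Qed.

Lemma ipNr x y : l2 x -> l2 y -> ip y (- x) = - ip y x.
Proof.
by move=> hx hy; rewrite (ipC (l2N hx) hy) ipNl// rmorphN/= (ipC hx hy).
Qed.

Lemma ipBr x y z : l2 x -> l2 y -> l2 z -> ip z (x - y) = ip z x - ip z y.
Proof. by move=> hx hy hz; rewrite ipDr ?ipNr//; exact: l2N. Qed.

Lemma ip_suml (I : Type) (r : seq I) (P : pred I) (F : I -> vec) y :
  (forall i, l2 (F i)) -> l2 y ->
  ip (\sum_(i <- r | P i) F i) y = \sum_(i <- r | P i) ip (F i) y.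
Proof.
move=> h hy.
have [] : l2 (\sum_(i <- r | P i) F i) /\
   ip (\sum_(i <- r | P i) F i) y = \sum_(i <- r | P i) ip (F i) y => //.
elim/big_rec2 : _ => [|i u v Pi [hv <-]].
  by split; [exact: l20|exact: ip0l].
by split; [exact: l2D|rewrite ipDl].
Qed.

Lemma ipxx x : ip x x = (rsq x)%:C.
Proof.
apply: complex_ext => /=.
  by congr (limn (series _)); apply/funext => n; rewrite mulconj.
have -> : (fun n => Im (x n * (x n)^*)) = (fun=> 0).
  by apply/funext => n; rewrite mulconj.
have -> : series (fun=> 0 : R) = (fun=> 0).
  by apply/funext => n; rewrite /series /= big1.
exact: lim_cst.
Qed.

Lemma sq_le_rsq x n : l2 x -> nrm (x n) ^+ 2 <= rsq x.
Proof.
move=> /l2P hx; apply: le_trans (nneg_series_le_lim n.+1 _ hx); last first.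
  by move=> k; exact: sqr_ge0.
by rewrite /series /= big_nat_recr//= lerDr sumr_ge0// => i _; exact: sqr_ge0.
Qed.

Lemma rsq_ge0 x : l2 x -> 0 <= rsq x.
Proof. by move=> hx; apply: le_trans (sq_le_rsq 0 hx); exact: sqr_ge0. Qed.

Lemma rsq_eq0 x : l2 x -> rsq x = 0 -> x = 0.
Proof.
move=> hx h; apply/funext => n; apply/eqP; rewrite -nrm_eq0.
have := sq_le_rsq n hx; rewrite h => h2.
by rewrite -sqrf_eq0 eq_le h2 sqr_ge0.
Qed.

Lemma ip_eq0 x : l2 x -> ip x x = 0 -> x = 0.
Proof.
by move=> hx; rewrite ipxx => h; apply: rsq_eq0 => //; apply: complexI.
Qed.

Lemma CauchySchwarz x y : l2 x -> l2 y -> nrm (ip x y) ^+ 2 <= rsq x * rsq y.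
Proof.
move=> hx hy; have [y0|y0] := eqVneq (rsq y) 0.
  by rewrite (rsq_eq0 hy y0) ip0r nrm0 expr0n/= -(rsq_eq0 hy y0) y0 mulr0.
have yp : 0 < rsq y by rewrite lt_neqAle eq_sym y0 rsq_ge0.
(* [c *: y] is the orthogonal projection of [x] onto the line of [y]; the inequality is the
   nonnegativity of the squared norm of the residual. *)
set c := ip x y / (rsq y)%:C.
have hcy := l2Z c hy.
have := rsq_ge0 (l2B hx hcy).
suff -> : rsq (x - c *: y) = rsq x - nrm (ip x y) ^+ 2 / rsq y.
  by rewrite subr_ge0 ler_pdivrMr.
apply: complexI; rewrite -ipxx ipBl ?ipBr//; [|exact: l2B].
have -> : (rsq x - nrm (ip x y) ^+ 2 / rsq y)%:C =
    (rsq x)%:C - ip x y * (ip x y)^* / (rsq y)%:C.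
  by rewrite mulconj -fmorphV -rmorphM -rmorphB.
rewrite !ipZl ?ipZr// !ipxx (ipC hx hy).
have yC : (rsq y)%:C != 0 by rewrite (inj_eq (@complexI _)).
have -> : c^* = (ip x y)^* / (rsq y)%:C.
  by rewrite /c rmorphM fmorphV/=; congr (_ * _^-1); rewrite conjcE /= oppr0.
by rewrite /c; field.
Qed.

Lemma l2_bounded x B : (forall N, \sum_(0 <= n < N) nrm (x n) ^+ 2 <= B) ->
  l2 x /\ rsq x <= B.
Proof. by move=> h; rewrite l2P; apply: nneg_series_cvg => // n; exact: sqr_ge0. Qed.

Local Notation sh := (@Defs.shift R).
Definition bs x : vec := fun n => x n.+1.

Lemma l2bs x : l2 x -> l2 (bs x).
Proof. by move=> /l2P/limn_series_recl[h _]; apply/l2P. Qed.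

Lemma l2sh x : l2 x -> l2 (sh x).
Proof.
move=> hx; apply: (l2_bounded (B := rsq x) _).1 => -[|N].
  by rewrite big_geq// rsq_ge0.
rewrite big_nat_recl// [sh x 0]/= nrm0 expr0n/= add0r.
by move/l2P: hx => hx; apply: nneg_series_le_lim => // n; exact: sqr_ge0.
Qed.

Lemma ip_sh x y : l2 x -> l2 y -> ip (sh x) y = ip x (bs y).
Proof.
move=> hx hy; rewrite /ip csum_recl; last by apply: l2_csable => //; exact: l2sh.
by rewrite /= mul0r add0r.
Qed.

Lemma ip_sh_sh x y : l2 x -> l2 y -> ip (sh x) (sh y) = ip x y.
Proof. by move=> hx hy; rewrite ip_sh//; exact: l2sh. Qed.

Lemma ip_bs x y : l2 x -> l2 y -> ip (bs x) y = ip x (sh y).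
Proof.
move=> hx hy; have hs := l2sh hy; have hb := l2bs hx.
by rewrite (ipC hy hb) (ipC hs hx) ip_sh.
Qed.

Lemma l2_iter k x : l2 x -> l2 (iter k sh x).
Proof. by move=> hx; elim: k => //= k; exact: l2sh. Qed.

Lemma iter_shE k x n : iter k sh x n = if (k <= n)%N then x (n - k)%N else 0.
Proof.
by elim: k n => [|k IH] [|n] //=.
Qed.

Lemma ip_iter_sh k x y : l2 x -> l2 y -> ip (iter k sh x) (iter k sh y) = ip x y.
Proof.
move=> hx hy; elim: k => //= k IH.
by rewrite ip_sh_sh//; exact: l2_iter.
Qed.

Definition del (k : nat) : vec := fun n => (n == k)%:R.

Lemma l2_del k : l2 (del k).
Proof. by apply: (@l2_fin _ k.+1) => n hn; rewrite /del gtn_eqF. Qed.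

Lemma iter_del k j : iter k sh (del j) = del (j + k)%N.
Proof.
apply/funext => n; rewrite iter_shE /del; case: leqP => h.
  by rewrite -(eqn_add2r k) subnK.
by rewrite ltn_eqF// ltn_addl.
Qed.

Lemma ip_del x k : l2 x -> ip x (del k) = x k.
Proof.
move=> hx; rewrite /ip (@csum_fin _ _ k.+1).
- rewrite big_ord_recr /= big1 ?add0r => [|i _].
    by rewrite /del eqxx rmorph1 mulr1.
  by rewrite /del ltn_eqF// rmorph0 mulr0.
- by apply: l2_csable => //; exact: l2_del.
- by move=> n hn; rewrite /del gtn_eqF// rmorph0 mulr0.
Qed.

Definition trunc N x : vec := \sum_(i < N) x i *: del i.

Lemma truncE N x n : trunc N x n = if (n < N)%N then x n else 0.
Proof.
rewrite /trunc fct_sumE; case: ltnP => h.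
  rewrite (bigD1 (Ordinal h))//= big1 => [|i /negP ni].
    by rewrite fctE /del eqxx /GRing.scale/= mulr1 addr0.
  rewrite fctE /del /GRing.scale/=; case: eqP => [e|]; last by rewrite mulr0.
  by case: ni; apply/eqP/val_inj => /=; rewrite e.
rewrite big1// => i _; rewrite fctE /del /GRing.scale/= gtn_eqF ?mulr0//.
exact: leq_trans (ltn_ord i) h.
Qed.

Lemma l2_trunc N x : l2 (trunc N x).
Proof. by apply: l2_sum => i; apply: l2Z; exact: l2_del. Qed.

Lemma rsq_tail x : l2 x -> (fun N => rsq (trunc N x - x)) @ \oo --> 0.
Proof.
move=> hx.
have E N : rsq (trunc N x - x) = rsq x - series (fun n => nrm (x n) ^+ 2) N.
  have hd : l2 (trunc N x - x) by apply: l2B => //; exact: l2_trunc.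
  apply/cvg_lim => //.
  rewrite -(cvg_shiftn N).
  have -> : (fun n => series (fun k => nrm ((trunc N x - x) k) ^+ 2) (n + N)%N) =
     (fun n => series (fun n => nrm (x n) ^+ 2) (n + N)%N
        - series (fun n => nrm (x n) ^+ 2) N).
    apply/funext => n; rewrite /series /= !(big_cat_nat (leq0n N) (leq_addl n N)) /=.
    rewrite [X in _ = X - _]addrC addrK big_nat big1 ?add0r => [|i /andP[_ iN]].
      apply: eq_big_nat => i /andP[iN _].
      by rewrite !fctE truncE ltnNge iN/= sub0r nrmN.
    by rewrite !fctE truncE iN subrr nrm0 expr0n.
  by move/l2P: hx => hx; apply: cvgB; [rewrite cvg_shiftn|exact: cvg_cst].
rewrite (_ : (fun N => _) = (fun N => rsq x - series (fun n => nrm (x n) ^+ 2) N));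
  last by apply/funext => N; rewrite E.
by move/l2P: hx => hx; rewrite -[X in _ --> X](subrr (rsq x)); apply: cvgB; [exact: cvg_cst|].
Qed.

Lemma trunc_tail_small x e : l2 x -> 0 < e -> exists N0, forall N, (N0 <= N)%N ->
  rsq (trunc N x - x) < e.
Proof.
move=> hx e0; have := rsq_tail hx => /cvgrPdist_lt/(_ e e0)[N0 _ h].
exists N0 => N hN; have := h N hN; rewrite sub0r normrN ger0_norm//.
by apply: rsq_ge0; apply: l2B => //; exact: l2_trunc.
Qed.

End SquareSummable.
#[global] Hint Resolve l2D l2Z l2N l2B l20 l2sh l2bs l2_iter l2_del l2_trunc : core.

(** * Translation of the topological definitions into real estimates *)

Section Bridge.
Variable R : realType.
Local Notation C := R[i].
Local Notation vec := (nat -> C).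
Local Open Scope complex_scope.
Local Open Scope ring_scope.
Implicit Types (x y : vec) (z : C).

(** A positive element of [R[i]] has zero imaginary part, so the epsilons of the topology of [Cx R]
    are exactly the real ones. *)
Lemma cvgCxP (T : Type) (F : set_system T) {FF : Filter F} (u : T -> Cx R) (l : Cx R) :
  (u @ F --> l) <-> (forall e : R, 0 < e -> \forall t \near F, nrm (l - u t : C) < e).
Proof.
split => [h e e0|h].
  have e0' : (0 : C) < e%:C by rewrite ltcR.
  move/cvgrPdist_lt : h => /(_ _ e0').
  by apply: filterS => t; rewrite -ltcR.
apply/cvgrPdist_lt => e e0.
have [er e0r] : (0 : R) < complex.Re e /\ e = (complex.Re e)%:C.
  by move: e0; rewrite ltcE; case: e => a b /= /andP[/eqP -> ->].
have := h _ er; apply: filterS => t.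
by rewrite -ltcR -e0r.
Qed.

Lemma cvg_complex (u : nat -> C) (l : C) :
  (fun n => Re (u n)) @ \oo --> Re l -> (fun n => Im (u n)) @ \oo --> Im l ->
  (u : nat -> Cx R) @ \oo --> (l : Cx R).
Proof.
move=> hr hi; apply/cvgCxP => e e0.
have e2 : 0 < e / 2 by rewrite divr_gt0.
move/cvgrPdist_lt : hr => /(_ _ e2) hr; move/cvgrPdist_lt : hi => /(_ _ e2) hi.
near=> n; apply: le_lt_trans (nrm_le_ReIm _) _.
rewrite ReD ReN ImD ImN [ltRHS](splitr e); apply: ltrD; near: n => //.
Unshelve. all: by end_near. Qed.

Lemma cvg_Re (u : nat -> Cx R) (l : Cx R) : u @ \oo --> l ->
  (fun n => Re (u n)) @ \oo --> Re l.
Proof.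
move=> /cvgCxP h; apply/cvgrPdist_lt => e e0; have := h e e0.
apply: filterS => n; apply: le_lt_trans.
by have := Re_le_nrm (l - u n : C); rewrite ReD ReN.
Qed.

Lemma cvg_csum (f : vec) : csable f ->
  (series (f : nat -> Cx R) : nat -> Cx R) @ \oo --> (csum f : Cx R).
Proof.
move=> hf; apply: cvg_complex => /=.
  rewrite (_ : (fun n => _) = series (fun n => Re (f n))); first exact: csable_Re.
  by apply/funext => n; rewrite /series /= -Re_sum.
rewrite (_ : (fun n => _) = series (fun n => Im (f n))); first exact: csable_Im.
by apply/funext => n; rewrite /series /= -Im_sum.
Qed.

Lemma lim_csum (f : vec) : csable f -> limn (series (f : nat -> Cx R)) = csum f.
Proof. by move=> /cvg_csum h; apply/cvg_lim. Qed.

Lemma real_series_Cx (f : nat -> R) : cvgn (series f) ->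
  (series (fun n => (f n)%:C : Cx R)) @ \oo --> ((limn (series f))%:C : Cx R).
Proof.
move=> h; apply: cvg_complex => /=.
  rewrite (_ : (fun n => _) = series f)//.
  by apply/funext => n; rewrite /series /= Re_sum.
rewrite (_ : (fun n => _) = fun=> 0); first exact: cvg_cst.
by apply/funext => n; rewrite /series /= Im_sum big1.
Qed.

Lemma sqnormE (z : C) : (`|(z : Cx R)| ^+ 2 : C) = (nrm z ^+ 2)%:C.
Proof. by rewrite rmorphXn. Qed.

Lemma is_H2E (x : vec) : is_H2 (x : seqC R) <-> l2 x.
Proof.
rewrite /is_H2.
rewrite (_ : (fun n => (`|(x n : Cx R)| ^+ 2 : Cx R)) =
  (fun n => (nrm (x n) ^+ 2)%:C)); last by apply/funext => n; exact: sqnormE.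
split => [/cvg_ex[l h]|/l2P h].
  apply/l2P/cvg_ex; exists (complex.Re (l : C)).
  rewrite (_ : series _ = (fun n => Re
    (series (fun n => (nrm (x n) ^+ 2)%:C : Cx R) n))); first exact: cvg_Re h.
  by apply/funext => n; rewrite /series /= Re_sum.
by apply/cvg_ex; eexists; exact: real_series_Cx h.
Qed.

Lemma nsqH2E (x : vec) : l2 x -> nsqH2 (x : seqC R) = (rsq x)%:C.
Proof.
move=> /l2P h; rewrite /nsqH2; apply/cvg_lim => //.
rewrite (_ : (fun n => (`|(x n : Cx R)| ^+ 2 : Cx R)) =
  (fun n => (nrm (x n) ^+ 2)%:C)); last by apply/funext => n; exact: sqnormE.
exact: real_series_Cx h.
Qed.

Lemma ipH2E x y : l2 x -> l2 y -> ipH2 (x : seqC R) (y : seqC R) = ip x y.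
Proof. by move=> hx hy; apply: lim_csum; exact: l2_csable. Qed.

Lemma discE z : disc (z : Cx R) <-> nrm z < 1.
Proof.
rewrite /disc /= -ltcR.
by split.
Qed.

End Bridge.

(** * Point evaluation on the Hardy space *)

Section Evaluation.
Variable R : realType.
Local Notation C := R[i].
Local Notation vec := (nat -> C).
Local Notation sh := (@Defs.shift R).
Local Open Scope complex_scope.
Local Open Scope ring_scope.
Implicit Types (x y : vec) (z : C).

Definition ev x z : C := csum (fun n => x n * z ^+ n).
(** The Szego kernel: evaluation at [z] is the inner product with it, so linearity and
    Cauchy-Schwarz carry over to evaluations. *)
Definition kz z : vec := fun n => (z ^+ n)^*.

Lemma cvg_geo (q : R) : 0 <= q < 1 -> cvgn (series (fun n => q ^+ n)).
Proof.
move=> /andP[q0 q1]; rewrite (_ : (fun n => _) = geometric 1 q).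
  by apply: is_cvg_geometric_series; rewrite ger0_norm.
by apply/funext => n; rewrite /geometric /= mul1r.
Qed.

Lemma l2_kz z : nrm z < 1 -> l2 (kz z).
Proof.
move=> z1; apply: (@l2_le _ _ (fun n => (nrm z ^+ 2) ^+ n)) => [|n].
  by apply: cvg_geo; rewrite sqr_ge0 expr_lt1// nrm_ge0.
by rewrite /kz nrm_conj nrmX -!exprM mulnC.
Qed.

Lemma ev_ip x z : ev x z = ip x (kz z).
Proof. by congr csum; apply/funext => n; rewrite /kz conjCK. Qed.

Lemma evalH2E x z : l2 x -> nrm z < 1 -> evalH2 (x : seqC R) (z : Cx R) = ev x z.
Proof.
move=> hx hz; apply: lim_csum.
have := l2_csable hx (l2_kz hz).
by congr csable; apply/funext => n; rewrite /kz conjCK.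
Qed.

Lemma ev_sh x z : l2 x -> nrm z < 1 -> ev (sh x) z = z * ev x z.
Proof.
move=> hx hz; have hk := l2_kz hz; rewrite !ev_ip ip_sh//.
(* The kernel is an eigenvector of the backward shift, the adjoint of [sh]. *)
have -> : bs (kz z) = z^* *: kz z.
  by apply/funext => n; rewrite fctE /bs /kz exprS rmorphM.
by rewrite ipZr// conjCK.
Qed.

Lemma ev_iter k x z : l2 x -> nrm z < 1 -> ev (iter k sh x) z = z ^+ k * ev x z.
Proof.
move=> hx hz; elim: k => [|k IH]; first by rewrite mul1r.
by rewrite iterS ev_sh ?IH ?mulrA ?exprS//; exact: l2_iter.
Qed.

Lemma evD x y z : l2 x -> l2 y -> nrm z < 1 -> ev (x + y) z = ev x z + ev y z.
Proof. by move=> hx hy hz; rewrite !ev_ip ipDl//; exact: l2_kz. Qed.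

Lemma evB x y z : l2 x -> l2 y -> nrm z < 1 -> ev (x - y) z = ev x z - ev y z.
Proof. by move=> hx hy hz; rewrite !ev_ip ipBl//; exact: l2_kz. Qed.

Lemma evZ c x z : l2 x -> nrm z < 1 -> ev (c *: x) z = c * ev x z.
Proof. by move=> hx hz; rewrite !ev_ip ipZl//; exact: l2_kz. Qed.

Lemma ev_del k z : nrm z < 1 -> ev (del R k) z = z ^+ k.
Proof.
move=> hz; have hk := l2_kz hz.
by rewrite ev_ip (ipC hk (l2_del R k)) ip_del// /kz conjCK.
Qed.

Lemma ev_recl x z : l2 x -> nrm z < 1 -> ev x z = x 0%N + z * ev (bs x) z.
Proof.
move=> hx hz; have hb := l2bs hx.
have {1}-> : x = x 0%N *: del R 0 + sh (bs x).
  apply/funext => -[|n]; rewrite !fctE /del /GRing.scale/= ?mulr1 ?addr0//.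
  by rewrite mulr0 add0r.
rewrite evD//; [|exact: l2Z|exact: l2sh].
by rewrite evZ// ev_del// expr0 mulr1 ev_sh.
Qed.

Lemma ev0 x : l2 x -> ev x 0 = x 0%N.
Proof. by move=> hx; rewrite ev_recl ?nrm0// mul0r addr0. Qed.

Lemma rsq_kz_le z : nrm z <= 2^-1 -> rsq (kz z) <= 2.
Proof.
move=> hz; apply: (l2_bounded (B := 2) _).2 => N.
have h n : nrm (kz z n) ^+ 2 <= 2^-1 ^+ n.
  rewrite /kz nrm_conj nrmX -exprM mulnC exprM; apply: lerXn2r; rewrite ?nnegrE ?sqr_ge0//.
  have := nrm_ge0 z; nra.
apply: (@le_trans _ _ (\sum_(0 <= n < N) 2^-1 ^+ n)).
  by apply: ler_sum => n _; exact: h.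
have E : \sum_(0 <= n < N) (2^-1 : R) ^+ n = 2 - 2 * 2^-1 ^+ N.
  elim: N => [|N IH]; first by rewrite big_geq// expr0 mulr1 subrr.
  by rewrite big_nat_recr//= IH exprS; field.
by rewrite E gerBl mulr_ge0// exprn_ge0.
Qed.

(** Uniformity on the half disc is the point: applied to backward shifts of a sequence, it bounds
    the remainders of its expansion at 0. *)
Lemma ev_bound x z : l2 x -> nrm z <= 2^-1 -> nrm (ev x z) ^+ 2 <= rsq x * 2.
Proof.
move=> hx hz; rewrite ev_ip.
have hz1 : nrm z < 1 by apply: le_lt_trans hz _; rewrite invf_lt1// ltr1n.
apply: le_trans (CauchySchwarz hx (l2_kz hz1)) _.
by rewrite ler_wpM2l ?rsq_ge0// rsq_kz_le.
Qed.

(** Shaped for Cauchy-Schwarz, which bounds squares: [e] is the squared norm of an approximation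
    error and [B] collects the fixed factors. *)
Lemma small_eq0 (w : C) (B : R) :
  (forall e, 0 < e -> nrm w ^+ 2 <= e * B) -> w = 0.
Proof.
move=> h; apply/eqP; rewrite -nrm_eq0 -sqrf_eq0 eq_le sqr_ge0 andbT.
have B0 : 0 <= B by have := h 1 ltr01; rewrite mul1r; apply: le_trans; exact: sqr_ge0.
apply/ler_addgt0Pl => e e0; rewrite addr0.
have B1 : 0 < B + 1 by lra.
apply: le_trans (h (e / (B + 1)) _) _; first by rewrite divr_gt0.
rewrite mulrAC ler_pdivrMr//; nra.
Qed.

Lemma ev_eq0 x : l2 x -> (forall z, nrm z < 1 -> ev x z = 0) -> x = 0.
Proof.
move=> hx h; apply/funext => n; rewrite [RHS]/=; have -> : (0 : vec) n = 0 by [].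
elim: n x hx h => [|n IH] x hx h; first by rewrite -ev0// h// nrm0.
have hb := l2bs hx.
apply: (IH (bs x)) => // z hz.
have x0 : x 0%N = 0 by rewrite -ev0// h// nrm0.
have nz w : nrm w < 1 -> w != 0 -> ev (bs x) w = 0.
  move=> w1 w0; have := h w w1; rewrite ev_recl// x0 add0r => /eqP.
  by rewrite mulf_eq0 (negbTE w0) => /eqP.
(* At 0 the factor [z] cannot be cancelled. Since [bs x] vanishes at small [t > 0], its constant
   term is at most [t] times a bounded value. *)
have [->|z0] := eqVneq z 0; last exact: nz.
rewrite ev0//; apply: (@small_eq0 _ (rsq (bs (bs x)) * 2)) => e e0.
pose t : R := Num.min e 2^-1.
have t0 : 0 < t by rewrite lt_min e0 invr_gt0 ltr0n.
have t2 : t <= 2^-1 by rewrite ge_min lexx orbT.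
have nt : nrm t%:C = t by rewrite nrm_real gtr0_norm.
have th : nrm t%:C <= 2^-1 by rewrite nt.
have t1 : nrm t%:C < 1 by rewrite nt; apply: le_lt_trans t2 _; rewrite invf_lt1// ltr1n.
have tn0 : t%:C != 0 by rewrite -nrm_gt0 nt.
have := nz _ t1 tn0; rewrite ev_recl// => /eqP; rewrite addr_eq0 => /eqP ->.
rewrite nrmN nrmM nt exprMn; apply: ler_pM => //; rewrite ?sqr_ge0//.
  have te : t <= e by rewrite ge_min lexx.
  by apply: le_trans te; rewrite expr2 ger_pMr//; lra.
by apply: ev_bound => //; exact: l2bs.
Qed.

Lemma ev_inj x y : l2 x -> l2 y -> (forall z, nrm z < 1 -> ev x z = ev y z) -> x = y.
Proof.
move=> hx hy h; apply/eqP; rewrite -subr_eq0; apply/eqP.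
by apply: ev_eq0 => [|z hz]; [exact: l2B|rewrite evB// h// subrr].
Qed.

End Evaluation.

(** * The model space of a sequence with orthonormal shifts *)

Section ModelSpace.
Variable R : realType.
Local Notation C := R[i].
Local Notation vec := (nat -> C).
Local Notation sh := (@Defs.shift R).
Local Open Scope complex_scope.
Local Open Scope ring_scope.
Implicit Types (x y h : vec) (z : C).
Variables (a : vec) (m : Cx R -> Cx R).
Hypothesis ha : l2 a.
Hypothesis a_orth : forall k, ip (iter k sh a) a = (k == 0%N)%:R.
Hypothesis hm : forall z : C, nrm z < 1 -> m z = ev a z.

Local Notation A k := (iter k sh a).

Let lA k : l2 (A k). Proof. exact: l2_iter. Qed.

Lemma orthA j k : ip (A j) (A k) = (j == k)%:R.
Proof.
have E i l : ip (A (l + i)) (A i) = (l == 0%N)%:R.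
  by rewrite addnC iterD ip_iter_sh// a_orth.
have [kj|jk] := leqP k j.
  by rewrite -{1}(subnK kj) E subn_eq0 eqn_leq kj andbT.
rewrite (ipC (lA k) (lA j)) -{1}(subnK (ltnW jk)) E.
by rewrite subn_eq0 leqNgt jk/= rmorph0 ltn_eqF.
Qed.

(* [conv g] lists the Taylor coefficients of [m g]. *)
Definition VN N (g : vec) : vec := \sum_(i < N) g i *: A i.
Definition conv (g : vec) : vec := fun n => \sum_(i < n.+1) g i * A i n.

Lemma l2_VN N g : l2 (VN N g).
Proof. by apply: l2_sum => i; apply: l2Z. Qed.

Lemma ip_VN N g i : ip (VN N g) (A i) = if (i < N)%N then g i else 0.
Proof.
rewrite /VN ip_suml//; last by move=> j; exact: l2Z.
under eq_bigr do rewrite ipZl// orthA.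
case: ltnP => h.
  rewrite (bigD1 (Ordinal h))//= eqxx mulr1 big1 ?addr0// => j nj.
  case: eqP => [e|]; last by rewrite mulr0.
  by case/negP: nj; apply/eqP/val_inj.
rewrite big1// => j _; case: eqP => [e|]; last by rewrite mulr0.
by move: (ltn_ord j); rewrite e ltnNge h.
Qed.

Lemma rsq_VN N g : rsq (VN N g) = \sum_(0 <= i < N) nrm (g i) ^+ 2.
Proof.
apply: complexI; rewrite -ipxx {1}/VN ip_suml; last exact: l2_VN; last first.
  by move=> i; exact: l2Z.
rewrite rmorph_sum big_mkord; apply: eq_bigr => i _.
rewrite ipZl//; last exact: l2_VN.
by rewrite (ipC (l2_VN N g) (lA i)) ip_VN ltn_ord mulconj.
Qed.

Lemma VNE N g n : (n < N)%N -> VN N g n = conv g n.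
Proof.
move=> nN; rewrite /VN /conv fct_sumE.
rewrite -(big_mkord xpredT (fun i => (g i *: A i) n)).
rewrite -(big_mkord xpredT (fun i => g i * A i n)).
rewrite (big_cat_nat (leq0n n.+1) nN)/= [X in _ + X]big_nat.
rewrite [X in _ + X]big1 ?addr0// => i /andP[ni _].
by rewrite fctE /GRing.scale/= iter_shE leqNgt ni mulr0.
Qed.

(** The first [N] coefficients of [conv g] are those of [VN N g], and by orthonormality the squared
    norm of the latter is a partial sum of that of [g]. *)
Lemma conv_bound g : l2 g -> l2 (conv g) /\ rsq (conv g) <= rsq g.
Proof.
move=> hg; apply: l2_bounded => N.
apply: (@le_trans _ _ (\sum_(0 <= n < N) nrm (VN N g n) ^+ 2)).
  by rewrite !big_nat; apply: ler_sum => n /andP[_ nN]; rewrite VNE.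
apply: (@le_trans _ _ (rsq (VN N g))).
  apply: (@nneg_series_le_lim _ (fun n => nrm (VN N g n) ^+ 2)) => [n|].
    exact: sqr_ge0.
  by apply/l2P; exact: l2_VN.
rewrite rsq_VN; move/l2P: hg => hg.
by apply: (@nneg_series_le_lim _ (fun n => nrm (g n) ^+ 2)) => // n; exact: sqr_ge0.
Qed.

Lemma conv_trunc N g : conv (trunc N g) = VN N g.
Proof.
apply/funext => n; have h : (n < maxn n.+1 N)%N by rewrite leq_max ltnSn.
rewrite -(VNE _ h) /VN !fct_sumE.
rewrite -(big_mkord xpredT (fun i => (trunc N g i *: A i) n)).
rewrite -(big_mkord xpredT (fun i => (g i *: A i) n)).
rewrite (big_cat_nat (leq0n N) (leq_maxr n.+1 N))/= [X in _ + X]big_nat.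
rewrite [X in _ + X]big1 ?addr0 => [|i /andP[Ni _]].
  by rewrite !big_nat; apply: eq_bigr => i /andP[_ iN]; rewrite !fctE truncE iN.
by rewrite fctE truncE ltnNge Ni/= scale0r.
Qed.

Lemma convB g h : conv g - conv h = conv (g - h).
Proof.
apply/funext => n; rewrite !fctE /conv -sumrB.
by apply: eq_bigr => i _; rewrite mulrBl.
Qed.

(** Density of polynomials in [g], made to pass through multiplication by [m]: one [N] serves both
    errors because [conv] contracts. *)
Lemma conv_approx g e : l2 g -> 0 < e ->
  exists N, rsq (trunc N g - g) <= e /\ rsq (VN N g - conv g) <= e.
Proof.
move=> hg e0; have [N h] := trunc_tail_small hg e0; exists N.
have := h N (leqnn _) => /ltW hN; split => //.
rewrite -conv_trunc convB; apply: le_trans hN.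
by apply: (conv_bound _).2; exact: l2B.
Qed.

Lemma ev_conv g z : l2 g -> nrm z < 1 -> ev (conv g) z = m z * ev g z.
Proof.
move=> hg hz; apply/eqP; rewrite -subr_eq0; apply/eqP.
have [lc _] := conv_bound hg; have lk := l2_kz hz.
apply: (@small_eq0 _ _ (2 * rsq (kz z) * (1 + nrm (m z) ^+ 2))) => e e0.
have [N [h1 h2]] := conv_approx hg e0.
have lV := l2_VN N g.
have E : ev (VN N g) z = m z * ev (trunc N g) z.
  rewrite !ev_ip /VN /trunc !ip_suml//; [|by move=> i; apply: l2Z..].
  rewrite mulr_sumr; apply: eq_bigr => i _.
  rewrite !ipZl// -!ev_ip ev_iter// ev_del// hm//; ring.
(* The product formula holds for the truncation by [E]; subtracting it leaves two evaluations of
   small vectors. *)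
have -> : ev (conv g) z - m z * ev g z =
   m z * ev (trunc N g - g) z - ev (VN N g - conv g) z.
  by rewrite !evB//; rewrite E; ring.
set p := ev (trunc N g - g) z; set q := ev (VN N g - conv g) z.
have hp : nrm p ^+ 2 <= e * rsq (kz z).
  rewrite /p ev_ip; apply: le_trans (CauchySchwarz _ lk) _ => //; first exact: l2B.
  by rewrite ler_wpM2r ?rsq_ge0.
have hq : nrm q ^+ 2 <= e * rsq (kz z).
  rewrite /q ev_ip; apply: le_trans (CauchySchwarz _ lk) _ => //; first exact: l2B.
  by rewrite ler_wpM2r ?rsq_ge0.
apply: (@le_trans _ _ (2 * (nrm (m z) ^+ 2 * nrm p ^+ 2) + 2 * nrm q ^+ 2)).
  have := nrmD (m z * p) (- q); rewrite nrmN nrmM.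
  have := nrm_ge0 (m z * p - q); have := nrm_ge0 p; have := nrm_ge0 q.
  have := nrm_ge0 (m z).
  move: (nrm (m z)) (nrm p) (nrm q) (nrm (m z * p - q)) => u v w s u0 w0 v0 s0 hs.
  rewrite -exprMn; have := mulr_ge0 u0 v0; move: (u * v) hs => t hs t0.
  have := sqr_ge0 (t - w); nra.
have h3 : nrm (m z) ^+ 2 * nrm p ^+ 2 <= nrm (m z) ^+ 2 * (e * rsq (kz z)).
  by rewrite ler_wpM2l// sqr_ge0.
have -> : e * (2 * rsq (kz z) * (1 + nrm (m z) ^+ 2)) =
  2 * (nrm (m z) ^+ 2 * (e * rsq (kz z))) + 2 * (e * rsq (kz z)) by ring.
by apply: lerD; rewrite ler_pM2l.
Qed.

(** The model space tested on countably many vectors, which suffices because polynomial multiples of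
    [m] are dense in [mH2 m]; see [modelE]. *)
Definition Kset x := l2 x /\ forall k, ip x (A k) = 0.

Lemma K_conv x g : Kset x -> l2 g -> ip x (conv g) = 0.
Proof.
move=> [hx xA] hg; have [lc _] := conv_bound hg.
apply: (@small_eq0 _ _ (rsq x)) => e e0.
have [N [_ h]] := conv_approx hg e0; have lV := l2_VN N g.
have -> : ip x (conv g) = - ip x (VN N g - conv g).
  rewrite ipBr// (ipC lV hx) /VN ip_suml//; last by move=> i; apply: l2Z.
  rewrite big1 ?rmorph0 ?sub0r ?opprK// => i _.
  by rewrite ipZl// (ipC hx (lA i)) xA rmorph0 mulr0.
rewrite nrmN; apply: le_trans (CauchySchwarz hx _) _; first exact: l2B.
by rewrite mulrC ler_wpM2r ?rsq_ge0.
Qed.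

Lemma modelE : model m = (Kset : set (seqC R)).
Proof.
apply/seteqP; split => x.
  move=> [/is_H2E hx xm]; split => // k.
  rewrite -ipH2E//; apply: xm; split; first exact/is_H2E.
  exists (del R k); split; first by apply/is_H2E; exact: l2_del.
  move=> z /discE hz; rewrite (evalH2E (lA k) hz).
  by rewrite (evalH2E (l2_del R k) hz) ev_del// ev_iter// hm// mulrC.
move=> Kx; have hx := Kx.1; split; first exact/is_H2E.
move=> h [/is_H2E hh [g [/is_H2E hg hE]]].
have [lc _] := conv_bound hg.
(* [h] is known only through its values on the disc; injectivity of evaluation recovers its
   coefficients. *)
have -> : h = conv g.
  apply: ev_inj => // z hz; rewrite ev_conv//.
  by have := hE z; rewrite !evalH2E//; apply; apply/discE.
by rewrite ipH2E// K_conv.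
Qed.

Lemma K_lin (c : C) x y : Kset x -> Kset y -> Kset (c *: x + y).
Proof.
move=> [hx xA] [hy yA]; have hcx := l2Z c hx; split => [|k]; first exact: l2D.
by rewrite ipDl// ipZl// xA yA mulr0 addr0.
Qed.

Lemma K0 : Kset 0.
Proof. by split => [|k]; [exact: l20|exact: ip0l]. Qed.

Lemma KZ c x : Kset x -> Kset (c *: x).
Proof. by move=> Kx; rewrite -[_ *: _]addr0; exact: K_lin Kx K0. Qed.

Lemma KB x y : Kset x -> Kset y -> Kset (x - y).
Proof. by move=> Kx Ky; rewrite -scaleN1r addrC; exact: K_lin. Qed.

(** The family of the [A k] is stable under [sh], so its orthogonal complement is stable under the
    adjoint. *)
Lemma K_bs x : Kset x -> Kset (bs x).
Proof.
move=> [hx xA]; split => [|k]; first exact: l2bs.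
by rewrite ip_bs// (xA k.+1).
Qed.

Lemma ip_AK k x : Kset x -> ip (A k) x = 0.
Proof. by move=> [hx xA]; rewrite (ipC hx (lA k)) xA rmorph0. Qed.

(** A relation because [projH] selects its value by choice: each projection met below has an
    explicit witness, and uniqueness identifies the two. *)
Definition isproj x y := Kset y /\ forall h, Kset h -> ip (x - y) h = 0.

Lemma isproj_uniq x y y' : l2 x -> isproj x y -> isproj x y' -> y = y'.
Proof.
move=> hx [Ky hy] [Ky' hy']; apply/eqP; rewrite -subr_eq0; apply/eqP.
have Kd := KB Ky Ky'; have [ly _] := Ky; have [ly' _] := Ky'; have [ld _] := Kd.
apply: ip_eq0 => //.
have E : y - y' = (x - y') - (x - y) by apply/funext => n; rewrite !fctE; ring.
by rewrite {1}E ipBl ?hy ?hy' ?subrr//; exact: l2B.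
Qed.

Lemma projHE x y : l2 x -> isproj x y -> projH m x = y.
Proof.
move=> hx p; have [Ky hy] := p; have [ly _] := Ky.
rewrite /projH; case: xgetP => [y' _ [/= my hy']|/(_ y)[]].
  move: my; rewrite modelE => Ky'; have [ly' _] := Ky'.
  apply: (isproj_uniq hx) p; split => // h Kh; have [lh _] := Kh.
  have := hy' h; rewrite modelE ipH2E//; last exact: l2B.
  exact.
rewrite /= modelE; split => // h Kh; have [lh _] := Kh.
by rewrite ipH2E ?hy//; exact: l2B.
Qed.

(* The compressed shift: [P_H] only has to remove the component along [a],
   because [sh y] is already orthogonal to every [iter k.+1 sh a]. *)
Definition T y : vec := sh y - ip (sh y) a *: a.

(** As [bs] preserves [Kset], its adjoint [sh] preserves the orthogonal complement, so projecting
    before the shift does not change the projection after it. *)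
Lemma isproj_T x y : l2 x -> isproj x y -> isproj (sh x) (T y).
Proof.
move=> hx [Ky hy]; have [ly yA] := Ky; have ls := l2sh ly.
have lc := l2Z (ip (sh y) a) ha.
have lT : l2 (T y) by exact: l2B.
have lsA k : l2 (sh (A k)) := lA k.+1.
split.
  split => // -[|k]; rewrite /T ipBl//= ?ipZl//.
    by rewrite -[ip a a]/(ip (A 0) (A 0)) orthA eqxx mulr1 subrr.
  rewrite -[ip a (sh (A k))]/(ip (A 0) (A k.+1)) orthA mulr0 subr0.
  by rewrite ip_sh_sh.
move=> h Kh; have [lh _] := Kh.
have -> : sh x - T y = sh (x - y) + ip (sh y) a *: a.
  have -> : sh (x - y) = sh x - sh y.
    by apply/funext => -[|n]; rewrite !fctE //= subr0.
  by rewrite /T; apply/funext => n; rewrite !fctE; ring.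
have lxy := l2B hx ly.
rewrite ipDl//; last exact: l2sh.
rewrite ip_sh// ipZl// -[ip a h]/(ip (A 0) h) ip_AK// mulr0 addr0.
by apply: hy; exact: K_bs.
Qed.

Lemma isproj_id x : Kset x -> isproj x x.
Proof. by move=> Kx; split => // h Kh; rewrite subrr ip0l. Qed.

Lemma isproj_lin c x x' y y' : l2 x -> l2 x' -> isproj x y -> isproj x' y' ->
  isproj (c *: x + x') (c *: y + y').
Proof.
move=> lx lx' [Ky hy] [Ky' hy']; split; first exact: K_lin.
have [ly _] := Ky; have [ly' _] := Ky'.
move=> h Kh; have [lh _] := Kh.
have -> : c *: x + x' - (c *: y + y') = c *: (x - y) + (x' - y').
  by rewrite scalerBr opprD addrACA.
have l1 := l2B lx ly; have l3 := l2B lx' ly'.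
by rewrite ipDl ?ipZl ?hy ?hy' ?mulr0 ?addr0//; exact: l2Z.
Qed.

Lemma Tm_T x : Kset x -> Tm m x = T x.
Proof.
by move=> Kx; have [lx _] := Kx; apply: projHE; [exact: l2sh|apply: isproj_T => //; exact: isproj_id].
Qed.

Lemma K_T x : Kset x -> Kset (T x).
Proof.
by move=> Kx; have [lx _] := Kx; have [] := isproj_T lx (isproj_id Kx).
Qed.

Lemma Tm_TT x : Kset x -> Tm m (Tm m x) = T (T x).
Proof. by move=> Kx; rewrite Tm_T// Tm_T//; exact: K_T. Qed.

Lemma TTE x : l2 x -> T (T x) =
  sh (sh x) - (ip (sh (sh x)) a *: a + ip (sh (sh x)) (sh a) *: sh a).
Proof.
move=> lx; have ls := l2sh lx; have lss := l2sh ls; have lsa := l2sh ha.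
have E : sh (T x) = sh (sh x) - ip (sh (sh x)) (sh a) *: sh a.
  rewrite ip_sh_sh//; apply/funext => -[|n]; rewrite /T !fctE //=.
  by rewrite /GRing.scale/= mulr0 subr0.
rewrite {1}/T E ipBl//; last exact: l2Z.
rewrite ipZl// -[ip (sh a) a]/(ip (A 1) (A 0)) orthA mulr0 subr0.
by rewrite opprD addrA addrAC.
Qed.

(** The vectors subtracted in [TTE] are orthogonal to [y], so only the double shift contributes. *)
Lemma ip_TT x y : Kset x -> Kset y -> ip (T (T x)) y = ip x (bs (bs y)).
Proof.
move=> [lx _] Ky; have [ly _] := Ky; have lb := l2bs ly.
have lsa := l2sh ha; have ls := l2sh lx; have lss := l2sh ls.
rewrite TTE// ipBl//; last first.
  by apply: l2D; exact: l2Z.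
rewrite ipDl ?ipZl//; [|exact: l2Z..].
rewrite -[ip a y]/(ip (A 0) y) -[ip (sh a) y]/(ip (A 1) y) !ip_AK// !mulr0 addr0 subr0.
by rewrite ip_sh// ip_sh.
Qed.

End ModelSpace.

(** * Sufficiency: reducing subspaces cut out by a pair condition *)

Section Reducing.
Variable R : realType.
Local Notation C := R[i].
Local Notation vec := (nat -> C).
Local Notation sh := (@Defs.shift R).
Local Open Scope complex_scope.
Local Open Scope ring_scope.
Implicit Types (x y h : vec) (z : C).
Variables (a : vec) (m : Cx R -> Cx R).
Hypothesis ha : l2 a.
Hypothesis a_orth : forall k, ip (iter k sh a) a = (k == 0%N)%:R.
Hypothesis hm : forall z : C, nrm z < 1 -> m z = ev a z.
Hypothesis hdim : dim_ge2 (model m).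

Local Notation A k := (iter k sh a).
Local Notation K := (Kset a).
Local Notation T := (T a).

Let lA k : l2 (A k). Proof. exact: l2_iter. Qed.
Let lsa : l2 (sh a) := lA 1.

(** Under such a recurrence an element of [K] is determined by its constant term, so [K] would have
    dimension at most 1. This excludes both trivial subspaces below. *)
Lemma two_term_dim (w0 w1 : C) : (w0 != 0) || (w1 != 0) ->
  ~ (forall h, K h -> forall n, w0 * h n + w1 * h n.+1 = 0).
Proof.
move=> w H; have [f1 [f2 [K1 [K2 ind]]]] := hdim.
move: K1 K2; rewrite (modelE ha a_orth hm) => K1 K2.
have z0 h : K h -> h 0%N = 0 -> h = 0.
  move=> Kh h0; have [w1z|w1n] := eqVneq w1 0.
    have w0n : w0 != 0 by move: w; rewrite w1z eqxx orbF.
    apply/funext => n; have := H h Kh n; rewrite w1z mul0r addr0 => /eqP.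
    by rewrite mulf_eq0 (negbTE w0n) => /eqP.
  apply/funext; elim => [//|n IH]; have := H h Kh n; rewrite IH mulr0 add0r => /eqP.
  by rewrite mulf_eq0 (negbTE w1n) => /eqP.
have g0 : f2 0%N *: f1 + (- f1 0%N) *: f2 = 0 :> vec.
  apply: z0; first by apply: K_lin => //; apply: KZ.
  by rewrite !fctE /GRing.scale/=; ring.
have [_ /eqP] := ind _ _ g0; rewrite oppr_eq0 => /eqP f10.
have f1z : f1 = 0 by exact: z0.
have : 1 *: f1 + 0 *: f2 = 0 :> vec by rewrite f1z scaler0 scale0r addr0.
by move=> /ind[/eqP]; rewrite oner_eq0.
Qed.

Section Sufficiency.
Variables al be : C.
Hypothesis u0 : (al != 0) || (be != 0).
(* The functions [g(z^2) (al + be z)]. *)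
Let X x := forall k : nat, be * x k.*2 = al * x k.*2.+1.
(** The vector produced here is the projection onto the span of [a] and [sh a], which is what the
    compression removes from a double shift. *)
Hypothesis XA : forall x, l2 x -> X x -> X (ip x a *: a + ip x (sh a) *: sh a).

Lemma reducible_of_pairs : reducible (model m) (fun x => Tm m (Tm m x)).
Proof.
rewrite /reducible (modelE ha a_orth hm).
exists (fun x : vec => K x /\ X x).
have Xlin c x y : X x -> X y -> X (c *: x + y).
  move=> hx hy k; rewrite !fctE /GRing.scale/= !mulrDr hy mulrCA hx; ring.
have XB x y : X x -> X y -> X (x - y).
  by move=> hx hy; rewrite -scaleN1r addrC; exact: Xlin.
have Xss x : X x -> X (sh (sh x)).
  by move=> hx [|k]; rewrite /= ?mulr0//; exact: hx.
split; [|split; [|split; [|split]]].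
- split; first by move=> x [].
  split; first by split; [exact: K0|move=> k; rewrite !mulr0].
  split; first by move=> c x y [Kx Xx] [Ky Xy]; split; [exact: K_lin|exact: Xlin].
  move=> u x /is_H2E lx Mu cv.
  have lu k : l2 (u k) by have [[]] := Mu k.
  have small e : 0 < e -> exists k, rsq (u k - x) <= e.
    move=> e0; move/cvgCxP : cv => /(_ e e0)[k _ /(_ k (leqnn k))] /=.
    have ld : l2 (u k - x) by exact: l2B.
    rewrite nsqH2E// sub0r nrmN nrm_real ger0_norm ?rsq_ge0// => /ltW h.
    by exists k.
  (* Each coefficient is bounded by the norm, so the pair condition survives norm limits. *)
  have pt n (c d : C) : (forall k, c * u k n.*2 = d * u k n.*2.+1) ->
      c * x n.*2 = d * x n.*2.+1.
    move=> h; apply/eqP; rewrite -subr_eq0; apply/eqP.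
    apply: (@small_eq0 _ _ (2 * nrm c ^+ 2 + 2 * nrm d ^+ 2)) => e e0.
    have [k hk] := small e e0; have ld : l2 (u k - x) by exact: l2B.
    have -> : c * x n.*2 - d * x n.*2.+1 =
       d * (u k - x) n.*2.+1 - c * (u k - x) n.*2.
      by rewrite !fctE !mulrBr h; ring.
    have h1 := le_trans (sq_le_rsq n.*2 ld) hk.
    have h2 := le_trans (sq_le_rsq n.*2.+1 ld) hk.
    set p := (u k - x) n.*2.+1 in h2 *; set q := (u k - x) n.*2 in h1 *.
    have := nrmD (d * p) (- (c * q)); rewrite nrmN !nrmM => h3.
    have h4 : (nrm d * nrm p) ^+ 2 <= nrm d ^+ 2 * e.
      by rewrite exprMn ler_wpM2l// sqr_ge0.
    have h5 : (nrm c * nrm q) ^+ 2 <= nrm c ^+ 2 * e.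
      by rewrite exprMn ler_wpM2l// sqr_ge0.
    have := nrm_ge0 (d * p - c * q).
    move: (nrm (d * p - c * q)) h3 => r h3 r0.
    move: (nrm d * nrm p) (nrm c * nrm q) h3 h4 h5 => s t h3 h4 h5.
    have := sqr_ge0 (s - t); nra.
  split; last by move=> n; apply: pt => k; have [_] := Mu k; exact.
  split => // k; apply: (@small_eq0 _ _ (rsq (A k))) => e e0.
  have [j hj] := small e e0; have ld : l2 (u j - x) by exact: l2B.
  have -> : ip x (A k) = - ip (u j - x) (A k).
    by rewrite ipBl//; have [[_ ->] _] := Mu j; rewrite sub0r opprK.
  rewrite nrmN; apply: le_trans (CauchySchwarz ld (lA k)) _.
  by rewrite ler_wpM2r// rsq_ge0.
- (* The projection of [al + be z] onto the model space lies in [M]. *)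
  move=> M0.
  pose u : vec := al *: del R 0 + be *: del R 1.
  have lu : l2 u by apply: l2D; exact: l2Z.
  have Xu : X u.
    move=> [|k]; rewrite /u !fctE /del /GRing.scale/=; first by ring.
    by ring.
  pose w : vec := ip u a *: a + ip u (sh a) *: sh a.
  have lw : l2 w by apply: l2D; exact: l2Z.
  have Ku : K (u - w).
    split; first exact: l2B.
    move=> k; rewrite (ipBl lu lw (lA k)).
    have -> : ip w (A k) = ip u a * ip (A 0) (A k) + ip u (sh a) * ip (A 1) (A k).
      by rewrite ipDl ?ipZl//; exact: l2Z.
    rewrite !(orthA ha a_orth).
    case: k => [|[|k]]; rewrite ?eqxx/= ?mulr1 ?mulr0 ?addr0 ?add0r ?subrr//.
    rewrite subr0.
    have -> : ip u (A k.+2) = al * ip (del R 0) (A k.+2) + be * ip (del R 1) (A k.+2).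
      by rewrite ipDl ?ipZl//; exact: l2Z.
    rewrite !(ipC (lA k.+2) (l2_del _ _)) !(ip_del _ (lA k.+2)) /=.
    by rewrite rmorph0 !mulr0 addr0.
  have : [set 0 : seqC R] (u - w) by rewrite -M0; split => //; apply: XB => //; exact: XA.
  (* Now [u] lies in the span of [a] and [sh a], hence is orthogonal to [K]. This is a two-term
     relation between the first two coefficients of every [h] in [K], and [bs] propagates it. *)
  move=> /= uw; have {}uw : u = w by apply/eqP; rewrite -subr_eq0; apply/eqP.
  apply: (@two_term_dim al^* be^*); first by rewrite !conjC_eq0.
  have base h : K h -> al^* * h 0%N + be^* * h 1%N = 0.
    move=> Kh; have [lh _] := Kh.
    have : ip u h = 0.
      rewrite uw /w ipDl//; [|exact: l2Z..].
      by rewrite !ipZl// (ip_AK ha 0 Kh) (ip_AK ha 1 Kh) !mulr0 addr0.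
    rewrite /u ipDl//; [|exact: l2Z..].
    rewrite !ipZl// !(ipC lh (l2_del _ _)) !ip_del// => /(congr1 Num.conj).
    by rewrite rmorphD !rmorphM/= !conjCK rmorph0.
  move=> h Kh n; elim: n h Kh => [|n IH] h Kh; first exact: base.
  exact: (IH _ (K_bs ha Kh)).
(* If all of [K] satisfied the pair condition, stability under [bs] would spread it from even
   positions to all positions. *)
- move=> MK; apply: (@two_term_dim be (- al)); first by rewrite oppr_eq0 orbC.
  have base h : K h -> be * h 0%N + - al * h 1%N = 0.
    move=> Kh; have /= e := congr1 (fun f : set vec => f h) MK.
    have [_ /(_ 0%N)/= ->] : K h /\ X h by rewrite e.
    by rewrite mulNr subrr.
  move=> h Kh n; elim: n h Kh => [|n IH] h Kh; first exact: base.
  exact: (IH _ (K_bs ha Kh)).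
- move=> x [Kx Xx]; have [lx _] := Kx.
  rewrite (Tm_TT ha a_orth hm Kx); split; first by apply: (K_T ha a_orth); exact: (K_T ha a_orth).
  rewrite TTE//; apply: XB; first exact: Xss.
  by apply: XA; [do 2! apply: l2sh|exact: Xss].
- move=> y z [Ky Xy] Kz adj; have [ly _] := Ky; have [lz _] := Kz.
  have Kb := K_bs ha (K_bs ha Ky); have [lb _] := Kb.
  (* Dropping the first pair of coefficients keeps the pair condition. *)
  suff -> : z = bs (bs y).
    by split => // k; exact: (Xy k.+1).
  apply/eqP; rewrite -subr_eq0; apply/eqP.
  have Kd := KB ha Kz Kb; have [ld _] := Kd.
  apply: ip_eq0 => //; rewrite ipBr//.
  have := adj _ Kd; rewrite (Tm_TT ha a_orth hm Kd) !ipH2E//; last first.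
    by have [] := K_T ha a_orth (K_T ha a_orth Kd).
  by rewrite ip_TT// => ->; rewrite subrr.
Qed.
End Sufficiency.

(** The reducing subspace consists of the even functions in [K]: for even [a] the vector [sh a] is
    odd, hence orthogonal to them. *)
Lemma reducible_of_even : (forall k, a k.*2.+1 = 0) ->
  reducible (model m) (fun x => Tm m (Tm m x)).
Proof.
move=> ev; apply: (@reducible_of_pairs 1 0); first by rewrite oner_eq0.
move=> x lx Xx k.
have -> : ip x (sh a) = 0.
  apply: csum_eq0 => n; rewrite -(odd_double_half n); case: (odd n) => /=.
    by have := Xx n./2; rewrite mul0r mul1r add1n => <-; rewrite mul0r.
  rewrite add0n; case: n./2 => [|j]; first by rewrite /= rmorph0 mulr0.
  by rewrite doubleS /= ev rmorph0 mulr0.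
by rewrite !fctE /GRing.scale/= ev; ring.
Qed.

Lemma reducible_of_rec (mu : C) :
  (forall k, (1 - mu * mu^*) * a k.*2 = mu * a k.*2.+1 - mu^* * sh a k.*2) ->
  reducible (model m) (fun x => Tm m (Tm m x)).
Proof.
move=> rec; apply: (@reducible_of_pairs mu 1); first by rewrite oner_eq0 orbT.
move=> x lx Xx k.
(* [(z - mu) m] is orthogonal to [x], so the two coefficients are proportional. *)
have E : ip x (sh a) = mu^* * ip x a.
  have lma := l2Z mu ha.
  suff : ip x (sh a - mu *: a) = 0.
    by rewrite ipBr// ipZr// => /eqP; rewrite subr_eq0 => /eqP.
  have lw : l2 (sh a - mu *: a) by exact: l2B.
  pose v n := x n * ((sh a - mu *: a) n)^*.
  have sv : csable v by exact: l2_csable.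
  (* Given that [x] at [2k] is [mu] times [x] at [2k + 1], the conjugated recurrence is exactly the
     cancellation of these two terms. *)
  have pair k' : v k'.*2 + v k'.*2.+1 = 0.
    rewrite /v !fctE /GRing.scale/=; have := Xx k'; rewrite mul1r => ->.
    have := rec k' => /(congr1 Num.conj).
    rewrite !(rmorphB, rmorphM, rmorph1)/= conjCK => rk.
    set p := (a k'.*2)^* in rk *; set q := (a k'.*2.+1)^* in rk *.
    set s := (sh a k'.*2)^* in rk *.
    have -> : mu * x k'.*2.+1 * (s - mu^* * p) + x k'.*2.+1 * (p - mu^* * q) =
      x k'.*2.+1 * (p - mu * mu^* * p - (mu^* * q - mu * s)) by ring.
    by rewrite -rk; ring.
  have sums N : \sum_(0 <= n < N.*2) v n = 0.
    elim: N => [|N IH]; first by rewrite big_geq.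
    by rewrite doubleS !big_nat_recr//= IH add0r pair.
  have := cvg_csum sv => /cvgCxP cv; change (csum v = 0).
  apply: (@small_eq0 _ _ 1) => e e0; rewrite mulr1.
  have := cv (Num.min e 1); rewrite lt_min e0 ltr01 => /(_ isT)[N _ h].
  have := h N.*2; rewrite /= -addnn leq_addr => /(_ isT).
  rewrite addnn /series /= (_ : \sum_(0 <= k < N.*2) _ = 0); last exact: sums.
  rewrite subr0 lt_min => /andP[h1 h2]; have r0 := nrm_ge0 (csum v).
  by nra.
(* The projection is now [ip x a] times [a + mu^* *: sh a], and [rec] is the pair condition for this
   vector. *)
rewrite E !fctE /GRing.scale/= mul1r.
have := rec k; move: (a k.*2) (a k.*2.+1) (sh a k.*2) => p q s rk.
have -> : ip x a * p + mu^* * ip x a * s =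
  ip x a * ((1 - mu * mu^*) * p + mu^* * s + mu * mu^* * p) by ring.
by rewrite rk; ring.
Qed.

End Reducing.

(** * Necessity: the structure of a reducing subspace *)

Section Necessity.
Variable R : realType.
Local Notation C := R[i].
Local Notation vec := (nat -> C).
Local Notation sh := (@Defs.shift R).
Local Open Scope complex_scope.
Local Open Scope ring_scope.
Implicit Types (x y h : vec) (z : C).
Variable a : vec.
Hypothesis ha : l2 a.
Hypothesis a_orth : forall k, ip (iter k sh a) a = (k == 0%N)%:R.

Local Notation A k := (iter k sh a).
Local Notation K := (Kset a).
Local Notation T := (T a).
Local Notation isproj := (isproj a).

Let lA k : l2 (A k). Proof. exact: l2_iter. Qed.
Let lsa : l2 (sh a) := lA 1.

(** The projection of the monomial z^n: as [A k] vanishes below index [k], only [A 0] to [A n] have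
    to be removed. *)
Definition pdel n : vec := del R n - VN a n.+1 (fun k => ip (del R n) (A k)).

Lemma isproj_pdel n : isproj (del R n) (pdel n).
Proof.
have ld := l2_del R n.
have lV := l2_VN ha n.+1 (fun k => ip (del R n) (A k)).
have lp : l2 (pdel n) by exact: l2B.
split.
  split => // k; rewrite ipBl// (ip_VN ha a_orth); case: ltnP => nk.
    by rewrite subrr.
  by rewrite subr0 (ipC (lA k) ld) ip_del// iter_shE leqNgt nk/= rmorph0.
move=> h Kh; have [lh _] := Kh.
rewrite /pdel opprB addrC subrK /VN ip_suml//; last by move=> i; exact: l2Z.
by rewrite big1// => i _; rewrite ipZl// (ip_AK ha _ Kh) mulr0.
Qed.

Lemma isprojZ c x y : l2 x -> isproj x y -> isproj (c *: x) (c *: y).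
Proof.
move=> lx p; have := isproj_lin ha c lx (l20 R) p (isproj_id (K0 a)).
by rewrite !addr0.
Qed.

Lemma isprojD x y x' y' : l2 x -> l2 x' -> isproj x y -> isproj x' y' ->
  isproj (x + x') (y + y').
Proof.
by move=> lx lx' p p'; have := isproj_lin ha 1 lx lx' p p'; rewrite !scale1r.
Qed.

Lemma isproj_pdel2 (c d : C) j k :
  isproj (c *: del R j + d *: del R k) (c *: pdel j + d *: pdel k).
Proof.
have ld := l2_del R.
by apply: isprojD; [exact: l2Z|exact: l2Z|apply: isprojZ..];
  rewrite //; exact: isproj_pdel.
Qed.

Lemma isproj_contract x y : l2 x -> isproj x y -> rsq y <= rsq x.
Proof.
move=> lx [Ky hy]; have [ly _] := Ky; have ld := l2B lx ly.
have E : x = (x - y) + y by rewrite subrK.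
suff -> : rsq x = rsq (x - y) + rsq y by rewrite lerDr rsq_ge0.
apply: complexI; rewrite rmorphD/= -!ipxx {1 2}E.
rewrite ipDl//; last by rewrite -E.
by rewrite (ipDr ld ly ld) (ipDr ld ly ly) (ipC ld ly) (hy _ Ky) rmorph0 addr0 add0r.
Qed.

Section Invariant.
Variable M : set vec.
Hypothesis MK : M `<=` K.
Hypothesis M_lin : forall (c : C) x y, M x -> M y -> M (c *: x + y).
Hypothesis M0 : M 0.
Hypothesis M_closed : forall (u : nat -> vec) x, l2 x -> (forall k, M (u k)) ->
  (forall e, 0 < e -> exists N, forall k, (N <= k)%N -> rsq (u k - x) <= e) -> M x.
Hypothesis M_ne0 : exists2 x, M x & x != 0.
Hypothesis M_neK : exists2 x, K x & ~ M x.
Hypothesis M_TT : forall x, M x -> M (T (T x)).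
Hypothesis M_bb : forall x, M x -> M (bs (bs x)).

Let MZ c x : M x -> M (c *: x).
Proof. by move=> Mx; rewrite -[_ *: _]addr0; exact: M_lin. Qed.
Let MD x y : M x -> M y -> M (x + y).
Proof. by move=> Mx My; rewrite -[x]scale1r; exact: M_lin. Qed.
Let MB x y : M x -> M y -> M (x - y).
Proof. by move=> Mx My; rewrite -scaleN1r addrC; exact: M_lin. Qed.

Let shift2 n : sh (sh (del R n)) = del R n.+2.
Proof. by rewrite -[sh _]/(iter 2 sh (del R n)) iter_del addn2. Qed.

(** By [isproj_T], both sides are projections of the monomial z^(n+2). *)
Lemma TT_pdel n : T (T (pdel n)) = pdel n.+2.
Proof.
apply: (isproj_uniq ha (l2_del R n.+2)) (isproj_pdel _).
rewrite -shift2; have ld := l2_del R n; have ls := l2sh ld.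
by apply: isproj_T => //; apply: isproj_T => //; exact: isproj_pdel.
Qed.

(** Subtracting from [x] the image under T^2 of its adjoint image leaves the projection of x_0 + x_1
    z, and [M] is stable under both operators. *)
Lemma M_proj_head x : M x -> M (x 0%N *: pdel 0 + x 1%N *: pdel 1).
Proof.
move=> Mx; have Kx := MK Mx; have [lx _] := Kx.
have Mb := M_bb Mx; have Kb := MK Mb; have [lb _] := Kb.
suff -> : x 0%N *: pdel 0 + x 1%N *: pdel 1 = x - T (T (bs (bs x))).
  by apply: MB => //; exact: M_TT.
have E : sh (sh (bs (bs x))) = x - (x 0%N *: del R 0 + x 1%N *: del R 1).
  apply/funext => -[|[|n]]; rewrite !fctE /del /bs /GRing.scale/=; ring.
have ls := l2sh lb.
have p1 : isproj (sh (sh (bs (bs x)))) (T (T (bs (bs x)))).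
  apply: isproj_T => //; apply: isproj_T => //; exact: isproj_id.
have ld0 := l2_del R 0; have ld1 := l2_del R 1.
have p2 : isproj (x 0%N *: del R 0 + x 1%N *: del R 1) (x 0%N *: pdel 0 + x 1%N *: pdel 1).
  exact: isproj_pdel2.
have l01 : l2 (x 0%N *: del R 0 + x 1%N *: del R 1) by apply: l2D; exact: l2Z.
have p3 := isproj_lin ha (-1) l01 lx p2 (isproj_id Kx).
have : isproj (sh (sh (bs (bs x)))) (- 1 *: (x 0%N *: pdel 0 + x 1%N *: pdel 1) + x).
  by rewrite E [x - _]addrC -scaleN1r.
move=> /(isproj_uniq ha (l2sh ls) p1) ->.
by rewrite scaleN1r; apply/funext => n; rewrite !fctE; ring.
Qed.

(* The pairs of leading coefficients of elements of [M] fill a line: they are not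
   all zero because [M] is invariant under the square of the backward shift, and
   if they spanned the plane then [M] would contain the projection of every
   monomial. *)
Lemma M_heads : exists al be : C, [/\ (al != 0) || (be != 0),
  (forall x, M x -> forall k, be * x k.*2 = al * x k.*2.+1) &
  forall k, M (al *: pdel k.*2 + be *: pdel k.*2.+1)].
Proof.
have bb x k : M x -> M (fun n => x (k.*2 + n)%N).
  elim: k x => [|k IH] x Mx //.
  have := M_bb (IH x Mx); congr M; apply/funext => n.
  by rewrite /bs doubleS !addSn !addnS.
have [x Mx xh] : exists2 x, M x & (x 0%N != 0) || (x 1%N != 0).
  apply: contrapT => H; have [x Mx /eqP] := M_ne0; apply.
  apply/funext => n; rewrite -[RHS]/(0 : C); apply: contrapT => /eqP xn; apply: H.
  exists (fun j => x (n./2.*2 + j)%N); first exact: bb.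
  move: xn; rewrite -{1}(odd_double_half n) addnC; case: (odd n) => xn.
    by rewrite xn orbT.
  by rewrite xn.
exists (x 0%N), (x 1%N).
have prop y : M y -> x 1%N * y 0%N = x 0%N * y 1%N.
  move=> My; apply: contrapT => /eqP; rewrite -subr_eq0 => d0.
  have Mx' := M_proj_head Mx; have My' := M_proj_head My.
  (* If the heads of [x] and [y] were independent, Cramer's rule with determinant [d] would put
     [pdel 0] and [pdel 1] in [M], and T^2 all the others. *)
  set d := x 1%N * y 0%N - x 0%N * y 1%N in d0.
  have P0 : M (pdel 0).
    have -> : pdel 0 = d^-1 *: (x 1%N *: (y 0%N *: pdel 0 + y 1%N *: pdel 1)
        - y 1%N *: (x 0%N *: pdel 0 + x 1%N *: pdel 1)).
      by apply/funext => n; rewrite !fctE /GRing.scale/= /d; field.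
    by apply: MZ; apply: MB; exact: MZ.
  have P1 : M (pdel 1).
    have -> : pdel 1 = d^-1 *: (y 0%N *: (x 0%N *: pdel 0 + x 1%N *: pdel 1)
        - x 0%N *: (y 0%N *: pdel 0 + y 1%N *: pdel 1)).
      by apply/funext => n; rewrite !fctE /GRing.scale/= /d; field.
    by apply: MZ; apply: MB; exact: MZ.
  have P n : M (pdel n).
    have [] : M (pdel n) /\ M (pdel n.+1) => //.
    elim: n => [//|n [h1 h2]]; split => //.
    by rewrite -TT_pdel; exact: M_TT.
  have [w Kw nMw] := M_neK; apply: nMw; have [lw _] := Kw.
  (* [u N] is the projection of [trunc N w]; since projecting contracts and fixes [w], it converges
     to [w]. *)
  pose u N : vec := \sum_(i < N) w i *: pdel i.
  apply: (M_closed (u := u)) => // [N|e e0].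
    by apply: big_ind => [//|f g|i _]; [exact: MD|exact: MZ].
  have [N hN] := trunc_tail_small lw e0; exists N => k Nk.
  apply: le_trans (ltW (hN k Nk)).
  have ltk := l2_trunc k w.
  apply: isproj_contract; first exact: l2B.
  have pu : isproj (trunc k w) (u k).
    have [] : l2 (trunc k w) /\ isproj (trunc k w) (u k) => //.
    rewrite /trunc /u; apply: (big_ind2 (fun f g => l2 f /\ isproj f g)).
    - by split; [exact: l20|apply: isproj_id; exact: K0].
    - move=> f1 g1 f2 g2 [lf1 p1] [lf2 p2]; split; first exact: l2D.
      exact: isprojD.
    - move=> i _; have ld := l2_del R i; split; first exact: l2Z.
      by apply: isprojZ => //; exact: isproj_pdel.
  have := isproj_lin ha (-1) lw ltk (isproj_id Kw) pu.
  by rewrite !scaleN1r ![- w + _]addrC.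
split => // [y My k|k].
  by have := prop _ (bb y k My); rewrite addn0 addn1.
elim: k => [|k IH]; first exact: M_proj_head.
rewrite doubleS -!TT_pdel.
have := M_TT IH; congr M.
have ld := l2_del R; have lp n : l2 (pdel n) by have [[]] := isproj_pdel n.
have p n : isproj (del R n.+2) (T (T (pdel n))).
  by rewrite TT_pdel; exact: isproj_pdel.
set f := x 0%N *: del R k.*2.+2 + x 1%N *: del R k.*2.+3.
have lf : l2 f by apply: l2D; exact: l2Z.
apply: (isproj_uniq ha lf).
  have -> : f = sh (sh (x 0%N *: del R k.*2 + x 1%N *: del R k.*2.+1)).
    rewrite /f -!shift2; apply/funext => -[|[|n]]; rewrite !fctE //= /GRing.scale/= ?mulr0 ?addr0//.
  have lg : l2 (x 0%N *: del R k.*2 + x 1%N *: del R k.*2.+1) by apply: l2D; exact: l2Z.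
  have lsg := l2sh lg.
  apply: isproj_T => //; apply: isproj_T => //.
  exact: isproj_pdel2.
by apply: isprojD; [exact: l2Z|exact: l2Z|exact: isprojZ..].
Qed.

Lemma del_parity j n : [/\ del R j.*2.+1 n.*2 = 0, del R j.*2 n.*2.+1 = 0 &
  del R j.*2.+1 n.*2.+1 = del R j.*2 n.*2].
Proof.
have od p q : (p.*2 == q.*2.+1) = false.
  by apply/eqP => /(congr1 odd); rewrite /= !odd_double.
by split; rewrite /del ?od// eq_sym od.
Qed.

(** With [j = 0] the relations would be vacuous when [a 0 = a 1 = 0]; hence the freedom in [j],
    later used to reach the first nonzero pair of coefficients. *)
Lemma M_pair_closed : exists al be : C, [/\ (al != 0) || (be != 0),
  (forall x, M x -> forall k, be * x k.*2 = al * x k.*2.+1) &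
  forall j, (forall i, (i < j.*2)%N -> a i = 0) ->
  let b0 := (a j.*2)^* in let b1 := (a j.*2.+1)^* in
  (forall k, be ^+ 2 * b1 * a k.*2 + be ^+ 2 * b0 * sh a k.*2
     - al * (al * b0 + be * b1) * a k.*2.+1 = 0) /\
  (forall k, al^* ^+ 2 * b1 * a k.*2 + al^* ^+ 2 * b0 * sh a k.*2
     + be^* * (al^* * b1 - be^* * b0) * a k.*2.+1 = 0)].
Proof.
have [al [be [u0 MX Mq]]] := M_heads; exists al, be; split => // j aj b0 b1.
have ld := l2_del R.
(* As [m] vanishes to order [2j], projecting [z^2j (c + d z)] only involves [m] and [z m]. *)
have pr (c d : C) : c *: pdel j.*2 + d *: pdel j.*2.+1 =
    c *: del R j.*2 + d *: del R j.*2.+1 - ((c * b0 + d * b1) *: a + (d * b0) *: sh a).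
  set f := c *: del R j.*2 + d *: del R j.*2.+1.
  have lf : l2 f by apply: l2D; exact: l2Z.
  have lw : l2 ((c * b0 + d * b1) *: a + (d * b0) *: sh a) by apply: l2D; exact: l2Z.
  apply: (isproj_uniq ha lf (isproj_pdel2 _ _ _ _)); split; last first.
    move=> h Kh; have [lh _] := Kh; rewrite opprB addrC subrK ipDl//; [|exact: l2Z..].
    by rewrite !ipZl// (ip_AK ha 0 Kh) (ip_AK ha 1 Kh) !mulr0 addr0.
  split; first exact: l2B.
  move=> k; rewrite (ipBl lf lw (lA k)).
  have -> : ip f (A k) = c * (A k j.*2)^* + d * (A k j.*2.+1)^*.
    rewrite ipDl ?ipZl//; [|exact: l2Z..].
    by rewrite !(ipC (lA k) (ld _)) !(ip_del _ (lA k)).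
  have -> : ip ((c * b0 + d * b1) *: a + (d * b0) *: sh a) (A k) =
     (c * b0 + d * b1) * ip (A 0) (A k) + d * b0 * ip (A 1) (A k).
    by rewrite ipDl ?ipZl//; exact: l2Z.
  rewrite !(orthA ha a_orth).
  case: k => [|[|k]]; rewrite /= ?mulr1 ?mulr0 ?addr0 ?add0r.
  - by rewrite /b0 /b1 subrr.
  - case: j aj @b0 @b1 @f lf lw => [|j] aj b0 b1 f lf lw /=.
      by rewrite rmorph0 mulr0 add0r subrr.
    by rewrite doubleS /= aj ?doubleS// rmorph0 mulr0 add0r subrr.
  - rewrite subr0; have z n : (n <= j.*2.+1)%N -> sh (sh (A k)) n = 0.
      case: n => [|[|n]] //= nj; rewrite iter_shE; case: leqP => // kn.
      by apply: aj; apply: leq_ltn_trans (leq_subr _ _) _.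
    rewrite -[sh (A k) j.*2]/(sh (sh (A k)) j.*2.+1).
    by rewrite (z _ (leqnSn _)) (z _ (leqnn _)) rmorph0 !mulr0 addr0.
split => k.
  have /(MX _)/(_ k) := Mq j; rewrite pr !fctE /GRing.scale/= => E.
  (* The unprojected polynomial satisfies the pair condition by itself; cancelling it leaves a
     condition on the combination of [a] and [sh a]. *)
  have dl n : be * (al * del R j.*2 n.*2 + be * del R j.*2.+1 n.*2) =
     al * (al * del R j.*2 n.*2.+1 + be * del R j.*2.+1 n.*2.+1).
    have [-> -> ->] := del_parity j n; ring.
  move: E; rewrite !mulrBr dl => /addrI/oppr_inj E.
  transitivity (be * ((al * b0 + be * b1) * a k.*2 + be * b0 * sh a k.*2)
    - al * ((al * b0 + be * b1) * a k.*2.+1 + be * b0 * a k.*2)); first by ring.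
  by rewrite E subrr.
(* The projection of [z^2j (- be^* + al^* z)] is orthogonal to [M]. *)
pose r := (- be^*) *: pdel j.*2 + al^* *: pdel j.*2.+1.
have pr_r := isproj_pdel2 (- be^*) al^* j.*2 j.*2.+1.
have [Kr hr] := pr_r; have [lr _] := Kr.
(* The projection moves across the inner product twice: first onto the right factor, giving [q] in
   [M], then off [r]. The pair condition of [q] at [j] concludes. *)
have E : ip r (al *: del R k.*2 + be *: del R k.*2.+1) = 0.
  have lf : l2 (al *: del R k.*2 + be *: del R k.*2.+1) by apply: l2D; exact: l2Z.
  have [Kq hq] := isproj_pdel2 al be k.*2 k.*2.+1.
  have Mk := Mq k; set q := al *: pdel _ + _ in Kq hq Mk.
  have [lq _] := Kq.
  have -> : ip r (al *: del R k.*2 + be *: del R k.*2.+1) = ip r q.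
    apply/eqP; rewrite -subr_eq0 -ipBr// (ipC _ lr); last exact: l2B.
    by rewrite hq// rmorph0.
  have lg : l2 (- be^* *: del R j.*2 + al^* *: del R j.*2.+1) by apply: l2D; exact: l2Z.
  have -> : ip r q = ip (- be^* *: del R j.*2 + al^* *: del R j.*2.+1) q.
    by apply/eqP; rewrite eq_sym -subr_eq0 -ipBl// hr.
  rewrite ipDl ?ipZl//; [|exact: l2Z..].
  rewrite !(ipC lq (ld _)) !(ip_del _ lq).
  have := MX _ Mk j => /(congr1 Num.conj); rewrite !rmorphM /= mulNr => ->.
  by rewrite addNr.
have lr2 : l2 r := lr.
move: E; rewrite ipDr ?ipZr//; [|exact: l2Z..].
rewrite !(ip_del _ lr2) /r pr !fctE /GRing.scale/=.
have dl n : al^* * (- be^* * del R j.*2 n.*2 + al^* * del R j.*2.+1 n.*2) +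
   be^* * (- be^* * del R j.*2 n.*2.+1 + al^* * del R j.*2.+1 n.*2.+1) = 0.
  have [-> -> ->] := del_parity j n; ring.
have := dl k; move: (al^*) (be^*) => p q.
move: (del R j.*2 k.*2) (del R j.*2.+1 k.*2) (del R j.*2 k.*2.+1)
  (del R j.*2.+1 k.*2.+1) => d1 d2 d3 d4 dl0 E.
transitivity ((p * (- q * d1 + p * d2) + q * (- q * d3 + p * d4)) -
  (p * (- q * d1 + p * d2 - ((- q * b0 + p * b1) * a k.*2 + p * b0 * sh a k.*2)) +
   q * (- q * d3 + p * d4 - ((- q * b0 + p * b1) * a k.*2.+1 + p * b0 * a k.*2)))).
  by ring.
by rewrite E dl0 subrr.
Qed.

End Invariant.
End Necessity.

(** * From the two relations to [mu], and from coefficients to functions *)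

Section Characterisation.
Variable R : realType.
Local Notation C := R[i].
Local Notation vec := (nat -> C).
Local Notation sh := (@Defs.shift R).
Local Open Scope complex_scope.
Local Open Scope ring_scope.
Implicit Types (x y h : vec) (z : C).

(** At an even index [sh a] is the preceding odd coefficient, or 0 at index 0, so the recurrence
    starts from 0. *)
Lemma odd_zero_of_rec (a : vec) (c : C) :
  (forall k, a k.*2.+1 = c * sh a k.*2) -> forall k, a k.*2.+1 = 0.
Proof.
move=> h; elim => [|k IH]; rewrite h ?mulr0//.
by rewrite doubleS /= IH mulr0.
Qed.

Lemma two_relations (a : vec) (al be : C) j :
  (al != 0) || (be != 0) -> (a j.*2 != 0) || (a j.*2.+1 != 0) ->
  let b0 := (a j.*2)^* in let b1 := (a j.*2.+1)^* in
  (forall k, be ^+ 2 * b1 * a k.*2 + be ^+ 2 * b0 * sh a k.*2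
     - al * (al * b0 + be * b1) * a k.*2.+1 = 0) ->
  (forall k, al^* ^+ 2 * b1 * a k.*2 + al^* ^+ 2 * b0 * sh a k.*2
     + be^* * (al^* * b1 - be^* * b0) * a k.*2.+1 = 0) ->
  (forall k, a k.*2.+1 = 0) \/ exists2 mu : C, nrm mu < 1 &
  forall k, (1 - mu * mu^*) * a k.*2 = mu * a k.*2.+1 - mu^* * sh a k.*2.
Proof.
move=> u0 aj b0 b1 R1 R2.
(* When [b1 = 0], one of the relations, chosen according to whether [al = 0], ties each odd
   coefficient to the previous odd one, so [a] is even. *)
have [b1z|b1n] := eqVneq b1 0.
  have b0n : b0 != 0.
    move: aj; rewrite -(conjC_eq0 (a j.*2)) -(conjC_eq0 (a j.*2.+1)) -/b0 -/b1.
    by rewrite b1z eqxx orbF.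
  left; have [al0|aln] := eqVneq al 0.
    have ben : be^* != 0 by move: u0; rewrite al0 eqxx /= conjC_eq0.
    apply: (@odd_zero_of_rec _ (al^* ^+ 2 / be^* ^+ 2)) => k.
    have := R2 k; rewrite b1z; set p := al^*; set q := be^* => E.
    apply/eqP; rewrite -subr_eq0.
    have -> : a k.*2.+1 - p ^+ 2 / q ^+ 2 * sh a k.*2 =
       - (p ^+ 2 * 0 * a k.*2 + p ^+ 2 * b0 * sh a k.*2
         + q * (p * 0 - q * b0) * a k.*2.+1) / (b0 * q ^+ 2).
      by field; rewrite ben b0n.
    by rewrite E oppr0 mul0r.
  apply: (@odd_zero_of_rec _ (be ^+ 2 / al ^+ 2)) => k.
  have := R1 k; rewrite b1z => E.
  apply/eqP; rewrite -subr_eq0.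
  have -> : a k.*2.+1 - be ^+ 2 / al ^+ 2 * sh a k.*2 =
     - (be ^+ 2 * 0 * a k.*2 + be ^+ 2 * b0 * sh a k.*2
        - al * (al * b0 + be * 0) * a k.*2.+1) / (b0 * al ^+ 2).
    by field; rewrite aln b0n.
  by rewrite E oppr0 mul0r.
right.
have a1n : a j.*2.+1 != 0 by rewrite -conjC_eq0.
set p := al^* in R2; set q := be^* in R2.
(* Eliminate [a j.*2] and [sh a j.*2] from the relations at [k = j]; the rest carries the nonzero
   factor |al|^2 + |be|^2. *)
have E0 : (be * q - al * p) * b0 = p * be * b1.
  have Sn : be * q + al * p != 0.
    rewrite !mulconj -rmorphD (inj_eq (@complexI _)) paddr_eq0 ?sqr_ge0//.
    by rewrite !sqrf_eq0 !nrm_eq0 andbC negb_and.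
  apply: (mulfI Sn); apply: (mulfI a1n); apply/eqP; rewrite -subr_eq0.
  have -> : a j.*2.+1 * ((be * q + al * p) * ((be * q - al * p) * b0)) -
      a j.*2.+1 * ((be * q + al * p) * (p * be * b1)) =
    p ^+ 2 * (be ^+ 2 * b1 * a j.*2 + be ^+ 2 * b0 * sh a j.*2
       - al * (al * b0 + be * b1) * a j.*2.+1) -
    be ^+ 2 * (p ^+ 2 * b1 * a j.*2 + p ^+ 2 * b0 * sh a j.*2
       + q * (p * b1 - q * b0) * a j.*2.+1) by ring.
  by rewrite R1 R2 !mulr0 subrr.
(* So |al| and |be| differ, which is what places [mu] strictly inside the disc. *)
have Nn : be * q - al * p != 0.
  apply/eqP => N0; move: E0; rewrite N0 mul0r => /esym/eqP.
  rewrite !mulf_eq0 (negbTE b1n) orbF conjC_eq0 => /orP[/eqP z|/eqP z].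
    by move: N0 u0; rewrite z mul0r subr0 eqxx/= => /eqP; rewrite mulf_eq0 conjC_eq0 orbb => ->.
  move: N0 u0; rewrite z mul0r sub0r eqxx orbF => /eqP.
  by rewrite oppr_eq0 mulf_eq0 conjC_eq0 orbb => ->.
(* The required recurrence in homogeneous form, free of [b0] and [b1] thanks to [E0]. It comes from
   [R1] unless [be = 0], and then from [R2]. *)
have star k : (be * q - al * p) * a k.*2 + p * be * sh a k.*2 - al * q * a k.*2.+1 = 0.
  have [be0|ben] := eqVneq be 0.
    have aln : al != 0 by move: u0; rewrite be0 eqxx orbF.
    have pn : p != 0 by rewrite conjC_eq0.
    apply: (mulfI (mulf_neq0 b1n (expf_neq0 2 pn))); rewrite mulr0.
    transitivity ((be * q - al * p) * (p ^+ 2 * b1 * a k.*2 + p ^+ 2 * b0 * sh a k.*2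
       + q * (p * b1 - q * b0) * a k.*2.+1) +
       (p * be * b1 - (be * q - al * p) * b0) *
        (p ^+ 2 * sh a k.*2 - q ^+ 2 * a k.*2.+1)); first by ring.
    by rewrite R2 mulr0 E0 subrr mul0r addr0.
  apply: (mulfI (mulf_neq0 b1n (expf_neq0 2 ben))); rewrite mulr0.
  transitivity ((be * q - al * p) * (be ^+ 2 * b1 * a k.*2 + be ^+ 2 * b0 * sh a k.*2
       - al * (al * b0 + be * b1) * a k.*2.+1) +
       (p * be * b1 - (be * q - al * p) * b0) *
        (be ^+ 2 * sh a k.*2 - al ^+ 2 * a k.*2.+1)); first by ring.
  by rewrite R1 mulr0 E0 subrr mul0r addr0.
have [lt|gt|eq] := ltgtP (nrm al) (nrm be).
- have ben : be != 0 by rewrite -nrm_gt0; apply: le_lt_trans lt; exact: nrm_ge0.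
  have qn : q != 0 by rewrite conjC_eq0.
  exists (al / be).
    by rewrite nrmM nrmV ltr_pdivrMr ?mul1r// nrm_gt0.
  move=> k; rewrite !rmorphM fmorphV/= -/p -/q.
  apply/eqP; rewrite -subr_eq0.
  have -> : (1 - al / be * (p / q)) * a k.*2 - (al / be * a k.*2.+1 - p / q * sh a k.*2)
    = ((be * q - al * p) * a k.*2 + p * be * sh a k.*2 - al * q * a k.*2.+1) / (be * q).
    by field; rewrite qn ben.
  by rewrite star mul0r.
- have aln : al != 0 by rewrite -nrm_gt0; apply: le_lt_trans gt; exact: nrm_ge0.
  have pn : p != 0 by rewrite conjC_eq0.
  exists (- (q / p)).
    by rewrite nrmN nrmM nrmV /p /q !nrm_conj ltr_pdivrMr ?mul1r// nrm_gt0.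
  move=> k; rewrite !(rmorphN, rmorphM) fmorphV/= /p /q !conjCK -/p -/q.
  apply/eqP; rewrite -subr_eq0.
  have -> : (1 - - (q / p) * - (be / al)) * a k.*2
     - (- (q / p) * a k.*2.+1 - - (be / al) * sh a k.*2)
    = - ((be * q - al * p) * a k.*2 + p * be * sh a k.*2 - al * q * a k.*2.+1) / (al * p).
    by field; rewrite pn aln.
  by rewrite star oppr0 mul0r.
- by case/eqP: Nn; rewrite !mulconj eq subrr.
Qed.

Lemma l2_alt x : l2 x -> l2 (fun n => (-1) ^+ n * x n).
Proof.
move=> /l2P h; apply: (l2_le h) => n.
by rewrite nrmM nrmX nrmN nrm1 expr1n mul1r.
Qed.

Lemma ev_opp x z : ev x (- z) = ev (fun n => (-1) ^+ n * x n) z.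
Proof.
by congr csum; apply/funext => n; rewrite [(- z) ^+ n]exprNn mulrCA mulrA.
Qed.

Lemma ev_evenP x : l2 x -> (forall z, nrm z < 1 -> ev x z = ev x (- z)) <->
  (forall k, x k.*2.+1 = 0).
Proof.
move=> lx; split => [h k|h z _].
  have E : x = (fun n => (-1) ^+ n * x n).
    apply: ev_inj => // [|z hz]; first exact: l2_alt.
    by rewrite -ev_opp; exact: h.
  have := congr1 (fun f => f k.*2.+1) E.
  rewrite /= -signr_odd /= odd_double /= expr1 mulN1r => /eqP.
  by rewrite -subr_eq0 opprK -mulr2n mulrn_eq0 /= => /eqP.
rewrite ev_opp; congr ev; apply/funext => n.
rewrite -signr_odd -(odd_double_half n); case: (odd n) => /=.
  by rewrite add1n h mulr0.
by rewrite add0n odd_double expr0 mul1r.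
Qed.

(** The quotient m (1 + mu^* z) / (z + mu) should be even. Multiplying it by the even mu^2 - z^2
    gives (1 + mu^* z)(mu - z) m without division; the recurrence says that its odd coefficients
    vanish. *)
Lemma rec_evP (a : vec) (mu : C) : l2 a ->
  (forall k, (1 - mu * mu^*) * a k.*2 = mu * a k.*2.+1 - mu^* * sh a k.*2) <->
  (forall z, nrm z < 1 -> ev a z * ((1 + mu^* * z) * (mu - z)) =
     ev a (- z) * ((1 - mu^* * z) * (mu + z))).
Proof.
move=> la; have ls := l2sh la; have lss := l2sh ls.
pose g := mu *: a - ((1 - mu * mu^*) *: sh a + mu^* *: sh (sh a)).
have lg : l2 g by apply: l2B; [exact: l2Z|apply: l2D; exact: l2Z].
have eg z : nrm z < 1 -> ev g z = ev a z * ((1 + mu^* * z) * (mu - z)).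
  move=> hz; rewrite evB//; [|exact: l2Z|by apply: l2D; exact: l2Z].
  rewrite evD//; [|exact: l2Z..].
  rewrite !evZ// !ev_sh//; ring.
have gE k : g k.*2.+1 = mu * a k.*2.+1 - ((1 - mu * mu^*) * a k.*2 + mu^* * sh a k.*2).
  by rewrite /g !fctE.
have nz z : nrm z < 1 -> nrm (- z) < 1 by rewrite nrmN.
split => h.
  have /(ev_evenP lg) H : forall k, g k.*2.+1 = 0 by move=> k; rewrite gE h; ring.
  move=> z hz; have := H z hz; rewrite (eg z hz) (eg (- z) (nz z hz)).
  by rewrite mulrN opprK.
have /(ev_evenP lg) H : forall z, nrm z < 1 -> ev g z = ev g (- z).
  move=> z hz; rewrite (eg z hz) (eg (- z) (nz z hz)).
  by rewrite h// mulrN opprK.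
move=> k; have := H k; rewrite gE => /eqP; rewrite subr_eq0 => /eqP ->; ring.
Qed.

End Characterisation.

(** * Complex differentiability as a first-order expansion *)

Section ComplexDerivative.
Variable R : realType.
Local Notation C := R[i].
Local Open Scope complex_scope.
Local Open Scope ring_scope.
Implicit Types (f g : C -> C) (z w : C).

Definition cder f z := derivable (f : Cx R -> Cx R) (z : Cx R) (1 : Cx R).

Lemma cderM f g z : cder f z -> cder g z -> cder (fun w => f w * g w) z.
Proof. exact: (@derivableM R[i] R[i]^o f g z 1). Qed.

Lemma cderV f z : f z != 0 -> cder f z -> cder (fun w => (f w)^-1) z.
Proof. exact: (@derivableV R[i] R[i]^o f z 1). Qed.

Lemma cderD f g z : cder f z -> cder g z -> cder (fun w => f w + g w) z.
Proof. exact: (@derivableD R[i] R[i]^o R[i]^o f g z 1). Qed.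

Lemma cderN f z : cder f z -> cder (fun w => - f w) z.
Proof. exact: (@derivableN R[i] R[i]^o R[i]^o f z 1). Qed.

Lemma cder_cst c z : cder (fun w => c) z.
Proof. exact: (@derivable_cst R[i] R[i]^o R[i]^o c z 1). Qed.

Lemma cder_id z : cder (fun w => w) z.
Proof. exact: (@derivable_id R[i] R[i]^o z 1). Qed.

Lemma cderX f n z : cder f z -> cder (fun w => f w ^+ n) z.
Proof.
move=> h; elim: n => [|n IH]; first exact: cder_cst.
rewrite (_ : (fun w => _) = (fun w => f w * f w ^+ n)); first exact: cderM.
by apply/funext => w; rewrite exprS.
Qed.

Lemma nbhsCxP (z : C) (P : set C) : nbhs (z : Cx R) (P : set (Cx R)) <->
  exists2 d : R, 0 < d & forall w, nrm (w - z) < d -> P w.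
Proof.
rewrite -nbhs_ballE; split => [[e /= e0 h]|[d d0 h]].
  have [er e0r] : (0 : R) < complex.Re e /\ e = (complex.Re e)%:C.
    by move: e0; rewrite ltcE; case: e {h} => a b /= /andP[/eqP -> ->].
  exists (complex.Re e) => // w hw; apply: h.
  by rewrite -ball_normE /= e0r distrC normE ltcR.
exists d%:C; first by rewrite /= ltcR.
move=> w; rewrite -ball_normE /= distrC normE ltcR; exact: h.
Qed.

Lemma cderP f z : cder f z <-> exists c : C, forall e, 0 < e -> exists2 d, 0 < d &
  forall w, nrm (w - z) < d -> nrm (f w - f z - c * (w - z)) <= e * nrm (w - z).
Proof.
split.
  move=> /cvg_ex[l]; rewrite /= => /cvgCxP h; exists l => e e0.
  have /nbhsCxP[d d0 hd] := h e e0; exists d => // w hw.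
  have [->|wz] := eqVneq w z; first by rewrite !subrr mulr0 subr0 nrm0 mulr0.
  have wz0 : w - z != 0 by rewrite subr_eq0.
  have := hd (w - z); rewrite subr0 => /(_ hw wz0) /ltW h1.
  have -> : f w - f z - l * (w - z) =
      - (w - z) * (l - (w - z)^-1 * (f w - f z)) by field.
  rewrite nrmM nrmN mulrC ler_pM2r ?nrm_gt0//.
  move: h1; rewrite /GRing.scale/= /GRing.scale/= mulr1 subrK.
  by [].
move=> [c h]; apply/cvg_ex; exists (c : Cx R) => /=; apply/cvgCxP => e e0.
have e2 : 0 < e / 2 by rewrite divr_gt0.
have [d d0 hd] := h _ e2; apply/nbhsCxP; exists d => // t; rewrite subr0 => td t0.
have := hd (t + z); rewrite addrK => /(_ td) h1.
rewrite /GRing.scale/= /GRing.scale/= mulr1.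
have tn : 0 < nrm t by rewrite nrm_gt0.
rewrite -(ltr_pM2l tn) -nrmM.
have -> : t * (c - t^-1 * (f (t + z) - f z)) = - (f (t + z) - f z - c * t).
  by field.
rewrite nrmN; apply: le_lt_trans h1 _; rewrite mulrC ltr_pM2l//; lra.
Qed.

Lemma cder_local f g z d : 0 < d -> (forall w, nrm (w - z) < d -> f w = g w) ->
  cder f z -> cder g z.
Proof.
move=> d0 h /cderP[c H]; apply/cderP; exists c => e e0.
have [d' d'0 h'] := H e e0; exists (Num.min d d'); first by rewrite lt_min d0.
move=> w; rewrite lt_min => /andP[w1 w2].
by rewrite -!h ?subrr ?nrm0//; exact: h'.
Qed.

Lemma cder_cont f z : cder f z -> forall e, 0 < e -> exists2 d, 0 < d &
  forall w, nrm (w - z) < d -> nrm (f w - f z) < e.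
Proof.
move=> /cderP[c H] e e0; have [d d0 h] := H 1 ltr01.
have B0 : 0 < nrm c + 1 by have := nrm_ge0 c; lra.
exists (Num.min d (e / (nrm c + 1))); first by rewrite lt_min d0 divr_gt0.
move=> w; rewrite lt_min ltr_pdivlMr// => /andP[w1 w2].
have -> : f w - f z = (f w - f z - c * (w - z)) + c * (w - z) by ring.
apply: le_lt_trans (nrmD _ _) _; apply: le_lt_trans w2.
have := h w w1; rewrite nrmM; have := nrm_ge0 (w - z); have := nrm_ge0 c; nra.
Qed.

Lemma cder_opp f z : cder f (- z) -> cder (fun w => f (- w)) z.
Proof.
move=> /cderP[c H]; apply/cderP; exists (- c) => e e0.
have [d d0 h] := H e e0; exists d => // w hw.
have E : - w - - z = - (w - z) by ring.
by have := h (- w); rewrite E nrmN => /(_ hw); rewrite mulrN mulNr.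
Qed.

End ComplexDerivative.

(** * The equivalence for a given coefficient sequence *)

Section Main.
Variable R : realType.
Local Notation C := R[i].
Local Notation vec := (nat -> C).
Local Notation sh := (@Defs.shift R).
Local Open Scope complex_scope.
Local Open Scope ring_scope.
Implicit Types (x y h : vec) (z : C).
Variables (a : vec) (m : Cx R -> Cx R).
Hypothesis ha : l2 a.
Hypothesis a_orth : forall k, ip (iter k sh a) a = (k == 0%N)%:R.
Hypothesis hm : forall z : C, nrm z < 1 -> m z = ev a z.
Hypothesis hdim : dim_ge2 (model m).
Hypothesis m_inf : is_Hinf m.

Lemma coefs_of_reducible : reducible (model m) (fun x => Tm m (Tm m x)) ->
  (forall k, a k.*2.+1 = 0) \/ exists2 mu : C, nrm mu < 1 &
  forall k, (1 - mu * mu^*) * a k.*2 = mu * a k.*2.+1 - mu^* * sh a k.*2.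
Proof.
rewrite /reducible (modelE ha a_orth hm).
move=> [M [[MK [M0 [Mlin Mcl]]] [Mn0 [MnK [MT Madj]]]]].
have Mbb x : M x -> M (bs (bs x)).
  move=> Mx; have Kx := MK _ Mx; have Kb := K_bs ha (K_bs ha Kx).
  apply: (Madj x) => // y Ky.
  have KT : Kset a (T a (T a y)) by apply: (K_T ha a_orth); exact: (K_T ha a_orth).
  rewrite (Tm_TT ha a_orth hm Ky) !ipH2E ?(ip_TT ha a_orth)//.
  - by case: Ky.
  - by case: Kb.
  - by case: KT.
  - by case: Kx.
have MTT x : M x -> M (T a (T a x)).
  by move=> Mx; rewrite -(Tm_TT ha a_orth hm (MK _ Mx)); exact: MT.
have Mne : exists2 x : vec, M x & x != 0.
  apply: contrapT => H; apply: Mn0; apply/seteqP; split => [x Mx|x ->]//.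
  by apply: contrapT => /eqP x0; apply: H; exists x.
have MneK : exists2 x : vec, Kset a x & ~ M x.
  apply: contrapT => H; apply: MnK; apply/seteqP; split => // x Kx.
  by apply: contrapT => nx; apply: H; exists x.
have Mcl' (u : nat -> vec) x : l2 x -> (forall k, M (u k)) ->
    (forall e, 0 < e -> exists N, forall k, (N <= k)%N -> rsq (u k - x) <= e) -> M x.
  move=> lx Mu h; apply: (Mcl u) => //; first exact/is_H2E.
  apply/cvgCxP => e e0; have e2 : 0 < e / 2 by rewrite divr_gt0.
  have [N hN] := h _ e2; exists N => // k /= Nk.
  have ld : l2 (u k - x) by apply: l2B => //; have [] := MK _ (Mu k).
  rewrite nsqH2E// sub0r nrmN nrm_real ger0_norm ?rsq_ge0//.
  by apply: le_lt_trans (hN k Nk) _; lra.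
have [al [be [u0 _ H]]] := M_pair_closed ha a_orth MK Mlin M0 Mcl' Mne MneK MTT Mbb.
have [n an] : exists n, a n != 0.
  apply: contrapT => H0; have := a_orth 0; rewrite /= (_ : a = 0) ?ip0l.
    by move/eqP; rewrite eq_sym oner_eq0.
  by apply/funext => n; apply: contrapT => /eqP an; apply: H0; exists n.
(* Half the order of vanishing of [m] at 0, rounded down. *)
have [j [aj0 aj]] : exists j, (forall i, (i < j.*2)%N -> a i = 0) /\
    ((a j.*2 != 0) || (a j.*2.+1 != 0)).
  have ex : exists n, a n != 0 by exists n.
  exists (ex_minn ex)./2; case: ex_minnP => k ak kmin; split.
    move=> i ik; apply/eqP; apply: contraT => /kmin.
    rewrite leqNgt => /negP[]; apply: leq_trans ik _.
    by rewrite -{2}(odd_double_half k) leq_addl.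
  move: ak; rewrite -{1}(odd_double_half k); case: (odd k) => ak.
    by rewrite add1n in ak; rewrite ak orbT.
  by rewrite add0n in ak; rewrite ak.
have [R1 R2] := H j aj0.
exact: (two_relations u0 aj R1 R2).
Qed.

(** The recurrence reads (1 - |mu|^2) m = (z + mu)(1 - mu^* z) b, where b is the odd part of m
    divided by z. As b is even, p is b times an even polynomial; the work lies in the
    differentiability and boundedness of b. *)
Lemma factor_of_rec (mu : C) : nrm mu < 1 ->
  (forall k, (1 - mu * mu^*) * a k.*2 = mu * a k.*2.+1 - mu^* * sh a k.*2) ->
  exists p : Cx R -> Cx R, is_Hinf p /\
    (forall z : Cx R, disc z -> p z = p (- z)) /\
    (forall z : Cx R, disc z -> m z = p z * ((z + mu) / (1 + mu^* * z))).
Proof.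
move=> mu1 rec.
have N0 : 1 - mu * mu^* != 0.
  rewrite mulconj -(rmorph1 (real_complex R)) -rmorphB (inj_eq (@complexI _)).
  by rewrite subr_eq0 eq_sym lt_eqF// expr_lt1// nrm_ge0.
have D0 (c z : C) : nrm c < 1 -> nrm z < 1 -> 1 + c * z != 0.
  move=> hc hz; rewrite addrC addr_eq0; apply/eqP => /(congr1 (@nrm R)).
  rewrite nrmM nrmN nrm1 => h; have := nrm_ge0 c; have := nrm_ge0 z; nra.
pose b : vec := fun n => if odd n then 0 else a n.+1.
have lb : l2 b.
  have /l2P h := l2bs ha; apply: (l2_le h) => n; rewrite /b; case: odd => //.
  by rewrite nrm0 expr0n sqr_ge0.
have lsb := l2sh lb; have lssb := l2sh lsb.
have beven : forall z, nrm z < 1 -> ev b z = ev b (- z).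
  by apply/(ev_evenP lb) => k; rewrite /b /= odd_double.
have bE k : b k.*2 = a k.*2.+1 by rewrite /b odd_double.
have bO k : b k.*2.+1 = 0 by rewrite /b /= odd_double.
have aE : (1 - mu * mu^*) *: a = mu *: b + ((1 - mu * mu^*) *: sh b - mu^* *: sh (sh b)).
  apply/funext => n; rewrite -(odd_double_half n) !fctE /GRing.scale/=.
  case: (odd n) => /=; rewrite ?add1n ?add0n.
    by rewrite bO bE; case: n./2 => [|k]; rewrite ?doubleS /= ?bO; ring.
  rewrite rec bE; case: n./2 => [|k]; rewrite ?doubleS /= ?bO ?bE; ring.
have evE z : nrm z < 1 -> (1 - mu * mu^*) * m z = (z + mu) * (1 - mu^* * z) * ev b z.
  move=> hz; rewrite hm// -evZ// aE.
  rewrite evD//; [|exact: l2Z|by apply: l2B; exact: l2Z].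
  rewrite evB//; [|exact: l2Z..].
  rewrite !evZ// !ev_sh//; ring.
have oddE z : nrm z < 1 -> z * ev b z = (m z - m (- z)) / 2.
  move=> hz; have hz' : nrm (- z) < 1 by rewrite nrmN.
  rewrite -ev_sh//.
  have -> : sh b = 2^-1 *: (a - (fun n => (-1) ^+ n * a n)).
    apply/funext => n; rewrite !fctE /GRing.scale/= -signr_odd.
    have := odd_double_half n; move: (odd n) (n./2) => o k <-.
    case: o; rewrite ?add1n ?add0n; first by rewrite /= bE expr1; field.
    by rewrite expr0; case: k => [|k]; rewrite ?doubleS /= ?bO; ring.
  have l' := l2_alt ha.
  rewrite evZ//; last exact: l2B.
  by rewrite evB// -ev_opp -!hm// mulrC.
have [holo [M0 bdd]] := m_inf.
pose c := (1 - mu * mu^*)^-1.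
pose p z : C := c * (1 - (mu^* * z) ^+ 2) * ev b z.
exists (p : Cx R -> Cx R); split; [split|split].
- move=> z /discE hz; change (cder p z).
  apply: cderM.
    apply: cderM; first exact: cder_cst.
    apply: cderD; first exact: cder_cst.
    apply: cderN; apply: cderX; apply: cderM; first exact: cder_cst.
    exact: cder_id.
  (* Away from 0, [b] evaluates to (m z - m (- z)) / (2 z), a quotient of differentiable functions.
     At 0 its linear coefficient vanishes, so the derivative is 0 with a quadratic remainder. *)
  have [z0|z0] := eqVneq z 0.
    apply/cderP; exists 0 => e e0.
    have lbb := l2bs (l2bs lb).
    set B := rsq (bs (bs b)) * 2 + 1.
    have B0 : 0 < B by have := rsq_ge0 lbb; rewrite /B; lra.
    exists (Num.min (e / B) 2^-1); first by rewrite lt_min divr_gt0//= invr_gt0.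
    move=> w; rewrite z0 subr0 mul0r subr0 lt_min => /andP[w1 w2].
    have w3 : nrm w < 1 by apply: lt_trans w2 _; rewrite invf_lt1// ltr1n.
    rewrite ev0// (ev_recl lb w3) (ev_recl (l2bs lb) w3).
    rewrite (_ : bs b 0%N = 0); last by [].
    rewrite add0r addrC addKr mulrA !nrmM.
    have h1 := ev_bound lbb (ltW w2).
    have h2 : nrm (ev (bs (bs b)) w) <= B.
      rewrite /B; move: h1; have := nrm_ge0 (ev (bs (bs b)) w).
      move: (nrm (ev _ w)) => t; nra.
    move: w1; rewrite ltr_pdivlMr// => w1.
    have := nrm_ge0 w; have := nrm_ge0 (ev (bs (bs b)) w); move: h2 w1.
    move: (nrm (ev _ w)) (nrm w) => t s h2 w1 t0 s0.
    rewrite -mulrA mulrC ler_wpM2r//; apply: le_trans (ltW w1).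
    by rewrite ler_wpM2l.
  have d0 : 0 < Num.min (nrm z) (1 - nrm z) by rewrite lt_min nrm_gt0 z0 subr_gt0.
  apply: (@cder_local _ (fun w => (m w - m (- w)) / 2 * w^-1) _ _ _ d0).
    move=> w; rewrite lt_min => /andP[w1 w2].
    have w0 : w != 0.
      by apply/eqP => w0; move: w1; rewrite w0 sub0r nrmN ltxx.
    have w3 : nrm w < 1.
      have -> : w = (w - z) + z by rewrite subrK.
      by apply: le_lt_trans (nrmD _ _) _; lra.
    by rewrite -oddE// mulrAC mulfV// mul1r.
  have hz' : disc (- z : Cx R) by apply/discE; rewrite nrmN.
  apply: cderM; last by apply: cderV => //; exact: cder_id.
  apply: cderM; last exact: cder_cst.
  apply: cderD; first by apply: holo; apply/discE.
  apply: cderN; apply: cder_opp; exact: holo.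
- exists (nrm c * 2 * (`|M0| * 2 + rsq b * 2 + 1)) => z /discE hz.
  rewrite normE lecR /p !nrmM.
  have h1 : nrm (1 - (mu^* * z) ^+ 2) <= 2.
    apply: le_trans (nrmD _ _) _; rewrite nrm1 nrmN nrmX nrmM nrm_conj.
    have : nrm mu * nrm z <= 1.
      have := nrm_ge0 mu; have := nrm_ge0 z; nra.
    have := mulr_ge0 (nrm_ge0 mu) (nrm_ge0 z).
    move: (nrm mu * nrm z) => t; nra.
  (* Within radius 1/2 this is Cauchy-Schwarz; outside, dividing by [z] costs at most a factor 2. *)
  have h2 : nrm (ev b z) <= `|M0| * 2 + rsq b * 2 + 1.
    have [hs|hl] := leP (nrm z) 2^-1.
      have := ev_bound lb hs; have := nrm_ge0 (ev b z); have := normr_ge0 M0.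
      move: (nrm (ev b z)) => t; nra.
    have hm1 (w : C) : nrm w < 1 -> nrm (m w) <= `|M0|.
      move=> hw; have := bdd w; rewrite normE lecR => h.
      by apply: le_trans (ler_norm _); apply: h; apply/discE.
    have := oddE z hz => /(congr1 (@nrm R)); rewrite !nrmM nrmV.
    have -> : nrm (2 : C) = 2.
      rewrite (_ : (2 : C) = (2 : R)%:C); last by rewrite rmorph_nat.
      by rewrite nrm_real ger0_norm.
    have h3 : nrm (m z - m (- z)) <= `|M0| + `|M0|.
      apply: le_trans (nrmD _ _) _; rewrite nrmN; apply: lerD; apply: hm1 => //.
      by rewrite nrmN.
    move: h3; move: (nrm (m z - m (- z))) => s h3 E.
    have t0 := nrm_ge0 (ev b z); have r0 := rsq_ge0 lb; have n0 := normr_ge0 M0.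
    move: (nrm (ev b z)) (nrm z) hl E t0 => t r hl E t0; nra.
  apply: ler_pM => //; rewrite ?mulr_ge0 ?nrm_ge0//.
  by apply: ler_pM => //; exact: nrm_ge0.
- move=> z /discE hz; rewrite /p -beven// mulrN.
  by rewrite sqrrN.
- move=> z /discE hz.
  have D1 : 1 + mu^* * z != 0 by apply: D0 => //; rewrite nrm_conj.
  change (m z = p z * ((z + mu) / (1 + mu^* * z)) :> C).
  apply: (mulfI N0); rewrite evE// /p /c; field.
  by rewrite D1 N0.
Qed.

Theorem reducible_iff : reducible (model m) (fun x => Tm m (Tm m x)) <->
  ((forall z : Cx R, disc z -> m z = m (- z)) \/
   (exists mu : Cx R, disc mu /\
      exists p : Cx R -> Cx R, is_Hinf p /\
        (forall z : Cx R, disc z -> p z = p (- z)) /\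
        (forall z : Cx R, disc z ->
           m z = p z * ((z + mu) / (1 + mu^* * z))))).
Proof.
split.
  move=> /coefs_of_reducible[odd0|[mu mu1 rec]]; [left|right].
    move=> z /discE hz; have hz' : nrm (- z : C) < 1 by rewrite nrmN.
    by rewrite (hm hz) (hm hz'); apply: ((ev_evenP ha).2 odd0).
  by exists mu; split; [exact/discE|exact: factor_of_rec].
move=> [ev|[mu [/discE mu1 [p [_ [pev pE]]]]]].
  apply: (reducible_of_even ha a_orth hm hdim).
  apply/(ev_evenP ha) => z hz; have hz' : nrm (- z : C) < 1 by rewrite nrmN.
  by rewrite -(hm hz) -(hm hz'); apply: ev; apply/discE.
apply: (reducible_of_rec ha a_orth hm hdim (mu := mu)).
apply/(rec_evP _ ha) => z hz; have hz' : nrm (- z : C) < 1 by rewrite nrmN.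
have D0 (w : C) : nrm w < 1 -> 1 + mu^* * w != 0.
  move=> hw; rewrite addrC addr_eq0; apply/eqP => /(congr1 (@nrm R)).
  rewrite nrmM nrmN nrm1 nrm_conj => h; have := nrm_ge0 (mu : C); have := nrm_ge0 w; nra.
have D1 := D0 z hz; have := D0 (- z) hz'; rewrite mulrN => D2.
rewrite -(hm hz) -(hm hz').
have E1 : (m z : C) = p z * ((z + mu) / (1 + mu^* * z)) by apply: pE; apply/discE.
have E2 : (m (- z) : C) = p z * ((- z + mu) / (1 - mu^* * z)).
  have -> : (p z : C) = p (- z) by apply: pev; apply/discE.
  by rewrite -mulrN; apply: pE; apply/discE.
rewrite E1 E2; move: (p z) => q; field.
by rewrite D1 D2.
Qed.

End Main.

(** * Real integrals over segments *)

Section RealIntegral.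
Variable R : realType.
Local Open Scope ring_scope.
Implicit Types (f g : R -> R) (a b c : R).

Definition RI a b f : R := \int[@lebesgue_measure R]_(x in `[a, b]) f x.

Definition intab a b f := (@lebesgue_measure R).-integrable `[a, b] (EFin \o f).

(** Continuity is asked only relative to the segment, because the integrands of Goursat's theorem
    are controlled only on a closed rectangle. *)
Lemma intab_eps a b f :
  (forall x, a <= x <= b -> forall e, 0 < e -> exists2 d, 0 < d &
     forall y, a <= y <= b -> `|y - x| < d -> `|f y - f x| < e) -> intab a b f.
Proof.
move=> h; apply: continuous_compact_integrable; first exact: segment_compact.
apply/subspace_continuousP => x; rewrite /= in_itv /= => abx.
apply/cvgrPdist_lt => e e0; have [d d0 hd] := h x abx e e0.
rewrite near_withinE; near=> y => aby.
rewrite distrC; apply: hd; first by move: aby; rewrite /= in_itv.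
rewrite distrC; near: y; apply: (nbhsx_ballx x d d0).
Unshelve. all: by end_near. Qed.

Lemma intab_cont a b f : continuous f -> intab a b f.
Proof.
move=> cf; apply: continuous_compact_integrable; first exact: segment_compact.
exact: continuous_subspaceT.
Qed.

Lemma intab_sub a b a' b' f : a <= a' -> b' <= b -> intab a b f -> intab a' b' f.
Proof.
move=> h1 h2; apply: integrableS => // x; rewrite /= !in_itv /=.
by move=> /andP[x1 x2]; rewrite (le_trans h1 x1) (le_trans x2 h2).
Qed.

Lemma intabB a b f g : intab a b f -> intab a b g -> intab a b (fun x => f x - g x).
Proof.
move=> cf cg.
have h : (@lebesgue_measure R).-integrable `[a, b] ((EFin \o f) \- (EFin \o g))%E.
  exact: integrableB.
by apply: eq_integrable h => //= x _; rewrite EFinB.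
Qed.

Lemma RI_B a b f g : intab a b f -> intab a b g ->
  RI a b (fun x => f x - g x) = RI a b f - RI a b g.
Proof. by move=> cf cg; apply: RintegralB => //. Qed.

Lemma RI_D a b f g : intab a b f -> intab a b g ->
  RI a b (fun x => f x + g x) = RI a b f + RI a b g.
Proof. by move=> cf cg; apply: RintegralD => //. Qed.

Lemma RI_Z a b k f : intab a b f -> RI a b (fun x => k * f x) = k * RI a b f.
Proof. by move=> cf; apply: RintegralZl => //. Qed.

Lemma RI_cst a b k : a <= b -> RI a b (fun=> k) = k * (b - a).
Proof.
move=> ab; rewrite /RI Rintegral_cst//= lebesgue_measure_itv /= lte_fin.
case: ltP => //= h; have -> : a = b by apply/eqP; rewrite eq_le ab h.
by rewrite subrr.
Qed.

Lemma intab_cst a b (k : R) : intab a b (fun=> k).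
Proof. by apply: intab_cont => x; exact: cvg_cst. Qed.

Lemma RI_near a b f k e : a <= b -> intab a b f ->
  (forall x, a <= x <= b -> `|f x - k| <= e) -> `|RI a b f - k * (b - a)| <= e * (b - a).
Proof.
move=> ab cf h; have ck k' := intab_cst a b k'.
rewrite ler_distl; apply/andP; split.
  have -> : k * (b - a) - e * (b - a) = RI a b (fun=> k - e) by rewrite RI_cst//; ring.
  apply: le_Rintegral => //; [exact: ck|].
  move=> x; rewrite /= in_itv /= => /h; rewrite ler_distl => /andP[h1 h2]; lra.
have -> : k * (b - a) + e * (b - a) = RI a b (fun=> k + e) by rewrite RI_cst//; ring.
apply: le_Rintegral => //; [exact: ck|].
move=> x; rewrite /= in_itv /= => /h; rewrite ler_distl => /andP[h1 h2]; lra.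
Qed.

Lemma RI_split a b c f : a <= c -> c <= b -> intab a b f ->
  RI a b f = RI a c f + RI c b f.
Proof.
move=> ac cb iab; have icb := intab_sub ac (lexx b) iab.
have := @Rintegral_itvB R f (BLeft a) (BRight b) c iab.
rewrite !bnd_simp => /(_ ac cb) h.
have iocb : (@lebesgue_measure R).-integrable `]c, b] (EFin \o f).
  by apply: integrableS icb => //; apply: subset_itvr; rewrite bnd_simp.
have e := @Rintegral_itv_obnd_cbnd R c (BRight b) f iocb.
have {}h : RI a b f - RI a c f = RI c b f := etrans h e.
by rewrite -h addrC subrK.
Qed.

Lemma eq_RI a b f g : (forall x, a <= x <= b -> f x = g x) -> RI a b f = RI a b g.
Proof.
by move=> h; apply: eq_Rintegral => x; rewrite inE /= in_itv /= => /h.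
Qed.

End RealIntegral.

Lemma itv_dist (R : realFieldType) (a b x y d : R) : a <= x -> x <= a + b ->
  a <= y -> y <= a + b -> b < d -> `|x - y| < d.
Proof. by move=> *; rewrite ltr_norml; apply/andP; split; lra. Qed.

(** * Goursat's theorem on a rectangle *)

Section Goursat.
Variable R : realType.
Local Open Scope ring_scope.
Variables (u v : R -> R -> R) (x0 x1 y0 y1 : R).
Hypotheses (x01 : x0 <= x1) (y01 : y0 <= y1).
Let D x y := (x0 <= x <= x1) && (y0 <= y <= y1).
(** Differentiability of u + i v with derivative p + i q, in real and imaginary parts. *)
Hypothesis CR : forall x y, D x y -> exists p q : R, forall e, 0 < e ->
  exists2 d, 0 < d & forall x' y', D x' y' -> `|x' - x| < d -> `|y' - y| < d ->
  `|u x' y' - u x y - (p * (x' - x) - q * (y' - y))| <= e * (`|x' - x| + `|y' - y|) /\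
  `|v x' y' - v x y - (q * (x' - x) + p * (y' - y))| <= e * (`|x' - x| + `|y' - y|).

(** The real part of the counterclockwise contour integral of u + i v; the other part is reached by
    multiplying the function by i. *)
Let J a b c d := RI a b (fun x => u x c - u x d) - RI c d (fun y => v b y - v a y).

Lemma CR_cont x y : D x y -> forall e, 0 < e -> exists2 d, 0 < d &
  forall x' y', D x' y' -> `|x' - x| < d -> `|y' - y| < d ->
  `|u x' y' - u x y| < e /\ `|v x' y' - v x y| < e.
Proof.
move=> Dxy e e0; have [p [q /(_ 1 ltr01)[d d0 h]]] := CR Dxy.
pose B : R := 2 * (`|p| + `|q| + 1).
have B0 : 0 < B by rewrite mulr_gt0// ltr_wpDl// addr_ge0.
exists (Num.min d (e / B)); first by rewrite lt_min d0 divr_gt0.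
move=> x' y' D'; rewrite !lt_min !ltr_pdivlMr// => /andP[hx1 hx2] /andP[hy1 hy2].
have [] := h x' y' D' hx1 hy1; rewrite mul1r.
set s := x' - x in hx2 *; set t := y' - y in hy2 *.
have bound (a b X : R) : `|a| + `|b| <= `|p| + `|q| ->
   `|a| <= `|p| + `|q| -> `|b| <= `|p| + `|q| ->
   `|X - (a * s + b * t)| <= `|s| + `|t| -> `|X| < e.
  move=> _ ha hb hX.
  have -> : X = (X - (a * s + b * t)) + (a * s + b * t) by ring.
  apply: le_lt_trans (ler_normD _ _) _.
  have := ler_normD (a * s) (b * t); rewrite !normrM => h3.
  have s0 := normr_ge0 s; have t0 := normr_ge0 t.
  have h4 := ler_wpM2r s0 ha; have h5 := ler_wpM2r t0 hb.
  rewrite /B in hx2 hy2; lra.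
have p0 := normr_ge0 p; have q0 := normr_ge0 q.
move=> h1 h2; split.
  apply: (bound p (- q)); rewrite ?normrN//; try lra.
  by move: h1; congr (`| _ | <= _); ring.
by apply: (bound q p) => //; lra.
Qed.

Lemma ucontx y a b : x0 <= a -> b <= x1 -> y0 <= y <= y1 -> intab a b (fun x => u x y).
Proof.
move=> ha hb hy; apply: intab_eps => x /andP[ax xb] e e0.
have Dx z : a <= z <= b -> D z y.
  by move=> /andP[az zb]; rewrite /D hy andbT (le_trans ha az) (le_trans zb hb).
have [|d d0 h] := @CR_cont x y _ e e0; first by apply: Dx; rewrite ax.
exists d => // z hz zx; have [] := h z y (Dx z hz) zx => //.
by rewrite subrr normr0.
Qed.

Lemma vconty x a b : y0 <= a -> b <= y1 -> x0 <= x <= x1 -> intab a b (fun y => v x y).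
Proof.
move=> ha hb hx; apply: intab_eps => y /andP[ay yb] e e0.
have Dy z : a <= z <= b -> D x z.
  by move=> /andP[az zb]; rewrite /D hx /= (le_trans ha az) (le_trans zb hb).
have [|d d0 h] := @CR_cont x y _ e e0; first by apply: Dy; rewrite ay.
exists d => // z hz zx; have [] := h x z (Dy z hz) => //.
by rewrite subrr normr0.
Qed.

(** Interior edges are traversed twice in opposite directions and cancel. *)
Lemma J_split a b c d s t : x0 <= a -> a <= s -> s <= b -> b <= x1 ->
  y0 <= c -> c <= t -> t <= d -> d <= y1 ->
  J a b c d = J a s c t + J s b c t + J a s t d + J s b t d.
Proof.
move=> xa as_ sb bx yc ct td dy; rewrite /J.
have xs : x0 <= s <= x1 by rewrite (le_trans xa as_) (le_trans sb bx).
have yt : y0 <= t <= y1 by rewrite (le_trans yc ct) (le_trans td dy).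
have xas : x0 <= a <= x1 by rewrite xa (le_trans as_ (le_trans sb bx)).
have xbs : x0 <= b <= x1 by rewrite bx (le_trans xa (le_trans as_ sb)).
have yct : y0 <= c <= y1 by rewrite yc (le_trans ct (le_trans td dy)).
have ydt : y0 <= d <= y1 by rewrite dy (le_trans yc (le_trans ct td)).
have [xs0 xs1] := andP xs; have [yt0 yt1] := andP yt.
have ux y (hy : y0 <= y <= y1) a' b' (h1 : x0 <= a') (h2 : b' <= x1) := ucontx h1 h2 hy.
have vy x (hx : x0 <= x <= x1) a' b' (h1 : y0 <= a') (h2 : b' <= y1) := vconty h1 h2 hx.
rewrite !RI_B; try (by apply: ux); try (by apply: vy).
rewrite (RI_split as_ sb (ux c yct _ _ xa bx)) (RI_split as_ sb (ux d ydt _ _ xa bx)).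
rewrite (RI_split ct td (vy b xbs _ _ yc dy)) (RI_split ct td (vy a xas _ _ yc dy)).
ring.
Qed.

(** The affine part contributes [q * (b - a) * (d - c)] to both integrals and cancels, so only the
    remainder counts. *)
Lemma J_small x y p q e a b c d : x0 <= a -> a <= x -> x <= b -> b <= x1 ->
  y0 <= c -> c <= y -> y <= d -> d <= y1 -> 0 <= e ->
  (forall x' y', a <= x' <= b -> c <= y' <= d ->
  `|u x' y' - u x y - (p * (x' - x) - q * (y' - y))| <= e * (`|x' - x| + `|y' - y|) /\
  `|v x' y' - v x y - (q * (x' - x) + p * (y' - y))| <= e * (`|x' - x| + `|y' - y|)) ->
  `|J a b c d| <= 2 * e * ((b - a) + (d - c)) ^+ 2.
Proof.
move=> xa ax xb bx yc cy yd dy e0 h.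
have ab := le_trans ax xb; have cd := le_trans cy yd.
have xas : x0 <= a <= x1 by rewrite xa (le_trans ab bx).
have xbs : x0 <= b <= x1 by rewrite bx (le_trans xa ab).
have ycs : y0 <= c <= y1 by rewrite yc (le_trans cd dy).
have yds : y0 <= d <= y1 by rewrite dy (le_trans yc cd).
have aab : a <= a <= b by rewrite lexx.
have bab : a <= b <= b by rewrite lexx ab.
have ccd : c <= c <= d by rewrite lexx.
have dcd : c <= d <= d by rewrite lexx cd.
pose S := (b - a) + (d - c).
have bd x' y' : a <= x' <= b -> c <= y' <= d -> `|x' - x| + `|y' - y| <= S.
  by move=> /andP[h1 h2] /andP[h3 h4]; rewrite /S; apply: lerD; rewrite ler_norml; apply/andP; split; lra.
have E1 : `|RI a b (fun x => u x c - u x d) - q * (d - c) * (b - a)| <= 2 * e * S * (b - a).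
  apply: RI_near => //; first by apply: intabB; apply: ucontx.
  move=> z hz; have [h1 _] := h z c hz ccd; have [h2 _] := h z d hz dcd.
  have h3 := ler_wpM2l e0 (bd z c hz ccd); have h4 := ler_wpM2l e0 (bd z d hz dcd).
  have -> : u z c - u z d - q * (d - c) = (u z c - u x y - (p * (z - x) - q * (c - y)))
     - (u z d - u x y - (p * (z - x) - q * (d - y))) by ring.
  apply: le_trans (ler_normB _ _) _; lra.
have E2 : `|RI c d (fun y => v b y - v a y) - q * (b - a) * (d - c)| <= 2 * e * S * (d - c).
  apply: RI_near => //; first by apply: intabB; apply: vconty.
  move=> z hz; have [_ h1] := h b z bab hz; have [_ h2] := h a z aab hz.
  have h3 := ler_wpM2l e0 (bd b z bab hz); have h4 := ler_wpM2l e0 (bd a z aab hz).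
  have -> : v b z - v a z - q * (b - a) = (v b z - v x y - (q * (b - x) + p * (z - y)))
     - (v a z - v x y - (q * (a - x) + p * (z - y))) by ring.
  apply: le_trans (ler_normB _ _) _; lra.
have -> : J a b c d = (RI a b (fun x => u x c - u x d) - q * (d - c) * (b - a))
   - (RI c d (fun y => v b y - v a y) - q * (b - a) * (d - c)) by rewrite /J; ring.
apply: le_trans (ler_normB _ _) _; apply: le_trans (lerD E1 E2) _.
by rewrite -mulrDr -/S expr2 mulrA.
Qed.

Let w := x1 - x0.
Let h := y1 - y0.
Let t (n : nat) : R := 2^-1 ^+ n.
Let c := `|J x0 x1 y0 y1|.

(** [s] is the lower left corner of a rectangle of the [n]-th bisection that carries at least its
    share 4^-n of |J|. *)
Let P n (s : R * R) := [/\ x0 <= s.1, s.1 + w * t n <= x1, y0 <= s.2, s.2 + h * t n <= y1 &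
  c * t n ^+ 2 <= `|J s.1 (s.1 + w * t n) s.2 (s.2 + h * t n)|].

Let w0 : 0 <= w. Proof. by rewrite subr_ge0. Qed.
Let h0 : 0 <= h. Proof. by rewrite subr_ge0. Qed.
Let t0 n : 0 < t n. Proof. by rewrite exprn_gt0 ?invr_gt0. Qed.
Let tS n : t n = 2 * t n.+1.
Proof. by rewrite /t exprS mulrA mulfV ?mul1r. Qed.

Lemma quarter n s : P n s -> exists s', P n.+1 s' /\
  [/\ s.1 <= s'.1, s'.1 + w * t n.+1 <= s.1 + w * t n,
      s.2 <= s'.2 & s'.2 + h * t n.+1 <= s.2 + h * t n].
Proof.
case: s => x y [/= hx0 hx1 hy0 hy1 hc].
have wt : 0 <= w * t n.+1 by rewrite mulr_ge0// ltW.
have ht : 0 <= h * t n.+1 by rewrite mulr_ge0// ltW.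
set W := w * t n.+1 in wt *; set H := h * t n.+1 in ht *.
have tw : x + w * t n = x + W + W by rewrite tS /W; ring.
have th : y + h * t n = y + H + H by rewrite tS /H; ring.
have tc : c * t n ^+ 2 = 4 * (c * t n.+1 ^+ 2) by rewrite tS; ring.
rewrite tw th tc in hx1 hy1 hc *.
have E : J x (x + W + W) y (y + H + H) = J x (x + W) y (y + H) +
    J (x + W) (x + W + W) y (y + H) + J x (x + W) (y + H) (y + H + H) +
    J (x + W) (x + W + W) (y + H) (y + H + H) by apply: J_split; lra.
rewrite E in hc.
set J1 := J x (x + W) y (y + H) in hc; set J2 := J (x + W) (x + W + W) y (y + H) in hc.
set J3 := J x (x + W) (y + H) (y + H + H) in hc.
set J4 := J (x + W) (x + W + W) (y + H) (y + H + H) in hc.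
have Hs : 4 * (c * t n.+1 ^+ 2) <= `|J1| + `|J2| + `|J3| + `|J4|.
  apply: le_trans hc _; apply: le_trans (ler_normD _ _) _; rewrite lerD2r.
  apply: le_trans (ler_normD _ _) _; rewrite lerD2r; exact: ler_normD.
have [g1|g1] := leP (c * t n.+1 ^+ 2) `|J1|.
  by exists (x, y); split; split; rewrite /= -/W -/H //; lra.
have [g2|g2] := leP (c * t n.+1 ^+ 2) `|J2|.
  by exists (x + W, y); split; split; rewrite /= -/W -/H //; lra.
have [g3|g3] := leP (c * t n.+1 ^+ 2) `|J3|.
  by exists (x, y + H); split; split; rewrite /= -/W -/H //; lra.
have [g4|g4] := leP (c * t n.+1 ^+ 2) `|J4|.
  by exists (x + W, y + H); split; split; rewrite /= -/W -/H //; lra.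
lra.
Qed.

Lemma goursat : J x0 x1 y0 y1 = 0.
Proof.
have P0 : P 0 (x0, y0).
  by split => //=; rewrite /t /w /h ?expr0 ?expr1n ?mulr1 ?subrKC ?addrC ?subrK.
pose nx n (s : {s | P n s}) := cid (quarter (svalP s)).
pose fix sq n : {s | P n s} := match n with
  | 0%N => exist _ (x0, y0) P0
  | n'.+1 => exist _ (sval (nx n' (sq n'))) (svalP (nx n' (sq n'))).1 end.
pose X n := (sval (sq n)).1; pose Y n := (sval (sq n)).2.
have step n : [/\ X n <= X n.+1, X n.+1 + w * t n.+1 <= X n + w * t n,
      Y n <= Y n.+1 & Y n.+1 + h * t n.+1 <= Y n + h * t n].
  exact: (svalP (nx n (sq n))).2.
have PX n : P n (X n, Y n) by have := svalP (sq n); rewrite /X /Y; case: (sval _).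
have lim (Z : nat -> R) (k : R) : 0 <= k -> (forall n, Z n <= Z n.+1) ->
   (forall n, Z n.+1 + k * t n.+1 <= Z n + k * t n) ->
   exists l, forall n, Z n <= l <= Z n + k * t n.
  move=> k0 inc dec.
  have incm n j : (n <= j)%N -> Z n <= Z j.
    by move=> /subnK <-; elim: (j - n)%N => // i IH; apply: le_trans IH (inc _).
  have decm n j : (n <= j)%N -> Z j + k * t j <= Z n + k * t n.
    by move=> /subnK <-; elim: (j - n)%N => // i IH; apply: le_trans (dec _) IH.
  have zk i : Z i <= Z i + k * t i by rewrite lerDl mulr_ge0// ltW.
  have all i n : Z i <= Z n + k * t n.
    have [ni|/ltnW ni] := leqP n i; first exact: le_trans (zk i) (decm _ _ ni).
    exact: le_trans (incm _ _ ni) (zk n).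
  have hs : has_sup (range Z).
    split; first by exists (Z 0%N), 0%N.
    by exists (Z 0%N + k * t 0) => _ [i _ <-].
  exists (sup (range Z)) => n; apply/andP; split.
    by apply: sup_upper_bound => //; exists n.
  by apply: sup_le_ub; [exists (Z 0%N), 0%N|move=> _ [i _ <-]].
have [X' hX] := lim X w w0 (fun n => let: And4 h1 _ _ _ := step n in h1)
   (fun n => let: And4 _ h1 _ _ := step n in h1).
have [Y' hY] := lim Y h h0 (fun n => let: And4 _ _ h1 _ := step n in h1)
   (fun n => let: And4 _ _ _ h1 := step n in h1).
have DX : D X' Y'.
  have [/= g1 g2 g3 g4 _] := PX 0%N; have /andP[g5 g6] := hX 0%N; have /andP[g7 g8] := hY 0%N.
  by rewrite /D (le_trans g1 g5) (le_trans g6 g2) (le_trans g3 g7) (le_trans g8 g4).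
have [p [q CRX]] := CR DX.
suff : c <= 0 by rewrite /c normr_le0 => /eqP.
apply/ler_addgt0Pl => e e0; rewrite addr0.
pose B := 2 * (w + h) ^+ 2 + 1.
have B0 : 0 < B by have := sqr_ge0 (w + h); rewrite /B; lra.
have eB : 0 < e / B by rewrite divr_gt0.
have [d d0 hd] := CRX _ eB.
(* Such an [n] puts the whole [n]-th rectangle within [d] of the common point. *)
have [n hn] : exists n, (w + h + 1) * t n < d.
  have := @cvg_geometric R (w + h + 1) 2^-1.
  rewrite ger0_norm ?invr_ge0// invf_lt1 ?ltr1n// => /(_ isT).
  move=> /cvgrPdist_lt/(_ d d0)[N _ /(_ N (leqnn N))] /=.
  rewrite sub0r normrN /geometric /= ger0_norm; first by exists N.
  by apply: mulr_ge0; [have := w0; have := h0; lra|exact: exprn_ge0].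
have [/= g1 g2 g3 g4 g] := PX n; have /andP[g5 g6] := hX n; have /andP[g7 g8] := hY n.
have tn := t0 n.
have wt : 0 <= w * t n by rewrite mulr_ge0// ltW.
have ht : 0 <= h * t n by rewrite mulr_ge0// ltW.
have hn' : w * t n + h * t n + t n < d by move: hn; rewrite !mulrDl mul1r.
have JS : `|J (X n) (X n + w * t n) (Y n) (Y n + h * t n)| <=
    2 * (e / B) * (X n + w * t n - X n + (Y n + h * t n - Y n)) ^+ 2.
  apply: (@J_small X' Y' p q) => //; first exact: ltW.
  move=> x' y' /andP[a1 a2] /andP[a3 a4]; apply: hd.
  - by rewrite /D (le_trans g1 a1) (le_trans a2 g2) (le_trans g3 a3) (le_trans a4 g4).
  - apply: itv_dist a1 a2 g5 g6 _; apply: le_lt_trans hn'.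
    by rewrite -addrA lerDl addr_ge0// ltW.
  - apply: itv_dist a3 a4 g7 g8 _; apply: le_lt_trans hn'.
    by rewrite addrC addrA lerDr addr_ge0// ltW.
have := le_trans g JS.
have -> : X n + w * t n - X n + (Y n + h * t n - Y n) = (w + h) * t n by ring.
(* Upper and lower bound both scale like 4^-n, so [t n ^+ 2] cancels. *)
have -> : 2 * (e / B) * ((w + h) * t n) ^+ 2 = e * (2 * (w + h) ^+ 2) / B * t n ^+ 2.
  by field; rewrite gt_eqF.
rewrite (ler_pM2r (exprn_gt0 2 tn)) => g9; apply: le_trans g9 _.
by rewrite ler_pdivrMr// ler_pM2l// lerDl.
Qed.

End Goursat.

(** * Logarithmic polar coordinates and circle integrals *)

Section Polar.
Variable R : realType.
Local Notation C := R[i].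
Local Open Scope complex_scope.
Local Open Scope ring_scope.
Implicit Types (f : C -> C) (z : C) (s t r : R).

Definition cis t : C := cos t +i* sin t.

Lemma nrm_cis t : nrm (cis t) = 1.
Proof. by rewrite /nrm /= cos2Dsin2 sqrtr1. Qed.

Lemma cisD s t : cis (s + t) = cis s * cis t.
Proof. by rewrite /cis cosD sinD; simpc; congr (_ +i* _); rewrite addrC. Qed.

Lemma cis0 : cis 0 = 1.
Proof. by rewrite /cis cos0 sin0. Qed.

Lemma cis_2pi : cis (2 * pi) = 1.
Proof. by rewrite mulr_natl mulr2n cisD /cis cospi sinpi; simpc. Qed.

Lemma cis_neq0 t : cis t != 0.
Proof. by rewrite -nrm_gt0 nrm_cis. Qed.

Lemma cis_conj t : (cis t)^* = (cis t)^-1.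
Proof.
apply: (mulfI (cis_neq0 t)); rewrite mulconj nrm_cis expr1n mulfV//.
exact: cis_neq0.
Qed.

Lemma nrm_polar r t : 0 <= r -> nrm (r%:C * cis t) = r.
Proof. by move=> r0; rewrite nrmM nrm_cis mulr1 nrm_real ger0_norm. Qed.

Lemma is_derive_eps (f : R -> R) (x l : R) : is_derive x 1 f l ->
  forall e, 0 < e -> exists2 d, 0 < d &
  forall h, `|h| < d -> `|f (x + h) - f x - l * h| <= e * `|h|.
Proof.
move=> [df dl] e e0.
have : h^-1 *: (f (h *: 1 + x) - f x) @[h --> 0^'] --> l.
  by rewrite -dl; exact: df.
move=> /cvgrPdist_lt/(_ e e0); rewrite near_withinE => /nbhs_ballP[d /= d0 hd].
exists d => // h hh; have [->|h0] := eqVneq h 0.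
  by rewrite addr0 subrr mulr0 subrr normr0 mulr0.
have := hd h; rewrite /ball /= sub0r normrN => /(_ hh h0) /ltW.
rewrite /GRing.scale/= mulr1 [h + x]addrC => h1.
have -> : f (x + h) - f x - l * h = - h * (l - h^-1 * (f (x + h) - f x)) by field.
by rewrite normrM normrN mulrC ler_wpM2r.
Qed.

(** The exponential of s + i t: being multiplicative, it can be expanded at any point from its
    expansion at 0. *)
Definition polar s t : C := (expR s)%:C * cis t.

Lemma polarD s t s' t' : polar (s + s') (t + t') = polar s t * polar s' t'.
Proof. by rewrite /polar expRD cisD rmorphM/=; ring. Qed.

Lemma polar_small e : 0 < e -> exists2 d, 0 < d & forall x y : R, `|x| < d -> `|y| < d ->
  nrm (polar x y - 1 - (x +i* y)) <= e * (`|x| + `|y|).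
Proof.
(* The errors add up to at most [e1 * |x| + 5 * e1 * |y|], well below the 8 allowed; the cap at 1
   keeps [expR x] below 2. *)
move=> e0; pose e1 := Num.min (e / 8) 1.
have e10 : 0 < e1 by rewrite lt_min divr_gt0// ltr01.
have e18 : e1 <= e / 8 by rewrite ge_min lexx.
have e11 : e1 <= 1 by rewrite ge_min lexx orbT.
have [d1 d10 h1] := is_derive_eps (is_derive_expR 0) e10.
have [d2 d20 h2] := is_derive_eps (is_derive_cos 0) e10.
have [d3 d30 h3] := is_derive_eps (is_derive_sin 0) e10.
exists (Num.min (Num.min d1 d2) (Num.min d3 (e1 / 2))).
  by rewrite !lt_min d10 d20 d30 divr_gt0.
move=> x y; rewrite !lt_min => /andP[/andP[x1 x2] /andP[x3 x4]] /andP[/andP[y1 y2] /andP[y3 y4]].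
have := h1 x x1; have := h2 y y2; have := h3 y y3.
rewrite !add0r sin0 cos0 expR0 !subr0 oppr0 mul0r !mul1r subr0 => g3 g2 g1.
apply: le_trans (nrm_le_ReIm _) _.
have -> : Re (polar x y - 1 - (x +i* y)) = expR x * cos y - 1 - x.
  by rewrite /polar /cis /=; ring.
have -> : Im (polar x y - 1 - (x +i* y)) = expR x * sin y - y.
  by rewrite /polar /cis /=; ring.
set X := `|x| in x1 x2 x3 x4 g1 *; set Y := `|y| in y1 y2 y3 y4 g2 g3 *.
have X0 : 0 <= X by exact: normr_ge0.
have Y0 : 0 <= Y by exact: normr_ge0.
have gx : `|expR x - 1| <= 2 * X.
  have -> : expR x - 1 = (expR x - 1 - x) + x by ring.
  apply: le_trans (ler_normD _ _) _; rewrite -/X; nra.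
have ex2 : expR x <= 2.
  move: gx; rewrite ler_distl => /andP[_ ?]; lra.
have ex0 := expR_ge0 x.
have A1 : `|expR x * cos y - 1 - x| <= e1 * X + 2 * (e1 * Y).
  have -> : expR x * cos y - 1 - x = (expR x - 1 - x) + expR x * (cos y - 1) by ring.
  apply: le_trans (ler_normD _ _) _; apply: lerD => //.
  by rewrite normrM (ger0_norm ex0); apply: ler_pM.
have A2 : `|expR x * sin y - y| <= 2 * (e1 * Y) + e1 * Y.
  have -> : expR x * sin y - y = expR x * (sin y - y) + (expR x - 1) * y by ring.
  apply: le_trans (ler_normD _ _) _; apply: lerD.
    by rewrite normrM (ger0_norm ex0); apply: ler_pM.
  rewrite normrM -/Y ler_wpM2r//; apply: le_trans gx _; lra.
apply: le_trans (lerD A1 A2) _.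
have := ler_wpM2r X0 e18; have := ler_wpM2r Y0 e18; nra.
Qed.

Lemma polar_CR f s0 t0 : cder f (polar s0 t0) -> exists c : C, forall e, 0 < e ->
  exists2 d, 0 < d & forall s t, `|s - s0| < d -> `|t - t0| < d ->
  nrm (f (polar s t) - f (polar s0 t0) - c * ((s - s0) +i* (t - t0)))
    <= e * (`|s - s0| + `|t - t0|).
Proof.
move=> /cderP[c hc]; set z0 := polar s0 t0 in hc *.
exists (c * z0) => e e0.
have Z0 := nrm_ge0 z0; have C0 := nrm_ge0 c.
(* [Z] is a Lipschitz constant of [polar] at the base point and [W] bounds the factor [c * z0] of
   its remainder; each error receives half of [e]. *)
pose Z := nrm z0 * 2 + 1; have Zp : 0 < Z by rewrite /Z; lra.
pose W := nrm c * nrm z0 + 1; have Wp : 0 < W by have := mulr_ge0 C0 Z0; rewrite /W; lra.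
have eZ : 0 < e / 2 / Z by rewrite !divr_gt0.
have [d1 d10 h1] := hc _ eZ.
have eW : 0 < Num.min 1 (e / 2 / W) by rewrite lt_min ltr01 !divr_gt0.
have [d2 d20 h2] := polar_small eW.
exists (Num.min d2 (d1 / 2 / Z)); first by rewrite lt_min d20 !divr_gt0.
move=> s t; rewrite !lt_min => /andP[s1 s2] /andP[t1 t2].
have := h2 _ _ s1 t1.
set x := s - s0 in s1 s2 *; set y := t - t0 in t1 t2 *.
set N := `|x| + `|y|.
have N0 : 0 <= N by rewrite addr_ge0.
have Nd : N * Z < d1 by move: s2 t2; rewrite !ltr_pdivlMr// /N; lra.
have xy : nrm (x +i* y : C) <= N.
  by have := nrm_le_ReIm (x +i* y : C).
move=> g.
have g1 : nrm (polar x y - 1 - (x +i* y)) <= N.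
  apply: le_trans g _; rewrite -[leRHS]mul1r ler_wpM2r//.
  by rewrite ge_min lexx.
have g2 : nrm (polar x y - 1 - (x +i* y)) <= e / 2 / W * N.
  apply: le_trans g _; rewrite ler_wpM2r//.
  by rewrite ge_min lexx orbT.
have E : polar s t = z0 * polar x y.
  by rewrite -polarD /x /y !subrKC.
have hz : nrm (polar s t - z0) <= Z * N.
  have -> : polar s t - z0 = z0 * ((polar x y - 1 - (x +i* y)) + (x +i* y)).
    by rewrite E; ring.
  rewrite nrmM; apply: (@le_trans _ _ (nrm z0 * (N + N))).
    rewrite ler_wpM2l//; apply: le_trans (nrmD _ _) _; exact: lerD.
  rewrite /Z; lra.
have {}h1 : nrm (f (polar s t) - f z0 - c * (polar s t - z0)) <= e / 2 / Z * (Z * N).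
  apply: le_trans (h1 _ _) _; first by apply: le_lt_trans hz _; rewrite mulrC.
  by rewrite ler_wpM2l// ltW.
have -> : f (polar s t) - f z0 - c * z0 * (x +i* y) =
  (f (polar s t) - f z0 - c * (polar s t - z0)) + c * z0 * (polar x y - 1 - (x +i* y)).
  by rewrite E; ring.
apply: le_trans (nrmD _ _) _.
have -> : e * N = e / 2 / Z * (Z * N) + W * (e / 2 / W * N).
  by field; rewrite !gt_eqF.
have cz : nrm (c * z0) <= W by rewrite nrmM /W lerDl.
by apply: lerD => //; rewrite (nrmM (c * z0)); apply: ler_pM => //; exact: nrm_ge0.
Qed.

Definition ci (g : R -> C) : C :=
  RI 0 (2 * pi) (fun t => Re (g t)) +i* RI 0 (2 * pi) (fun t => Im (g t)).

Lemma two_pi_ge0 : 0 <= 2 * pi :> R.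
Proof. by rewrite mulr_ge0// pi_ge0. Qed.

(** Goursat for [f] composed with [polar] on [ln r1, ln r2] x [0, 2 pi]: the edges t = 0 and t = 2
    pi cancel by periodicity, the other two are the circle integrals. *)
Lemma circle_Im_const f r1 r2 : 0 < r1 -> r1 <= r2 ->
  (forall z, r1 <= nrm z <= r2 -> cder f z) ->
  RI 0 (2 * pi) (fun t => Im (f (r1%:C * cis t))) =
  RI 0 (2 * pi) (fun t => Im (f (r2%:C * cis t))).
Proof.
move=> r10 r12 hf; have r20 : 0 < r2 by exact: lt_le_trans r12.
pose u s t := Re (f (polar s t)); pose v s t := Im (f (polar s t)).
have l12 : ln r1 <= ln r2 by rewrite ler_ln.
have CRuv : forall x y, (ln r1 <= x <= ln r2) && (0 <= y <= 2 * pi) ->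
  exists p q : R, forall e, 0 < e -> exists2 d, 0 < d & forall x' y',
  (ln r1 <= x' <= ln r2) && (0 <= y' <= 2 * pi) -> `|x' - x| < d -> `|y' - y| < d ->
  `|u x' y' - u x y - (p * (x' - x) - q * (y' - y))| <= e * (`|x' - x| + `|y' - y|) /\
  `|v x' y' - v x y - (q * (x' - x) + p * (y' - y))| <= e * (`|x' - x| + `|y' - y|).
  move=> x y /andP[/andP[x1 x2] _].
  have hp : cder f (polar x y).
    apply: hf; rewrite nrm_polar ?expR_ge0//.
    by rewrite -(@lnK _ r1)// -(@lnK _ r2)// !ler_expR x1.
  have [c hc] := polar_CR hp; exists (Re c), (Im c) => e e0.
  have [d d0 hd] := hc e e0; exists d => // x' y' _ hx hy.
  have := hd x' y' hx hy; set w := (_ - _ - _) => hw; split.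
    by apply: le_trans hw; have := Re_le_nrm w; rewrite /w !ReD !ReN ReM.
  apply: le_trans hw; have := Im_le_nrm w; rewrite /w !ImD !ImN ImM.
  by rewrite [Im c * _ + _]addrC.
have := goursat l12 two_pi_ge0 CRuv.
have -> : RI (ln r1) (ln r2) (fun x => u x 0 - u x (2 * pi)) = 0.
  transitivity (RI (ln r1) (ln r2) (fun=> (0 : R))).
    by apply: eq_RI => x _; rewrite /u /polar cis0 cis_2pi subrr.
  by rewrite RI_cst// mul0r.
have vI r : r1 <= r <= r2 -> intab 0 (2 * pi) (fun y => v (ln r) y).
  move=> /andP[ra rb]; have r0 : 0 < r by exact: lt_le_trans ra.
  by apply: (vconty CRuv) => //; rewrite !ler_ln// ra.
rewrite sub0r RI_B; [|by apply: vI; rewrite r12 lexx..].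
move=> /eqP; rewrite oppr_eq0 subr_eq0 => /eqP.
by rewrite /v /polar !lnK.
Qed.

Lemma circle_const f r1 r2 : 0 < r1 -> r1 <= r2 ->
  (forall z, r1 <= nrm z <= r2 -> cder f z) ->
  ci (fun t => f (r1%:C * cis t)) = ci (fun t => f (r2%:C * cis t)).
Proof.
move=> r10 r12 hf; apply: complex_ext => /=; last exact: circle_Im_const.
(* Multiplication by i turns the real part into the imaginary part already treated. *)
have hif z : r1 <= nrm z <= r2 -> cder (fun w => (0 +i* 1) * f w) z.
  by move=> hz; apply: cderM; [exact: cder_cst|exact: hf].
have := circle_Im_const r10 r12 hif.
have E z : Im ((0 +i* 1) * z) = Re z by case: z => a b; rewrite /= mul0r mul1r add0r.
by under eq_RI do rewrite E; under [in RHS]eq_RI do rewrite E.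
Qed.

End Polar.

(** * Averages over the circle and dominated convergence *)

Section CircleAverage.
Variable R : realType.
Local Notation C := R[i].
Local Open Scope complex_scope.
Local Open Scope ring_scope.
Implicit Types (f g : R -> C) (c z : C) (t r : R).

Definition ccont g := continuous (fun t => Re (g t)) /\ continuous (fun t => Im (g t)).

Lemma ccont_eps g : (forall t e, 0 < e -> exists2 d, 0 < d & forall s, `|s - t| < d ->
  nrm (g s - g t) < e) -> ccont g.
Proof.
move=> h; split => t; apply/cvgrPdist_lt => e e0; have [d d0 hd] := h t e e0.
  near=> s; rewrite distrC; apply: le_lt_trans (hd s _); last first.
    by rewrite distrC; near: s; exact: (nbhsx_ballx t d d0).
  by have := Re_le_nrm (g s - g t); rewrite ReD ReN.
near=> s; rewrite distrC; apply: le_lt_trans (hd s _); last first.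
  by rewrite distrC; near: s; exact: (nbhsx_ballx t d d0).
by have := Im_le_nrm (g s - g t); rewrite ImD ImN.
Unshelve. all: by end_near. Qed.

Lemma ccont_epsP g : ccont g -> forall t e, 0 < e -> exists2 d, 0 < d &
  forall s, `|s - t| < d -> nrm (g s - g t) < e.
Proof.
move=> [hr hi] t e e0; have e2 : 0 < e / 2 by rewrite divr_gt0.
have /cvgrPdist_lt/(_ _ e2)/nbhs_ballP[d1 /= d10 h1] := hr t.
have /cvgrPdist_lt/(_ _ e2)/nbhs_ballP[d2 /= d20 h2] := hi t.
exists (Num.min d1 d2); first by rewrite lt_min d10.
move=> s; rewrite lt_min => /andP[s1 s2]; apply: le_lt_trans (nrm_le_ReIm _) _.
rewrite ReD ReN ImD ImN [ltRHS](splitr e); apply: ltrD; rewrite distrC.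
  by apply: h1; rewrite /ball /= distrC.
by apply: h2; rewrite /ball /= distrC.
Qed.

Lemma ccontD f g : ccont f -> ccont g -> ccont (fun t => f t + g t).
Proof.
move=> [f1 f2] [g1 g2]; split => t.
  by under eq_fun do rewrite ReD; apply: cvgD; [exact: f1|exact: g1].
by under eq_fun do rewrite ImD; apply: cvgD; [exact: f2|exact: g2].
Qed.

Lemma ccontM f g : ccont f -> ccont g -> ccont (fun t => f t * g t).
Proof.
move=> [f1 f2] [g1 g2]; split => t.
  under eq_fun do rewrite ReM.
  by apply: cvgB; apply: cvgM; [exact: f1|exact: g1|exact: f2|exact: g2].
under eq_fun do rewrite ImM.
by apply: cvgD; apply: cvgM; [exact: f1|exact: g2|exact: f2|exact: g1].
Qed.

Lemma ccont_cst c : ccont (fun=> c).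
Proof. by split => t; exact: cvg_cst. Qed.

Lemma ccont_conj f : ccont f -> ccont (fun t => (f t)^*).
Proof.
move=> [f1 f2]; split.
  rewrite (_ : (fun t => _) = (fun t => Re (f t)))//.
  by apply/funext => t; rewrite conjcE; case: (f t).
rewrite (_ : (fun t => _) = (fun t => - Im (f t))); last first.
  by apply/funext => t; rewrite conjcE; case: (f t).
by move=> t; apply: cvgN; exact: f2.
Qed.

Lemma ccontX f n : ccont f -> ccont (fun t => f t ^+ n).
Proof.
move=> h; elim: n => [|n IH]; first exact: ccont_cst.
by under eq_fun do rewrite exprS; exact: ccontM.
Qed.

Lemma ccont_sum (N : nat) (F : nat -> R -> C) : (forall n, ccont (F n)) ->
  ccont (fun t => \sum_(n < N) F n t).
Proof.
move=> h; elim: N => [|N IH].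
  by under eq_fun do rewrite big_ord0; exact: ccont_cst.
by under eq_fun do rewrite big_ord_recr/=; exact: ccontD.
Qed.

Lemma ccont_cis : ccont (@cis R).
Proof. by split => t; [exact: continuous_cos|exact: continuous_sin]. Qed.

Lemma ccont_comp (f : C -> C) g : ccont g ->
  (forall t e, 0 < e -> exists2 d, 0 < d & forall w, nrm (w - g t) < d ->
     nrm (f w - f (g t)) < e) -> ccont (fun t => f (g t)).
Proof.
move=> hg hf; apply: ccont_eps => t e e0; have [d d0 h] := hf t e e0.
have [d' d'0 h'] := ccont_epsP hg t d0; exists d' => // s hs.
by apply: h; exact: h'.
Qed.

Lemma ccont_circle (f : C -> C) r : (forall t, cder f (r%:C * cis t)) ->
  ccont (fun t => f (r%:C * cis t)).
Proof.
move=> h; apply: (@ccont_comp f (fun t => r%:C * cis t)).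
  by apply: ccontM; [exact: ccont_cst|exact: ccont_cis].
by move=> t; exact: cder_cont (h t).
Qed.

Definition av g : C := ((2 * pi)^-1)%:C * ci g.

Let pi2 : 0 < 2 * pi :> R. Proof. by rewrite mulr_gt0// pi_gt0. Qed.

Lemma ciD f g : ccont f -> ccont g -> ci (fun t => f t + g t) = ci f + ci g.
Proof.
move=> [f1 f2] [g1 g2]; rewrite /ci; simpc; congr (_ +i* _).
  under eq_RI do rewrite ReD.
  by apply: RI_D; apply: intab_cont.
under eq_RI do rewrite ImD.
by apply: RI_D; apply: intab_cont.
Qed.

Lemma ciZ c f : ccont f -> ci (fun t => c * f t) = c * ci f.
Proof.
move=> [f1 f2]; have i1 := intab_cont 0 (2 * pi) f1.
have i2 := intab_cont 0 (2 * pi) f2.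
have z k (h : R -> R) : continuous h -> intab 0 (2 * pi) (fun t => k * h t).
  by move=> ch; apply: intab_cont => t; apply: cvgM; [exact: cvg_cst|exact: ch].
apply: complex_ext; rewrite ?ReM ?ImM /=.
  under eq_RI do rewrite ReM.
  by rewrite RI_B; [rewrite !RI_Z|exact: z..].
under eq_RI do rewrite ImM.
by rewrite RI_D; [rewrite !RI_Z|exact: z..].
Qed.

Lemma avD f g : ccont f -> ccont g -> av (fun t => f t + g t) = av f + av g.
Proof. by move=> hf hg; rewrite /av ciD// mulrDr. Qed.

Lemma avZ c f : ccont f -> av (fun t => c * f t) = c * av f.
Proof. by move=> hf; rewrite /av ciZ// mulrCA. Qed.

Lemma av_cst c : av (fun=> c) = c.
Proof.
rewrite /av /ci !RI_cst ?ltW// subr0.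
have -> : (Re c * (2 * pi)) +i* (Im c * (2 * pi)) = (2 * pi)%:C * c.
  by case: c => a b; simpc; rewrite [a * _]mulrC [b * _]mulrC.
by rewrite mulrA -rmorphM mulVf ?gt_eqF// rmorph1 mul1r.
Qed.

Lemma avB f g : ccont f -> ccont g -> av (fun t => f t - g t) = av f - av g.
Proof.
move=> hf hg; have -> : (fun t => f t - g t) = (fun t => f t + (-1) * g t).
  by apply/funext => t; rewrite mulN1r.
rewrite avD//; last by apply: ccontM => //; exact: ccont_cst.
by rewrite avZ// mulN1r.
Qed.

Lemma av_sum (N : nat) (F : nat -> R -> C) : (forall n, ccont (F n)) ->
  av (fun t => \sum_(n < N) F n t) = \sum_(n < N) av (F n).
Proof.
move=> h; elim: N => [|N IH].
  rewrite big_ord0 -[RHS](av_cst 0); congr av; apply/funext => t.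
  by rewrite big_ord0.
rewrite big_ord_recr/= -IH -avD//; last exact: ccont_sum.
by congr av; apply/funext => t; rewrite big_ord_recr.
Qed.

(** The factor 2 comes from bounding the real and imaginary integrals separately. *)
Lemma av_bound g B : ccont g -> (forall t, nrm (g t) <= B) -> nrm (av g) <= 2 * B.
Proof.
move=> [g1 g2] h.
have b (k : R -> R) : continuous k -> (forall t, `|k t| <= B) ->
    `|RI 0 (2 * pi) k| <= B * (2 * pi).
  move=> ck hk; have := @RI_near R 0 (2 * pi) k 0 B (ltW pi2) (intab_cont _ _ ck).
  by rewrite mul0r !subr0; apply => x _; rewrite subr0.
have ip : `|(2 * pi)^-1| = (2 * pi)^-1 :> R by rewrite ger0_norm// invr_ge0 ltW.
rewrite /av nrmM nrm_real ip ler_pdivrMl//.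
apply: le_trans (nrm_le_ReIm _) _ => /=.
have -> : 2 * pi * (2 * B) = B * (2 * pi) + B * (2 * pi) by ring.
apply: lerD; apply: b => // t; apply: le_trans (h t).
  exact: Re_le_nrm.
exact: Im_le_nrm.
Qed.

Lemma aeS (P Q : R -> Prop) : (forall t, P t -> Q t) ->
  {ae (@lebesgue_measure R), forall t, P t} -> {ae (@lebesgue_measure R), forall t, Q t}.
Proof.
by move=> h; apply: filterS => //; exact: (ae_filter_ringOfSetsType (@lebesgue_measure R)).
Qed.

Lemma RI_dct (f_ : nat -> R -> R) (f : R -> R) B :
  (forall j, continuous (f_ j)) -> continuous f -> (forall j t, `|f_ j t| <= B) ->
  {ae (@lebesgue_measure R), forall t, (fun j => f_ j t) @ \oo --> f t} ->
  (fun j => RI 0 (2 * pi) (f_ j)) @ \oo --> RI 0 (2 * pi) f.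
Proof.
move=> cf_ cf hB hae.
have mD : measurable (`[0, 2 * pi] : set (measurableTypeR R)) by [].
have [] := @dominated_convergence _ _ R (@lebesgue_measure R) _ mD
   (fun j => EFin \o f_ j) (EFin \o f) (EFin \o (fun=> B)).
- move=> j; exact: (measurable_int _ (intab_cont 0 (2 * pi) (cf_ j))).
- exact: (measurable_int _ (intab_cont 0 (2 * pi) cf)).
- apply: aeS hae => t h _ /=.
  by apply: cvg_EFin => //; near=> j.
- exact: (intab_cst 0 (2 * pi) B).
- by apply: aeW => t j _ /=; rewrite lee_fin.
move=> intf _.
have -> : (\int[@lebesgue_measure R]_(x in `[0%R, (2 * pi)%R]) (EFin \o f) x =
  (RI 0 (2 * pi) f)%:E)%E.
  by rewrite /RI /Rintegral fineK//; exact: integrable_fin_num.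
by move=> /fine_cvg.
Unshelve. all: by end_near. Qed.

Lemma av_dct (g_ : nat -> R -> C) g B :
  (forall j, ccont (g_ j)) -> ccont g -> (forall j t, nrm (g_ j t) <= B) ->
  {ae (@lebesgue_measure R), forall t, forall e, 0 < e ->
     exists N, forall j, (N <= j)%N -> nrm (g_ j t - g t) < e} ->
  forall e, 0 < e -> exists N, forall j, (N <= j)%N -> nrm (av (g_ j) - av g) < e.
Proof.
move=> cg_ [cg1 cg2] hB hae e e0.
have hr : (fun j => RI 0 (2 * pi) (fun t => Re (g_ j t))) @ \oo -->
    RI 0 (2 * pi) (fun t => Re (g t)).
  apply: (@RI_dct _ _ B) => // [j|j t|].
  - by have [] := cg_ j.
  - by apply: le_trans (Re_le_nrm _) _.
  - apply: aeS hae => t h; apply/cvgrPdist_lt => d d0.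
    have [N hN] := h d d0; exists N => // j /= Nj.
    rewrite distrC; apply: le_lt_trans (hN j Nj).
    by have := Re_le_nrm (g_ j t - g t); rewrite ReD ReN.
have hi : (fun j => RI 0 (2 * pi) (fun t => Im (g_ j t))) @ \oo -->
    RI 0 (2 * pi) (fun t => Im (g t)).
  apply: (@RI_dct _ _ B) => // [j|j t|].
  - by have [] := cg_ j.
  - by apply: le_trans (Im_le_nrm _) _.
  - apply: aeS hae => t h; apply/cvgrPdist_lt => d d0.
    have [N hN] := h d d0; exists N => // j /= Nj.
    rewrite distrC; apply: le_lt_trans (hN j Nj).
    by have := Im_le_nrm (g_ j t - g t); rewrite ImD ImN.
have e2 : 0 < e * (2 * pi) / 2 by rewrite divr_gt0// mulr_gt0.
move/cvgrPdist_lt : hr => /(_ _ e2)[N1 _ h1].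
move/cvgrPdist_lt : hi => /(_ _ e2)[N2 _ h2].
exists (maxn N1 N2) => j; rewrite geq_max => /andP[j1 j2].
rewrite /av -mulrBr nrmM nrm_real ger0_norm ?invr_ge0 ?ltW// ltr_pdivrMl// mulrC.
apply: le_lt_trans (nrm_le_ReIm _) _.
rewrite /ci ReD ReN ImD ImN /= [ltRHS](splitr (e * (2 * pi))); apply: ltrD.
  by rewrite distrC; exact: h1.
by rewrite distrC; exact: h2.
Qed.

End CircleAverage.

(** * The Cauchy kernel and Taylor expansion on the disc *)

Section Taylor.
Variable R : realType.
Local Notation C := R[i].
Local Open Scope complex_scope.
Local Open Scope ring_scope.
Implicit Types (f : C -> C) (z w : C) (t r : R).

Definition Hc r f : C := av (fun t => f (r%:C * cis t)).

Lemma Hc_const f r1 r2 rho : 0 < r1 -> r1 < rho -> 0 < r2 -> r2 < rho ->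
  (forall z, 0 < nrm z -> nrm z < rho -> cder f z) -> Hc r1 f = Hc r2 f.
Proof.
wlog le12 : r1 r2 / r1 <= r2.
  move=> H h1 h2 h3 h4 h5; have [le|/ltW le] := leP r1 r2; first exact: H.
  by apply/esym; exact: H.
move=> h1 h2 h3 h4 h5; rewrite /Hc /av; congr (_ * _); apply: circle_const => //.
move=> z /andP[z1 z2]; apply: h5; first exact: lt_le_trans z1.
exact: le_lt_trans h4.
Qed.

Lemma circle_cder_cont f r : 0 <= r -> (forall z, nrm z = r -> cder f z) ->
  ccont (fun t => f (r%:C * cis t)).
Proof. by move=> r0 h; apply: ccont_circle => t; apply: h; rewrite nrm_polar. Qed.

Lemma cder_invX n z : z != 0 -> cder (fun w => (w ^+ n)^-1) z.
Proof.
move=> z0; apply: cderV; first by rewrite expf_neq0.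
by apply: cderX; exact: cder_id.
Qed.

(** Doubling the radius leaves the average unchanged and also multiplies it by 2^-n, so it vanishes
    for n > 0. *)
Lemma Hc_invX r n : 0 < r -> Hc r (fun z => (z ^+ n)^-1) = (n == 0%N)%:R.
Proof.
move=> r0; case: n => [|n].
  rewrite -[RHS](av_cst 1); congr av; apply/funext => t.
  by rewrite expr0 invr1.
rewrite eqn0Ngt /=.
have cc s : 0 < s -> ccont (fun t => ((s%:C * cis t) ^+ n.+1)^-1).
  move=> s0; apply: (@circle_cder_cont (fun z => (z ^+ n.+1)^-1) s) => [|z zs]; first exact: ltW.
  by apply: cder_invX; rewrite -nrm_gt0 zs.
have E : Hc (2 * r) (fun z => (z ^+ n.+1)^-1) =
   ((2 ^- n.+1 : R)%:C) * Hc r (fun z => (z ^+ n.+1)^-1).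
  rewrite /Hc -avZ; last exact: cc.
  congr av; apply/funext => t; rewrite rmorphM -mulrA exprMn invfM.
  by rewrite fmorphV rmorphXn.
have := @Hc_const (fun z => (z ^+ n.+1)^-1) r (2 * r) (3 * r) r0.
rewrite E => /(_ _ _ _ _) H.
have {}H : Hc r (fun z => (z ^+ n.+1)^-1) = (2 ^- n.+1)%:C * Hc r (fun z => (z ^+ n.+1)^-1).
  apply: H; [lra|lra|lra|].
  by move=> z z0 _; apply: cder_invX; rewrite -nrm_gt0.
apply/eqP; move/eqP: H; rewrite -subr_eq0 -{1}[Hc _ _]mul1r -mulrBl mulf_eq0.
case/orP => // /eqP h; exfalso.
have /eqP : (1 - 2 ^- n.+1 : R) = 0 by apply: complexI; rewrite rmorphB.
rewrite subr_eq0 => /eqP h1; have : (1 : R) < 2 ^+ n.+1 by rewrite exprn_egt1// ltr1n.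
by rewrite -(invrK (2 ^+ n.+1)) -h1 invr1 ltxx.
Qed.

Lemma sum_delta0 w N : \sum_(n < N.+1) w ^+ n * (n == 0%N :> nat)%:R = 1.
Proof. by rewrite big_ord_recl /= mul1r big1 ?addr0// => n _; rewrite mulr0. Qed.

Lemma geo_identity z w N : z != 0 -> z - w != 0 ->
  z / (z - w) = \sum_(n < N) w ^+ n * (z ^+ n)^-1 + (w / z) ^+ N * (z / (z - w)).
Proof.
move=> z0 zw; elim: N => [|N IH]; first by rewrite big_ord0 expr0 mul1r add0r.
rewrite {1}IH big_ord_recr /= -addrA; congr (_ + _).
rewrite exprS exprMn exprVn; field.
by rewrite expf_neq0// zw z0.
Qed.

Variables (m : C -> C) (B : R).
Hypothesis mB : forall z, nrm z < 1 -> nrm (m z) <= B.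
Hypothesis md : forall z, nrm z < 1 -> cder m z.

Let B0 : 0 <= B.
Proof.
have h0 : nrm (0 : C) < 1 by rewrite nrm0.
exact: le_trans (nrm_ge0 _) (mB h0).
Qed.

(** The radius 1/2 is arbitrary, by [cfE]. *)
Definition cf n : C := Hc 2^-1 (fun z => m z * (z ^+ n)^-1).

Lemma cfE r n : 0 < r -> r < 1 -> Hc r (fun z => m z * (z ^+ n)^-1) = cf n.
Proof.
move=> r0 r1; apply: (@Hc_const _ _ _ 1) => //.
- by rewrite invf_lt1// ltr1n.
- move=> z z0 z1; apply: cderM; first exact: md.
  by apply: cder_invX; rewrite -nrm_gt0.
Qed.

(** Expanding the Cauchy kernel as a finite geometric series in w / z leaves a single remainder,
    bounded through |z - w| >= r - |w|. *)
Lemma geo_average f B' w r N : 0 < r -> nrm w < r ->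
  (forall z, nrm z = r -> cder f z) -> (forall z, nrm z = r -> nrm (f z) <= B') ->
  nrm (Hc r (fun z => f z * (z / (z - w))) -
       \sum_(n < N) w ^+ n * Hc r (fun z => f z * (z ^+ n)^-1))
   <= 2 * (B' * ((nrm w / r) ^+ N * (r / (r - nrm w)))).
Proof.
move=> r0 wr fd fB.
have zr0 z : nrm z = r -> z != 0 by move=> zr; rewrite -nrm_gt0 zr.
have zw z : nrm z = r -> z - w != 0.
  by move=> zr; rewrite subr_eq0; apply/eqP => e; move: wr; rewrite -e zr ltxx.
have c1 n : ccont (fun t => f (r%:C * cis t) * ((r%:C * cis t) ^+ n)^-1).
  apply: (@circle_cder_cont (fun z => f z * (z ^+ n)^-1) r); first exact: ltW.
  by move=> z zr; apply: cderM; [exact: fd|apply: cder_invX; exact: zr0].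
have ck z : nrm z = r -> cder (fun z => z / (z - w)) z.
  move=> zr; apply: cderM; first exact: cder_id.
  apply: cderV; first exact: zw.
  by apply: cderD; [exact: cder_id|exact: cder_cst].
have c2 : ccont (fun t => f (r%:C * cis t) * (r%:C * cis t / (r%:C * cis t - w))).
  apply: (@circle_cder_cont (fun z => f z * (z / (z - w))) r); first exact: ltW.
  by move=> z zr; apply: cderM; [exact: fd|exact: ck].
pose err z := f z * ((w / z) ^+ N * (z / (z - w))).
have cw n : ccont (fun t => w ^+ n * (f (r%:C * cis t) * ((r%:C * cis t) ^+ n)^-1)).
  by apply: ccontM; [exact: ccont_cst|exact: c1].
have cerr : ccont (fun t => err (r%:C * cis t)).
  apply: (@circle_cder_cont err r); first exact: ltW.
  move=> z zr; apply: cderM; first exact: fd.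
  apply: cderM; last exact: ck.
  apply: cderX; apply: cderM; first exact: cder_cst.
  by apply: cderV; [exact: zr0|exact: cder_id].
have -> : Hc r (fun z => f z * (z / (z - w))) -
       \sum_(n < N) w ^+ n * Hc r (fun z => f z * (z ^+ n)^-1) = Hc r err.
  rewrite /Hc.
  under [X in _ - X]eq_bigr do rewrite -avZ//.
  rewrite -(@av_sum _ N (fun n t => w ^+ n * (f (r%:C * cis t) * ((r%:C * cis t) ^+ n)^-1)))//.
  rewrite -avB//; last exact: (@ccont_sum _ N _ cw).
  congr av; apply/funext => t.
  have zr : nrm (r%:C * cis t) = r by rewrite nrm_polar// ltW.
  rewrite /err {1}(geo_identity N (zr0 _ zr) (zw _ zr)) mulrDr mulr_sumr addrAC.
  rewrite -sumrB big1 ?add0r// => n _; ring.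
rewrite /Hc; apply: av_bound => // t.
have zr : nrm (r%:C * cis t) = r by rewrite nrm_polar// ltW.
rewrite /err nrmM; apply: ler_pM; rewrite ?nrm_ge0//; first exact: fB.
rewrite nrmM nrmX !nrmM !nrmV; set z := r%:C * cis t in zr *.
rewrite -nrmM -/z zr.
apply: ler_pM => //.
- by rewrite exprn_ge0// divr_ge0 ?nrm_ge0// ltW.
- by rewrite divr_ge0 ?nrm_ge0// ltW.
rewrite ler_pM2l// lef_pV2 ?posrE ?subr_gt0//; last by rewrite nrm_gt0 zw.
by rewrite -zr lerBlDr; have := nrmD (z - w) w; rewrite subrK.
Qed.

Lemma Hc_seq f (rho : nat -> R) r0 B' : 0 <= r0 < 1 -> (forall j, 0 <= rho j < 1) ->
  rho @ \oo --> r0 -> (forall z, nrm z < 1 -> nrm (f z) <= B') ->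
  (forall z, nrm z < 1 -> forall e, 0 < e -> exists2 d, 0 < d & forall w, nrm (w - z) < d ->
     nrm (f w - f z) < e) ->
  forall e, 0 < e -> exists N, forall j, (N <= j)%N -> nrm (Hc (rho j) f - Hc r0 f) < e.
Proof.
move=> /andP[r00 r01] hrho cv fB fc.
have cc r : 0 <= r -> r < 1 -> ccont (fun t => f (r%:C * cis t)).
  move=> ra rb; apply: (@ccont_comp _ f (fun t => r%:C * cis t)).
    by apply: ccontM; [exact: ccont_cst|exact: ccont_cis].
  by move=> t; apply: fc; rewrite nrm_polar.
apply: (@av_dct _ _ _ B') => [j| |j t|].
- by have /andP[? ?] := hrho j; exact: cc.
- exact: cc.
- by have /andP[? ?] := hrho j; apply: fB; rewrite nrm_polar.
- apply: aeW => t e e0; have [|d d0 h] := fc (r0%:C * cis t) _ e e0; first by rewrite nrm_polar.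
  move/cvgrPdist_lt : cv => /(_ d d0)[N _ hN]; exists N => j Nj; apply: h.
  rewrite -mulrBl -rmorphB nrmM nrm_cis mulr1 nrm_real distrC.
  exact: hN.
Qed.

(** Circle invariance does not reach radius 0, nor a circle on which [f] is merely continuous;
    dominated convergence along radii decreasing to [r0] does. *)
Lemma Hc_zero_right f r0 r B' : 0 <= r0 -> r0 < r -> r < 1 ->
  (forall z, nrm z < 1 -> nrm (f z) <= B') ->
  (forall z, nrm z < 1 -> forall e, 0 < e -> exists2 d, 0 < d & forall w, nrm (w - z) < d ->
     nrm (f w - f z) < e) ->
  (forall s, r0 < s -> s <= r -> Hc s f = Hc r f) -> Hc r f = Hc r0 f.
Proof.
move=> r00 r0r r1 fB fc hs; apply/eqP; rewrite -subr_eq0 -nrm_eq0; apply/eqP.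
apply/le_anti/andP; split; last exact: nrm_ge0.
apply/ler_addgt0Pl => e e0; rewrite addr0.
pose rho (j : nat) := r0 + (r - r0) * j.+1%:R^-1.
have p j : 0 < (r - r0) * j.+1%:R^-1 by rewrite mulr_gt0 ?subr_gt0// invr_gt0.
have q j : (r - r0) * j.+1%:R^-1 <= r - r0.
  by apply: ler_piMr; [rewrite subr_ge0 ltW|rewrite invf_le1// ler1n].
have cv : rho @ \oo --> r0.
  rewrite -[X in _ --> X]addr0; apply: cvgD; first exact: cvg_cst.
  rewrite -[X in _ --> X](mulr0 (r - r0)); apply: cvgM; first exact: cvg_cst.
  exact: cvg_harmonic.
have hr j : 0 <= rho j < 1.
  have := p j; have := q j; rewrite /rho; move: ((r - r0) * _) => x h1 h2.
  by apply/andP; split; lra.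
have [|N hN] := Hc_seq _ hr cv fB fc e0; first by rewrite r00 (lt_trans r0r).
have := hN N (leqnn N); rewrite hs; first exact: ltW.
  by rewrite /rho ltrDl.
by have := q N; rewrite /rho; move: ((r - r0) * _) => x h1; lra.
Qed.

Lemma Hc_zero_left f r0 B' : 0 < r0 -> r0 < 1 ->
  (forall z, nrm z < 1 -> nrm (f z) <= B') ->
  (forall z, nrm z < 1 -> forall e, 0 < e -> exists2 d, 0 < d & forall w, nrm (w - z) < d ->
     nrm (f w - f z) < e) ->
  (forall s, 0 < s -> s < r0 -> Hc s f = 0) -> Hc r0 f = 0.
Proof.
move=> r00 r01 fB fc hs; apply/eqP; rewrite -nrm_eq0; apply/eqP.
apply/le_anti/andP; split; last exact: nrm_ge0.
apply/ler_addgt0Pl => e e0; rewrite addr0.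
pose rho (j : nat) := r0 + (- (r0 / 2)) * j.+1%:R^-1.
have p j : 0 < r0 / 2 * j.+1%:R^-1 by rewrite mulr_gt0 ?divr_gt0// invr_gt0.
have q j : r0 / 2 * j.+1%:R^-1 <= r0 / 2.
  by apply: ler_piMr; [rewrite divr_ge0// ltW|rewrite invf_le1// ler1n].
have cv : rho @ \oo --> r0.
  rewrite -[X in _ --> X]addr0; apply: cvgD; first exact: cvg_cst.
  rewrite -[X in _ --> X](mulr0 (- (r0 / 2))); apply: cvgM; first exact: cvg_cst.
  exact: cvg_harmonic.
have hr j : 0 <= rho j < 1.
  have := p j; have := q j; rewrite /rho mulNr; move: (r0 / 2 * _) => x h1 h2.
  by apply/andP; split; lra.
have [|N hN] := Hc_seq _ hr cv fB fc e0; first by rewrite ltW.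
have := hN N (leqnn N); rewrite hs ?sub0r ?nrmN; first exact: ltW.
  by have := p N; have := q N; rewrite /rho mulNr; move: (r0 / 2 * _) => x h1 h2; lra.
by rewrite /rho mulNr gtrBl.
Qed.

(* The circle averages of [q z = z (m z - m w) / (z - w)] are constant on both
   sides of the radius [nrm w] and depend continuously on the radius down to
   the centre, where [q] vanishes. *)
Lemma Hc_cauchy w r : nrm w < r -> r < 1 ->
  Hc r (fun z => m z * (z / (z - w))) = m w * Hc r (fun z => z / (z - w)).
Proof.
move=> wr r1; have w1 : nrm w < 1 by exact: lt_trans r1.
have r0 : 0 < r by apply: le_lt_trans wr; exact: nrm_ge0.
have /cderP[c hc] := md w1.
(* [w * c] is the limit at [w], so [q] is continuous on the disc and differentiable off [w]. *)
pose q z := if z == w then w * c else (m z - m w) * (z / (z - w)).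
have qd z : nrm z < 1 -> z != w -> cder q z.
  move=> z1 zw; have zw0 : 0 < nrm (z - w) by rewrite nrm_gt0 subr_eq0.
  apply: (@cder_local _ (fun z => (m z - m w) * (z / (z - w))) _ _ _ zw0).
    move=> x hx; rewrite /q; case: eqP => // xw.
    by move: hx; rewrite xw nrmB ltxx.
  apply: cderM; first by apply: cderD; [exact: md|exact: cder_cst].
  apply: cderM; first exact: cder_id.
  apply: cderV; first by rewrite subr_eq0.
  by apply: cderD; [exact: cder_id|exact: cder_cst].
have qw e : 0 < e -> exists2 d, 0 < d & forall z, nrm (z - w) < d -> nrm (q z - q w) < e.
  move=> e0; have C0 := nrm_ge0 c; have W0 := nrm_ge0 w.
  (* The increment of [q] is at most [2 * k + |c| * k]; the 3 makes this strictly less than [k * K],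
     hence than [e]. *)
  pose K := nrm c + 3.
  have K0 : 0 < K by rewrite /K; lra.
  have e1 : 0 < Num.min 1 (e / K) by rewrite lt_min ltr01 divr_gt0.
  have [d d0 hd] := hc _ e1; exists (Num.min d (Num.min 1 (e / K))).
    by rewrite lt_min d0.
  move=> z; rewrite lt_min => /andP[z1 z2].
  have [->|zw] := eqVneq z w; first by rewrite subrr nrm0.
  have zn : 0 < nrm (z - w) by rewrite nrm_gt0 subr_eq0.
  have zw0 : z - w != 0 by rewrite subr_eq0.
  rewrite /q (negbTE zw) eqxx.
  have -> : (m z - m w) * (z / (z - w)) - w * c =
     (m z - m w - c * (z - w)) / (z - w) * ((z - w) + w) + c * (z - w) by field.
  have h1 : nrm ((m z - m w - c * (z - w)) / (z - w)) <= Num.min 1 (e / K).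
    by rewrite nrmM nrmV ler_pdivrMr//; exact: hd.
  apply: le_lt_trans (nrmD _ _) _; rewrite (nrmM _ (z - w + w)) (nrmM c).
  set k := Num.min 1 (e / K) in e1 z2 h1.
  have k1 : k <= 1 by rewrite ge_min lexx.
  have kK : k * K <= e by rewrite -ler_pdivlMr// ge_min lexx orbT.
  have h2 : nrm (z - w + w) <= 2.
    by apply: le_trans (nrmD _ _) _; lra.
  have h3 := nrm_ge0 (z - w + w).
  have h4 : nrm ((m z - m w - c * (z - w)) / (z - w)) * nrm (z - w + w) <= k * 2.
    by apply: ler_pM => //; exact: nrm_ge0.
  have h5 : nrm c * nrm (z - w) <= nrm c * k by rewrite ler_wpM2l// ltW.
  apply: le_lt_trans (lerD h4 h5) _; apply: lt_le_trans kK; rewrite /K; nra.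
have qc z : nrm z < 1 -> forall e, 0 < e -> exists2 d, 0 < d &
    forall x, nrm (x - z) < d -> nrm (q x - q z) < e.
  by move=> z1; have [->|zw] := eqVneq z w; [exact: qw|apply: cder_cont; exact: qd].
(* A dominating constant: near [w] continuity bounds [q], and at distance at least [d] the quotient
   is at most [2 * B / d]. *)
have [d d0 hd] := qw 1 ltr01.
pose B' := nrm (q w) + 1 + 2 * B / d.
have Bd : 0 <= 2 * B / d by rewrite !mulr_ge0// invr_ge0 ltW.
have qB z : nrm z < 1 -> nrm (q z) <= B'.
  move=> z1; have [h|h] := ltP (nrm (z - w)) d.
    have -> : q z = (q z - q w) + q w by rewrite subrK.
    apply: le_trans (nrmD _ _) _; have := hd z h; rewrite /B'; lra.
  have zw : z != w.
    by apply/eqP => e; move: h; rewrite e subrr nrm0 leNgt d0.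
  rewrite /q (negbTE zw) nrmM; apply: (@le_trans _ _ (2 * B / d)); last first.
    by have := nrm_ge0 (q w); rewrite /B'; lra.
  apply: ler_pM; rewrite ?nrm_ge0//.
    apply: le_trans (nrmD _ _) _; rewrite nrmN.
    by have := mB z1; have := mB w1; lra.
  rewrite nrmM nrmV -[leRHS]mul1r; apply: ler_pM; [exact: nrm_ge0|by rewrite invr_ge0 nrm_ge0|exact: ltW|].
  by rewrite lef_pV2 ?posrE// (lt_le_trans d0).
have const r0' r' : 0 <= r0' -> r0' < r' -> r' < 1 ->
    (forall z, r0' < nrm z -> nrm z <= r' -> z != w) -> Hc r' q = Hc r0' q.
  move=> h1 h2 h3 h4; apply: (Hc_zero_right h1 h2 h3 qB qc) => s s1 s2.
  have s0 : 0 < s by exact: le_lt_trans s1.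
  have s00 : 0 < r' by exact: lt_le_trans s2.
  rewrite /Hc /av; congr (_ * _); apply: circle_const => // z /andP[z1 z2].
  apply: qd; first exact: le_lt_trans h3.
  by apply: h4 => //; exact: lt_le_trans z1.
have H0 : Hc 0 q = 0.
  rewrite /Hc -[RHS](av_cst 0); congr av; apply/funext => t; rewrite mul0r /q.
  by case: eqP => [<-|_]; rewrite ?mul0r// mulr0.
have Hw : Hc (nrm w) q = 0.
  have [->//|w0] := eqVneq (nrm w) 0.
  have w0' : 0 < nrm w by rewrite lt_neqAle eq_sym w0 nrm_ge0.
  apply: (Hc_zero_left w0' w1 qB qc) => s s0 sw.
  rewrite -H0; apply: const; [exact: lexx|exact: s0|exact: lt_trans w1|].
  by move=> z _ zs; apply/eqP => e; move: sw; rewrite -e ltNge zs.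
have Hr : Hc r q = 0.
  rewrite -Hw; apply: const; [exact: nrm_ge0|exact: wr|exact: r1|].
  by move=> z zw _; apply/eqP => e; move: zw; rewrite e ltxx.
have zw z : nrm z = r -> z != w.
  by move=> zr; apply/eqP => e; move: wr; rewrite -e zr ltxx.
have ck : forall z, nrm z = r -> cder (fun z => z / (z - w)) z.
  move=> z zr; apply: cderM; first exact: cder_id.
  apply: cderV; first by rewrite subr_eq0; exact: zw.
  by apply: cderD; [exact: cder_id|exact: cder_cst].
have c1 := circle_cder_cont (ltW r0) ck.
have c2 : ccont (fun t => m (r%:C * cis t) * (r%:C * cis t / (r%:C * cis t - w))).
  apply: (@circle_cder_cont (fun z => m z * (z / (z - w))) r); first exact: ltW.
  by move=> z zr; apply: cderM; [apply: md; rewrite zr|exact: ck].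
apply/eqP; rewrite -subr_eq0 /Hc -avZ// -avB//; last first.
  by apply: ccontM => //; exact: ccont_cst.
apply/eqP; rewrite -Hr; congr av; apply/funext => t; rewrite /q.
have -> : (r%:C * cis t == w) = false.
  by apply/negbTE; apply: zw; rewrite nrm_polar// ltW.
by rewrite mulrBl.
Qed.

(** For |w| = s the Cauchy kernel is integrated over the radius (1 + s) / 2, halfway to 1. [theta]
    is then the geometric ratio, and [kap] the constant before its powers. *)
Definition theta (s : R) := s / ((1 + s) / 2).
Definition kap (s : R) := 4 * B * (((1 + s) / 2) / ((1 + s) / 2 - s)).

Lemma taylor_error w N : nrm w < 1 ->
  nrm (m w - \sum_(n < N.+1) w ^+ n * cf n) <= kap (nrm w) * theta (nrm w) ^+ N.+1.
Proof.
move=> w1; pose r := (1 + nrm w) / 2; have w0 := nrm_ge0 w.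
have wr : nrm w < r by rewrite /r; lra.
have r1 : r < 1 by rewrite /r; lra.
have r0 : 0 < r by rewrite /r; lra.
have mc z : nrm z = r -> cder m z by move=> zr; apply: md; rewrite zr.
have mb z : nrm z = r -> nrm (m z) <= B by move=> zr; apply: mB; rewrite zr.
have g1 := @geo_average m B w r N.+1 r0 wr mc mb.
have b1 z : nrm z = r -> nrm (1 : C) <= 1 by rewrite nrm1.
have cd1 z : nrm z = r -> cder (fun=> 1) z by move=> _; exact: cder_cst.
(* The kernel average is estimated, not computed: for the constant 1 the sum is exactly 1, [N.+1]
   ensuring that the term of index 0 occurs. *)
have g2 := @geo_average (fun=> 1) 1 w r N.+1 r0 wr cd1 b1.
have E1 : \sum_(n < N.+1) w ^+ n * Hc r (fun z => m z * (z ^+ n)^-1) =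
   \sum_(n < N.+1) w ^+ n * cf n by apply: eq_bigr => n _; rewrite cfE.
have E2 : \sum_(n < N.+1) w ^+ n * Hc r (fun z => 1 * (z ^+ n)^-1) = 1.
  have e n : Hc r (fun z => 1 * (z ^+ n)^-1) = (n == 0%N)%:R.
    by rewrite -(Hc_invX n r0); congr av; apply/funext => t; rewrite mul1r.
  rewrite (eq_bigr (fun n : 'I_N.+1 => w ^+ n * ((n : nat) == 0%N)%:R)).
    exact: sum_delta0.
  by move=> n _; congr (_ * _); exact: e.
have E3 : Hc r (fun z => 1 * (z / (z - w))) = Hc r (fun z => z / (z - w)).
  by congr av; apply/funext => t; rewrite mul1r.
rewrite E1 (Hc_cauchy wr r1) in g1; rewrite E2 E3 mul1r in g2.
set Q := (nrm w / r) ^+ N.+1 * _ in g1 g2.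
have -> : kap (nrm w) * theta (nrm w) ^+ N.+1 = 2 * (B * Q) + B * (2 * Q).
  by rewrite /kap /theta -/r /Q; ring.
set S := \sum_(n < N.+1) _ in g1 *.
clear E1 E2 E3; clearbody S Q; move: (Hc r _) g1 g2 => H g1 g2.
have -> : m w - S = (m w * H - S) - m w * (H - 1) by ring.
apply: le_trans (nrmD _ _) _; rewrite nrmN (nrmM (m w)); apply: (lerD g1).
by apply: ler_pM; [exact: nrm_ge0|exact: nrm_ge0|exact: mB|exact: g2].
Qed.

Lemma theta_lt1 s : 0 <= s -> s < 1 -> 0 <= theta s < 1.
Proof.
move=> s0 s1; have p : 0 < (1 + s) / 2 by lra.
rewrite /theta; apply/andP; split; first by rewrite divr_ge0// ltW.
by rewrite ltr_pdivrMr// mul1r; lra.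
Qed.

(** Cauchy's estimate, with the factor 2 of [av_bound]. *)
Lemma cf_bound r n : 0 < r -> r < 1 -> nrm (cf n) * r ^+ n <= 2 * B.
Proof.
move=> r0 r1; rewrite -(cfE n r0 r1).
rewrite -ler_pdivlMr ?exprn_gt0// -mulrA; apply: av_bound.
  apply: (@circle_cder_cont (fun z => m z * (z ^+ n)^-1) r); first exact: ltW.
  move=> z zr; apply: cderM; first by apply: md; rewrite zr.
  by apply: cder_invX; rewrite -nrm_gt0 zr.
move=> t; have zr : nrm (r%:C * cis t) = r by rewrite nrm_polar// ltW.
rewrite nrmM nrmV nrmX zr; apply: ler_wpM2r; first by rewrite invr_ge0 exprn_ge0// ltW.
by apply: mB; rewrite zr.
Qed.

Lemma geo_small (K q e : R) : 0 <= K -> 0 <= q < 1 -> 0 < e -> exists N0, forall N,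
  (N0 <= N)%N -> K * q ^+ N < e.
Proof.
move=> K0 /andP[q0 q1] e0.
have := @cvg_geometric R K q; rewrite ger0_norm// => /(_ q1).
move=> /cvgrPdist_lt/(_ e e0)[N _ h]; exists N => k Nk.
by have := h k Nk; rewrite sub0r normrN /geometric /= ger0_norm// mulr_ge0// exprn_ge0.
Qed.

Lemma csum_lim (f : nat -> C) (l : C) : csable f ->
  (forall e, 0 < e -> exists N0, forall N, (N0 <= N)%N -> nrm (l - \sum_(n < N.+1) f n) < e) ->
  csum f = l.
Proof.
move=> sf h; apply/eqP; rewrite -subr_eq0 -nrm_eq0; apply/eqP.
apply/le_anti/andP; split; last exact: nrm_ge0.
apply/ler_addgt0Pl => e e0; rewrite addr0.
have e2 : 0 < e / 2 by rewrite divr_gt0.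
have [N1 h1] := h _ e2.
have /cvgCxP/(_ _ e2)[N2 _ h2] := cvg_csum sf.
pose N := maxn N1 N2.
have g1 := h1 N (leq_maxl _ _).
have g2 := h2 N.+1 (leq_trans (leq_maxr N1 N2) (leqnSn _)).
have {}g2 : nrm (csum f - \sum_(n < N.+1) f n) < e / 2.
  by move: g2; rewrite /series /= big_mkord.
have -> : csum f - l = (csum f - \sum_(n < N.+1) f n) - (l - \sum_(n < N.+1) f n) by ring.
by apply: le_trans (nrmD _ _) _; rewrite nrmN; lra.
Qed.

Lemma kap_ge0 s : 0 <= s -> s < 1 -> 0 <= kap s.
Proof. by move=> s0 s1; rewrite /kap !mulr_ge0 ?invr_ge0//; lra. Qed.

Lemma taylor w : nrm w < 1 -> m w = ev cf w.
Proof.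
move=> w1; have w0 := nrm_ge0 w; apply/esym; apply: csum_lim.
  pose r := (1 + nrm w) / 2.
  have r1 : r < 1 by rewrite /r; lra.
  have r0 : 0 < r by rewrite /r; lra.
  apply: (@csable_le _ _ (fun n => 2 * B * theta (nrm w) ^+ n)) => [|n].
    by apply: series_cvgZ; apply: cvg_geo; exact: theta_lt1.
  have h := cf_bound n r0 r1.
  rewrite nrmM nrmX (_ : theta (nrm w) = nrm w / r)// [(nrm w / r) ^+ n]exprMn exprVn.
  rewrite mulrA ler_pdivlMr ?exprn_gt0// mulrAC.
  by rewrite ler_wpM2r// exprn_ge0.
move=> e e0; have [N0 h] := geo_small (kap_ge0 w0 w1) (theta_lt1 w0 w1) e0.
exists N0 => N hN; apply: le_lt_trans (h N.+1 (leqW hN)).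
under eq_bigr do rewrite mulrC.
exact: taylor_error.
Qed.

End Taylor.

(** * Dominated convergence for series *)

Section Tannery.
Variable R : realType.
Local Notation C := R[i].
Local Open Scope complex_scope.
Local Open Scope ring_scope.

Lemma nrm_csum_bound (f : nat -> C) (S : R) : csable f ->
  (forall N, nrm (\sum_(0 <= n < N) f n) <= S) -> nrm (csum f) <= S.
Proof.
move=> sf h; apply/ler_addgt0Pl => e e0.
have /cvgCxP/(_ _ e0)[N _ /(_ N (leqnn N)) hN] := cvg_csum sf.
have -> : csum f = (csum f - series f N) + series f N by rewrite subrK.
apply: le_trans (nrmD _ _) _; apply: lerD; first exact: ltW.
exact: h.
Qed.

Lemma nrm_sum (N : nat) (f : nat -> C) :
  nrm (\sum_(0 <= n < N) f n) <= \sum_(0 <= n < N) nrm (f n).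
Proof.
elim: N => [|N IH]; first by rewrite !big_geq// nrm0.
by rewrite !big_nat_recr//=; apply: le_trans (nrmD _ _) _; rewrite lerD2r.
Qed.

Lemma sum_cvg (N : nat) (F : nat -> nat -> R) (l : nat -> R) :
  (forall n, (fun j => F j n) @ \oo --> l n) ->
  (fun j => \sum_(0 <= n < N) F j n) @ \oo --> \sum_(0 <= n < N) l n.
Proof.
move=> h; elim: N => [|N IH].
  by rewrite big_geq//; under eq_fun do rewrite big_geq//; exact: cvg_cst.
rewrite big_nat_recr//=; under eq_fun do rewrite big_nat_recr//=.
by apply: cvgD.
Qed.

(** Absolute summability controls the tail beyond [N0] uniformly in [j]; below it only finitely many
    limits are involved. *)
Lemma tannery (c : nat -> C) (x : nat -> nat -> R) : csable c ->
  (forall j n, 0 <= x j n <= 1) -> (forall n, (fun j => x j n) @ \oo --> (1 : R)) ->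
  forall e, 0 < e -> exists J, forall j, (J <= j)%N ->
    nrm (csum (fun n => c n * (x j n)%:C) - csum c) <= e.
Proof.
move=> sc hx xc e e0.
have e2 : 0 < e / 2 by rewrite divr_gt0.
have sc' := (csableP c).1 sc.
have /cvgrPdist_lt/(_ _ e2)[N0 _ /(_ N0 (leqnn N0)) hN0] := sc'.
have z : (fun j => \sum_(0 <= n < N0) nrm (c n) * (1 - x j n)) @ \oo --> 0.
  have E0 : \sum_(0 <= n < N0) nrm (c n) * (1 - 1) = 0.
    by rewrite big1// => n _; rewrite subrr mulr0.
  have : (fun j => \sum_(0 <= n < N0) nrm (c n) * (1 - x j n)) @ \oo -->
      \sum_(0 <= n < N0) nrm (c n) * (1 - 1).
    apply: (sum_cvg (F := fun j n => nrm (c n) * (1 - x j n))) => n.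
    apply: cvgM; first exact: cvg_cst.
    by apply: cvgB; [exact: cvg_cst|exact: xc].
  by rewrite E0.
move/cvgrPdist_lt : z => /(_ _ e2)[J _ hJ]; exists J => j /hJ {}hJ.
have x01 n : 0 <= 1 - x j n by have /andP[? ?] := hx j n; lra.
have x1 n : 1 - x j n <= 1 by have /andP[? ?] := hx j n; lra.
have nE n : nrm (c n * (x j n)%:C) <= nrm (c n).
  have /andP[h1 h2] := hx j n.
  by rewrite nrmM nrm_real ger0_norm// ler_piMr// nrm_ge0.
have scx : csable (fun n => c n * (x j n)%:C) by exact: csable_le sc' nE.
have -> : csum (fun n => c n * (x j n)%:C) - csum c =
    csum (fun n => c n * (x j n)%:C + (-1) * c n).
  by rewrite csumD ?csumZ ?mulN1r//; exact: csableZ.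
apply: nrm_csum_bound => [|N]; first by apply: csableD => //; exact: csableZ.
apply: le_trans (nrm_sum _ _) _.
have fE n : nrm (c n * (x j n)%:C + -1 * c n) = nrm (c n) * (1 - x j n).
  have -> : c n * (x j n)%:C + -1 * c n = - (c n * (1 - x j n)%:C).
    by rewrite rmorphB rmorph1; ring.
  by rewrite nrmN nrmM nrm_real ger0_norm.
under eq_bigr do rewrite fE.
apply: (@le_trans _ _ (\sum_(0 <= n < maxn N N0) nrm (c n) * (1 - x j n))).
  rewrite (big_cat_nat (leq0n N) (leq_maxl N N0))/= lerDl sumr_ge0// => n _.
  by rewrite mulr_ge0// nrm_ge0.
rewrite (big_cat_nat (leq0n N0) (leq_maxr N N0))/= (splitr e); apply: lerD.
  by apply: le_trans (ltW hJ); rewrite sub0r normrN ler_norm.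
apply: (@le_trans _ _ (\sum_(N0 <= n < maxn N N0) nrm (c n))).
  by apply: ler_sum => n _; rewrite ler_piMr// nrm_ge0.
apply: le_trans (ltW hN0); apply: le_trans (ler_norm _); rewrite lerBrDr.
have := @nneg_series_le_lim R (fun n => nrm (c n)) (maxn N N0) (fun n => nrm_ge0 _) sc'.
by rewrite /series /= (big_cat_nat (leq0n N0) (leq_maxr N N0))/= addrC.
Qed.

(** This precedes square summability of the coefficients: geometric decay comes from Cauchy's
    estimate at a radius [s] between [r] and 1. *)
Lemma corr_csable (a : nat -> C) (D r : R) k :
  (forall s n, 0 < s -> s < 1 -> nrm (a n) * s ^+ n <= D) -> 0 < r -> r < 1 ->
  csable (fun n => (a (n + k)%N * (a n)^*) * (r ^+ (n + (n + k)))%:C).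
Proof.
move=> aD r0 r1; pose s := (1 + r) / 2.
have s1 : s < 1 by rewrite /s; lra.
have s0 : 0 < s by rewrite /s; lra.
apply: (@csable_le _ _ (fun n => (D * D) * theta r ^+ n)) => [|n].
  by apply: series_cvgZ; apply: cvg_geo; apply: theta_lt1 => //; exact: ltW.
have h1 := aD r (n + k)%N r0 r1; have h2 := aD s n s0 s1.
rewrite !nrmM nrm_conj nrm_real ger0_norm ?exprn_ge0 ?(ltW r0)//.
have -> : nrm (a (n + k)%N) * nrm (a n) * r ^+ (n + (n + k)) =
  (nrm (a (n + k)%N) * r ^+ (n + k)) * ((nrm (a n) * s ^+ n) * (r / s) ^+ n).
  rewrite [r ^+ (n + (n + k))]exprD [(r / s) ^+ n]exprMn exprVn; field.
  by rewrite expf_neq0// gt_eqF.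
rewrite -[D * D * _]mulrA; apply: ler_pM => //.
- by rewrite mulr_ge0 ?nrm_ge0// exprn_ge0// ltW.
- apply: mulr_ge0; last by rewrite exprn_ge0// divr_ge0// ltW.
  by apply: mulr_ge0; [exact: nrm_ge0|rewrite exprn_ge0// ltW].
- by apply: ler_wpM2r => //; rewrite exprn_ge0// divr_ge0// ltW.
Qed.

End Tannery.

(** * Boundary values of an inner function and orthonormality *)

Section InnerFunction.
Variable R : realType.
Local Notation C := R[i].
Local Notation sh := (@Defs.shift R).
Local Open Scope complex_scope.
Local Open Scope ring_scope.
Implicit Types (z w : C) (t : R).
Variables (m : C -> C) (B : R).
Hypothesis mB : forall z, nrm z < 1 -> nrm (m z) <= B.
Hypothesis md : forall z, nrm z < 1 -> cder m z.
Hypothesis m_inner : {ae (@lebesgue_measure R), forall t, exists l : C, nrm l = 1 /\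
  forall e, 0 < e -> exists2 d, 0 < d & forall r, 0 <= r < 1 -> 1 - r < d ->
    nrm (m (r%:C * cis t) - l) < e}.

Local Notation a := (cf m).

Let B0 : 0 <= B.
Proof.
have h0 : nrm (0 : C) < 1 by rewrite nrm0.
exact: le_trans (nrm_ge0 _) (mB h0).
Qed.

Let zlt r t : 0 <= r < 1 -> nrm (r%:C * cis t) < 1.
Proof. by move=> /andP[r0 r1]; rewrite nrm_polar. Qed.

Let cm r : 0 <= r < 1 -> ccont (fun t => m (r%:C * cis t)).
Proof. by move=> hr; apply: ccont_circle => t; apply: md; exact: zlt. Qed.

Let ccis j : ccont (fun t : R => ((cis t)^*) ^+ j).
Proof. by apply: ccontX; apply: ccont_conj; exact: ccont_cis. Qed.

Lemma fourier_coef r j : 0 < r -> r < 1 ->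
  av (fun t => m (r%:C * cis t) * ((cis t)^*) ^+ j) = (r ^+ j)%:C * a j.
Proof.
move=> r0 r1; rewrite -(cfE md j r0 r1) /Hc -avZ.
  congr av; apply/funext => t.
  rewrite cis_conj exprMn invfM exprVn -rmorphXn -fmorphV mulrCA; congr (_ * _).
  by rewrite mulrA -rmorphM mulfV ?rmorph1 ?mul1r// expf_neq0// gt_eqF.
apply: (@circle_cder_cont _ (fun z => m z * (z ^+ j)^-1) r); first exact: ltW.
move=> z zr; apply: cderM; first by apply: md; rewrite zr.
by apply: cder_invX; rewrite -nrm_gt0 zr.
Qed.

(** The [k]-th Fourier coefficient of |m|^2 on the circle of radius [r]. *)
Definition corr (r : R) k : C :=
  av (fun t => m (r%:C * cis t) * (m (r%:C * cis t))^* * ((cis t)^*) ^+ k).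

(** Only the conjugated factor is replaced by its Taylor polynomial, with an error uniform on the
    circle; what remains is a finite combination of Fourier coefficients of [m]. *)
Lemma parseval r k : 0 < r -> r < 1 ->
  corr r k = csum (fun n => (a (n + k)%N * (a n)^*) * (r ^+ (n + (n + k)))%:C).
Proof.
move=> r0 r1; have r01 : 0 <= r < 1 by rewrite ltW.
have tr := theta_lt1 (ltW r0) r1.
apply/esym; apply: csum_lim.
  apply: (@corr_csable _ _ (2 * B)) => // s n s0 s1; exact: (cf_bound mB md n s0 s1).
move=> e e0.
have KB : 0 <= 2 * (B * kap B r).
  apply: mulr_ge0 => //; apply: mulr_ge0 => //.
  exact: (kap_ge0 mB (ltW r0) r1).
have [N0 h] := geo_small KB tr e0; exists N0 => N hN.
apply: le_lt_trans (h N.+1 (leqW hN)).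
pose S z := \sum_(n < N.+1) z ^+ n * a n.
have cS : ccont (fun t => S (r%:C * cis t)).
  apply: (@ccont_sum _ N.+1 (fun n t => (r%:C * cis t) ^+ n * a n)) => n.
  apply: ccontM; last exact: ccont_cst.
  by apply: ccontX; apply: ccontM; [exact: ccont_cst|exact: ccont_cis].
have -> : \sum_(n < N.+1) (a (n + k)%N * (a n)^*) * (r ^+ (n + (n + k)))%:C =
   av (fun t => m (r%:C * cis t) * (S (r%:C * cis t))^* * ((cis t)^*) ^+ k).
  rewrite (_ : (fun t => _) = (fun t => \sum_(n < N.+1) ((a n)^* * (r ^+ n)%:C) *
     (m (r%:C * cis t) * ((cis t)^*) ^+ (n + k)))); last first.
    apply/funext => t; rewrite /S rmorph_sum mulr_sumr mulr_suml.
    apply: eq_bigr => n _; rewrite rmorphM rmorphXn rmorphM /= exprMn exprD.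
    have -> : ((r%:C)^* : C) = r%:C by rewrite conjcE /= oppr0.
    by rewrite rmorphXn; ring.
  rewrite (@av_sum _ N.+1 (fun n t => ((a n)^* * (r ^+ n)%:C) *
     (m (r%:C * cis t) * ((cis t)^*) ^+ (n + k)))).
    apply: eq_bigr => n _; rewrite avZ; last by apply: ccontM; [exact: cm|exact: ccis].
    by rewrite fourier_coef// exprD rmorphM; ring.
  move=> n; apply: ccontM; first exact: ccont_cst.
  by apply: ccontM; [exact: cm|exact: ccis].
rewrite /corr -avB; last first.
- by apply: ccontM => //; apply: ccontM; [exact: cm|exact: ccont_conj].
- by apply: ccontM => //; apply: ccontM; [exact: cm|apply: ccont_conj; exact: cm].
rewrite -mulrA; apply: av_bound.
  apply: ccontD.
    by apply: ccontM => //; apply: ccontM; [exact: cm|apply: ccont_conj; exact: cm].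
  rewrite (_ : (fun t => _) = (fun t => (-1) *
     (m (r%:C * cis t) * (S (r%:C * cis t))^* * ((cis t)^*) ^+ k))); last first.
    by apply/funext => t; rewrite mulN1r.
  apply: ccontM; first exact: ccont_cst.
  by apply: ccontM => //; apply: ccontM; [exact: cm|exact: ccont_conj].
move=> t; set z := r%:C * cis t.
have zr : nrm z = r by rewrite nrm_polar// ltW.
have z1 : nrm z < 1 by rewrite zr.
rewrite -mulrBl -mulrBr -rmorphB !nrmM nrmX !nrm_conj nrm_cis expr1n mulr1 -mulrA.
apply: ler_pM; rewrite ?nrm_ge0//; first exact: mB.
by have := taylor_error mB md N z1; rewrite zr.
Qed.

(** Starting at 1/2 keeps all these radii strictly between 0 and 1. *)
Let rho (j : nat) : R := 1 - j.+2%:R^-1.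

Let rho01 j : 0 < rho j /\ rho j < 1.
Proof.
have h1 : (0 : R) < j.+2%:R^-1 by rewrite invr_gt0.
have h2 : (j.+2%:R^-1 : R) < 1 by rewrite invf_lt1// ltr1n.
by rewrite /rho; split; move: h1 h2; move: (_^-1) => x; lra.
Qed.

Let rho_cvg : rho @ \oo --> (1 : R).
Proof.
rewrite -[X in _ --> X]subr0; apply: cvgB; first exact: cvg_cst.
have := @cvg_harmonic R; rewrite -(cvg_shiftn 1) /=.
by under eq_fun do rewrite /harmonic addn1.
Qed.

Let rhoX_cvg n : (fun j => rho j ^+ n) @ \oo --> (1 : R).
Proof.
elim: n => [|n IH]; first by under eq_fun do rewrite expr0; exact: cvg_cst.
have : (fun j => rho j * rho j ^+ n) @ \oo --> (1 * 1 : R).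
  by apply: cvgM; [exact: rho_cvg|exact: IH].
by rewrite mulr1; under eq_fun do rewrite -exprS.
Qed.

(** Radial limits of modulus 1 make |m|^2 tend to 1 almost everywhere, dominated by B^2, and the
    average of a power of the conjugate of [cis] is known. *)
Lemma corr_lim k : forall e, 0 < e -> exists N, forall j, (N <= j)%N ->
  nrm (corr (rho j) k - (k == 0%N)%:R) < e.
Proof.
have r01 j : 0 <= rho j < 1 by have [h1 h2] := rho01 j; rewrite ltW.
have -> : (k == 0%N)%:R = av (fun t => ((cis t)^*) ^+ k) :> C.
  rewrite -(@Hc_invX R 1 k ltr01) /Hc; congr av; apply/funext => t.
  by rewrite mul1r cis_conj exprVn.
apply: (@av_dct _ _ _ (B * B)) => [j| |j t|].
- by apply: ccontM => //; apply: ccontM; [exact: cm|apply: ccont_conj; exact: cm].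
- exact: ccis.
- rewrite !nrmM nrmX !nrm_conj nrm_cis expr1n mulr1.
  by apply: ler_pM; rewrite ?nrm_ge0//; apply: mB; exact: zlt.
apply: aeS m_inner => t [l [l1 hl]] e e0.
have B1 : 0 < B + 1 by rewrite ltr_wpDl.
have e1 : 0 < e / (B + 1) by rewrite divr_gt0.
have [d d0 hd] := hl _ e1.
move/cvgrPdist_lt : rho_cvg => /(_ d d0)[N _ hN]; exists N => j /hN rj.
have hz := hd (rho j) (r01 j) (le_lt_trans (ler_norm _) rj).
set z := (rho j)%:C * cis t in hz *; set u := ((cis t)^*) ^+ k.
have un : nrm u = 1 by rewrite nrmX nrm_conj nrm_cis expr1n.
have ll : l * l^* = 1 by rewrite mulconj l1 expr1n.
have -> : m z * (m z)^* * u - u = ((m z - l) * (m z)^* + l * (m z - l)^*) * u.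
  transitivity (m z * (m z)^* * u - l * l^* * u); first by rewrite ll mul1r.
  by rewrite rmorphB /=; ring.
rewrite nrmM un mulr1; apply: le_lt_trans (nrmD _ _) _.
rewrite !nrmM !nrm_conj l1 mul1r.
have mz : nrm (m z) <= B by apply: mB; exact: zlt.
move: hz; rewrite ltr_pdivlMr// => hz; apply: le_lt_trans hz.
by rewrite mulrDr mulr1 lerD2r ler_wpM2l// nrm_ge0.
Qed.

(** A partial sum damped by powers of [rho j] is at most the real part of [corr (rho j) 0], which
    tends to 1; letting [j] grow removes the damping. *)
Lemma l2_cf : l2 a.
Proof.
apply: (l2_bounded (B := 1) _).1 => N.
have key j : \sum_(0 <= n < N) nrm (a n) ^+ 2 * rho j ^+ (n + n) <= Re (corr (rho j) 0).
  have [r0 r1] := rho01 j; rewrite (parseval 0 r0 r1) /csum /=.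
  have E : (fun n => Re (a (n + 0)%N * (a n)^* * (rho j ^+ (n + (n + 0)))%:C)) =
     (fun n => nrm (a n) ^+ 2 * rho j ^+ (n + n)).
    by apply/funext => n; rewrite !addn0 mulconj -rmorphM.
  rewrite E; apply: (@nneg_series_le_lim R (fun n => nrm (a n) ^+ 2 * rho j ^+ (n + n))).
    by move=> n; rewrite mulr_ge0 ?sqr_ge0// exprn_ge0// ltW.
  rewrite -E.
  apply: csable_Re; apply: (@corr_csable _ _ (2 * B)) => // s n s0 s1.
  exact: (cf_bound mB md n s0 s1).
have cv : (fun j => \sum_(0 <= n < N) nrm (a n) ^+ 2 * rho j ^+ (n + n)) @ \oo -->
    \sum_(0 <= n < N) nrm (a n) ^+ 2.
  apply: sum_cvg => n; rewrite -[X in _ --> X]mulr1.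
  by apply: cvgM; [exact: cvg_cst|exact: rhoX_cvg].
apply/ler_addgt0Pl => e e0; have e2 : 0 < e / 2 by rewrite divr_gt0.
move/cvgrPdist_lt : cv => /(_ _ e2)[N1 _ h1]; have [N2 h2] := corr_lim 0 e2.
have g1 := h1 (maxn N1 N2) (leq_maxl _ _); have g2 := h2 (maxn N1 N2) (leq_maxr _ _).
have g3 := key (maxn N1 N2).
have g4 : Re (corr (rho (maxn N1 N2)) 0) <= 1 + e / 2.
  have := le_lt_trans (Re_le_nrm _) g2; rewrite ReD ReN /= => /ltW.
  by rewrite ler_distl => /andP[_]; rewrite addrC.
move: g1; rewrite ltr_distl => /andP[_ g1].
move: g1 g3 g4; move: (\sum_(0 <= n < N) nrm (a n) ^+ 2) (\sum_(0 <= n < N) _) (Re _) => x y z; lra.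
Qed.

Lemma ip_iter_shl k (x y : nat -> C) : l2 x -> l2 y ->
  ip (iter k sh x) y = ip x (iter k (@bs R) y).
Proof.
move=> lx; elim: k y => //= k IH y ly.
by rewrite (ip_sh (l2_iter k lx) ly) (IH _ (l2bs ly)) -iterSr.
Qed.

(** The Parseval series has two limits as the radius tends to 1: the inner product by [tannery], and
    the Kronecker delta by [corr_lim]. *)
Lemma cf_orth k : ip (iter k sh a) a = (k == 0%N)%:R.
Proof.
have la := l2_cf.
have lb : l2 (iter k (@bs R) a) by elim: k => //= k; exact: l2bs.
have bE n : iter k (@bs R) a n = a (n + k)%N.
  elim: k {lb} n => [|k IH] n; first by rewrite addn0.
  by rewrite /= /bs IH addSnnS.
rewrite ip_iter_shl// (ipC lb la).
suff -> : ip (iter k (@bs R) a) a = (k == 0%N)%:R by rewrite rmorph_nat.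
have sc := l2_csable lb la.
apply/eqP; rewrite -subr_eq0 -nrm_eq0; apply/eqP.
apply/le_anti/andP; split; last exact: nrm_ge0.
apply/ler_addgt0Pl => e e0; rewrite addr0; have e2 : 0 < e / 2 by rewrite divr_gt0.
have hx j n : 0 <= rho j ^+ (n + (n + k)) <= 1.
  have [r0 r1] := rho01 j; rewrite exprn_ge0 ?(ltW r0)//=.
  by rewrite exprn_ile1// ltW.
have [J hJ] := tannery sc hx (fun n => rhoX_cvg (n + (n + k))) e2.
have [N hN] := corr_lim k e2.
have g1 := hJ (maxn J N) (leq_maxl _ _); have g2 := hN (maxn J N) (leq_maxr _ _).
have [r0 r1] := rho01 (maxn J N).
have E : csum (fun n => iter k (@bs R) a n * (a n)^* * (rho (maxn J N) ^+ (n + (n + k)))%:C)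
   = corr (rho (maxn J N)) k.
  by rewrite (parseval k r0 r1); congr csum; apply/funext => n; rewrite bE.
rewrite E in g1.
have -> : ip (iter k (@bs R) a) a - (k == 0%N)%:R =
   (corr (rho (maxn J N)) k - (k == 0%N)%:R) - (corr (rho (maxn J N)) k - ip (iter k (@bs R) a) a).
  by ring.
by apply: le_trans (nrmD _ _) _; rewrite nrmN (splitr e); apply: lerD => //; exact: ltW.
Qed.

End InnerFunction.

Theorem theorem1 (R : realType) (m : Cx R -> Cx R)
  (hm : inner_fun m) (hdim : dim_ge2 (model m)) :
  reducible (model m) (fun x => Tm m (Tm m x)) <->
  ((forall z : Cx R, disc z -> m z = m (- z)) \/
   (exists mu : Cx R, disc mu /\
      exists p : Cx R -> Cx R, is_Hinf p /\
        (forall z : Cx R, disc z -> p z = p (- z)) /\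
        (forall z : Cx R, disc z ->
           m z = p z * ((z + mu) / (1 + mu^* * z))))).
Proof.
have [m_inf m_ae] := hm; have [holo [B bdd]] := m_inf.
have mB (z : R[i]) : nrm z < 1 -> nrm (m z : R[i]) <= B.
  by move=> hz; have := bdd z; rewrite normE lecR; apply; apply/discE.
have md (z : R[i]) : nrm z < 1 -> cder (m : R[i] -> R[i]) z.
  by move=> hz; apply: holo; apply/discE.
(* The left limit at 1 is recast as an estimate over radii in [0, 1), the form used in
   [corr_lim]. *)
have m_lim : {ae (@lebesgue_measure R), forall t : R, exists l : R[i], nrm l = 1 /\
  forall e : R, 0 < e -> exists2 d : R, 0 < d & forall r : R, 0 <= r < 1 -> 1 - r < d ->
    nrm (m (real_complex R r * cis t) - l : R[i]) < e}.
  apply: aeS m_ae => t [l [l1 hl]]; exists (l : R[i]); split.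
    by apply: complexI; rewrite -normE.
  move=> e e0; move/cvgCxP : hl => /(_ e e0).
  rewrite near_withinE => /nbhs_ballP[d /= d0 hd]; exists d => // r /andP[r0 r1] rd.
  rewrite nrmB; apply: hd => //.
  by rewrite /ball /= ger0_norm// subr_ge0 ltW.
apply: (reducible_iff (l2_cf mB md m_lim) (cf_orth mB md m_lim)) => //.
by move=> z hz; exact: (@taylor R m B mB md z hz).
Qed.
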